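(* Let $\sigma>0$ and $c>0$, and let $G$ be a probability distribution supported in $(-c,c)$ with $\int\vartheta^2\,dG(\vartheta)>0$. Let $\mathcal{G}$ be the class of random (or non-random) empirical distribution functions $\mathbb{G}_n$ of $n$ points with $\mathbb{E}\,\mathbb{G}_n=G$, and let $\Delta_{\hat G}=\bigl(\delta_{\hat G}(Y_1),\dots,\delta_{\hat G}(Y_n)\bigr)$, where $\hat G$ is the NPMLE based on $Y_1,\dots,Y_n$. Then for any $\mathbb{G}_n\in\mathcal{G}$, as $n\to\infty$, $$R(\mathbb{G}_n,\Delta_{\hat G})\le\min_{\Delta}\max_{\tilde{\mathbb{G}}_n\in\mathcal{G}}R(\tilde{\mathbb{G}}_n,\Delta)+O\!\left(\sqrt{\frac{\log n}{n}}\right),$$ where the minimum is over all decision rules $\Delta:\mathbb{R}^n\to\mathbb{R}^n$.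
   Context: For a probability distribution $H$ on $[-c,c]$, let $f_H(y)=\frac1\sigma\int\varphi\bigl(\frac{y-\vartheta}{\sigma}\bigr)\,dH(\vartheta)$, where $\varphi$ is the standard normal density, and let $\delta_H(y)=y+\sigma^2 f_H'(y)/f_H(y)$, which equals $\mathbb{E}(\vartheta\mid Y=y)$ when $\vartheta\sim H$ and $Y\mid\vartheta\sim N(\vartheta,\sigma^2)$. For each $n$, $\mathcal{G}$ consists of all random (or non-random) distribution functions $\mathbb{G}_n$ of the form $\mathbb{G}_n(t)=\frac1n\sum_{i=1}^n\mathbf{1}(\vartheta_i\le t)$, for some (possibly random, with arbitrary joint law) $\vartheta_1,\dots,\vartheta_n\in(-c,c)$, such that $\mathbb{E}\,\mathbb{G}_n=G$. The statistician observes $Y_1,\dots,Y_n$, which given $\vartheta_1,\dots,\vartheta_n$ are independent with $Y_i\sim N(\vartheta_i,\sigma^2)$; $\sigma^2$ is known. Without knowing $G$ or $\mathbb{G}_n$ he uses a measurable rule $\Delta:\mathbb{R}^n\to\mathbb{R}^n$ and sets $(\hat\vartheta_1,\dots,\hat\vartheta_n)=\Delta(Y_1,\dots,Y_n)$. The risk is $$R(\mathbb{G}_n,\Delta)=\mathbb{E}\,\frac1n\sum_{i=1}^n(\hat\vartheta_i-\vartheta_i)^2,$$ where the expectation is over $Y_1,\dots,Y_n$ and over the possibly random $\vartheta_1,\dots,\vartheta_n$. The NPMLE is $\hat G\in\arg\max_H\sum_{i=1}^n\log f_H(Y_i)$ over all probability distributions $H$ on $[-c,c]$. The $\min$ and $\max$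 are understood as infimum and supremum when not attained. *)

(* Defs.v *)
From HB Require Import structures.
From mathcomp Require Import all_boot all_order all_algebra.
From mathcomp Require Import all_classical all_reals all_analysis.

Set Implicit Arguments.
Unset Strict Implicit.
Unset Printing Implicit Defensive.

Import Order.TTheory GRing.Theory Num.Theory.
Import numFieldNormedType.Exports.

Local Open Scope classical_set_scope.
Local Open Scope ring_scope.

Section tuple_product.
Context d (T : measurableType d) (R : realType).

Definition cons_pair n (x : T * n.-tuple T) : n.+1.-tuple T :=
  [tuple of x.1 :: x.2].

Lemma measurable_cons_pair n :
  measurable_fun [set: T * n.-tuple T] (@cons_pair n).
Proof. exact: measurable_cons. Qed.

HB.instance Definition _ n := @isMeasurableFun.Build _ _ _ _
  (@cons_pair n) (@measurable_cons_pair n).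

(* The library has only the binary product measure; [tuple_prod] is the law of
   n independent coordinates, the i-th one having law [P i]; see
   [tuple_prodE]. *)
Fixpoint tuple_prod n :
    ('I_n -> probability T R) -> probability (n.-tuple T) R :=
  match n with
  | 0 => fun _ => dirac [tuple]
  | m.+1 => fun P =>
      distribution (P ord0 \x tuple_prod (fun i : 'I_m => P (lift ord0 i)))%E
                   (@cons_pair m)
  end.

Lemma measurable_tuple_box n (B : 'I_n -> set T) :
  (forall i, measurable (B i)) ->
  measurable [set y : n.-tuple T | forall i, B i (tnth y i)].
Proof.
move=> mB.
rewrite (_ : [set _ | _] =
    \bigcap_(i in [set: 'I_n]) ((fun y : n.-tuple T => tnth y i) @^-1` B i)).
  apply: fin_bigcap_measurable => [|i _]; first exact: finite_finset.
  rewrite -[X in measurable X]setTI.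
  exact: (measurable_tnth i measurableT (mB i)).
by apply/seteqP; split => y /= h i; [move=> _|]; exact: h.
Qed.

Lemma tuple_prodE n (P : 'I_n -> probability T R) (B : 'I_n -> set T) :
  (forall i, measurable (B i)) ->
  tuple_prod P [set y : n.-tuple T | forall i, B i (tnth y i)] =
  (\prod_(i < n) P i (B i))%E.
Proof.
elim: n P B => [|n IH] P B mB.
  by rewrite big_ord0 /= diracE mem_set// => -[].
rewrite big_ord_recl -IH; last by move=> i; exact: mB.
rewrite -product_measure1E//; last first.
  exact: (@measurable_tuple_box n (fun i => B (lift ord0 i))).
rewrite /= /distribution /pushforward; congr (_ _).
apply/seteqP; split => -[x y] /=.
  move=> h; split; first exact: (h ord0).
  by move=> i; have := h (lift ord0 i); rewrite tnthS.
move=> [x0 hy] i; case: (unliftP ord0 i) => [j ->|-> //].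
by rewrite tnthS.
Qed.

End tuple_product.

(* [normal_prob m s] lives on [measurableTypeR R], which has the same measurable
   sets as [R] but another display; [normal_law m s] is the same measure, seen
   on [R]. *)
Section normal_law.
Context (R : realType) (m s : R).
Local Open Scope ereal_scope.

Definition normal_law : set R -> \bar R := normal_prob m s.

Let normal_law0 : normal_law set0 = 0.
Proof. exact: (measure0 (normal_prob m s)). Qed.

Let normal_law_ge0 A : 0 <= normal_law A.
Proof. exact: (measure_ge0 (normal_prob m s)). Qed.

Let normal_law_sigma_additive : semi_sigma_additive normal_law.
Proof. exact: (@measure_semi_sigma_additive _ _ _ (normal_prob m s)). Qed.

HB.instance Definition _ := isMeasure.Build _ _ _ normal_law
  normal_law0 normal_law_ge0 normal_law_sigma_additive.

Let normal_lawT : normal_law setT = 1.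
Proof. exact: (@probability_setT _ _ _ (normal_prob m s)). Qed.

HB.instance Definition _ :=
  Measure_isProbability.Build _ _ _ normal_law normal_lawT.

End normal_law.

Section gaussian_compound_decision.
Context (R : realType).
Implicit Types (sigma c : R) (H G : probability R R) (n : nat).

Definition mixture_density sigma H (y : R) : R :=
  sigma^-1 * \int[H]_t normal_pdf 0 1 ((y - t) / sigma).

Definition posterior_mean sigma H (y : R) : R :=
  y + sigma ^+ 2 * derive1 (mixture_density sigma H) y
      / mixture_density sigma H y.

Definition decision_rule n := n.-tuple R -> n.-tuple R.

(* law of (Y_1, ..., Y_n) given (theta_1, ..., theta_n) = th *)
Definition obs_law sigma n (th : n.-tuple R) : probability (n.-tuple R) R :=
  tuple_prod (fun i => normal_law (tnth th i) sigma).

Definition squared_loss n (th th' : n.-tuple R) : R :=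
  n%:R^-1 * \sum_(i < n) (tnth th' i - tnth th i) ^+ 2.

(* A random empirical distribution function is represented by the joint law
   [mu] of the points (theta_1, ..., theta_n): the order of the points matters
   for the risk of a rule that is not permutation equivariant. *)
Definition risk sigma n (mu : probability (n.-tuple R) R)
    (D : decision_rule n) : \bar R :=
  (\int[mu]_th \int[obs_law sigma th]_y (squared_loss th (D y))%:E)%E.

Definition empirical_cdf n (th : n.-tuple R) (t : R) : R :=
  n%:R^-1 * \sum_(i < n) (tnth th i <= t)%R%:R.

Definition empirical_class c G n : set (probability (n.-tuple R) R) :=
  [set mu : probability (n.-tuple R) R |
     mu [set th : n.-tuple R | forall i, -c < tnth th i < c] = 1%E /\
     forall t, (\int[mu]_th (empirical_cdf th t)%:E)%E = G `]-oo, t]%classic].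

Arguments empirical_class c G n : clear implicits.

Definition minimax_risk sigma c G n : \bar R :=
  ereal_inf [set ereal_sup [set risk sigma mu D | mu in empirical_class c G n]
            | D in [set D : decision_rule n | measurable_fun setT D]].

Definition log_likelihood sigma n (y : n.-tuple R) H : R :=
  \sum_(i < n) ln (mixture_density sigma H (tnth y i)).

Definition is_npmle sigma c n (y : n.-tuple R) H : Prop :=
  H `[-c, c]%classic = 1%E /\
  forall H' : probability R R, H' `[-c, c]%classic = 1%E ->
    log_likelihood sigma y H' <= log_likelihood sigma y H.

Definition plugin_rule sigma n (Ghat : n.-tuple R -> probability R R) :
    decision_rule n :=
  fun y => [tuple posterior_mean sigma (Ghat y) (tnth y i) | i < n].

End gaussian_compound_decision.

Arguments empirical_class {R} c G n.

(* Main.v *)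
(** Let [k t] be the density of N(t, s^2) with respect to N(0, s^2), [marg H] the
    [H]-mixture of the [k t], [pmean H] the posterior mean and r(G) the Bayes
    risk of [G].

    Lower bound: G^n belongs to the class, and against it every rule has risk at
    least r(G), coordinate by coordinate.

    Upper bound: given th with empirical distribution [H0], the average risk of
    [pmean H0] over th is at most that of [pmean G], whose expectation is r(G).
    So it suffices to compare the plug-in rule with [pmean H0] for fixed th.
    Matching finitely many moments gives a finite net in which the NPMLE is, up
    to a factor 1 + w on |y| <= T, some [H1], whose likelihood is then almost at
    least that of [H0]. Hence exp (lam * excess loss) is at most the product of
    the factors exp (lam * excess_i) * sqrt (marg H1 / marg H0) (Y_i). The
    expectation of the product is controlled factor by factor: on average over
    [H0] the tilt costs O(lam * E gap^2), where the gap [pmean H1 - pmean H0] is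
    a central difference, with step l, of ln (marg H1 / marg H0), and the square
    root gains the squared Hellinger distance of the two marginals, which pays
    for this cost when lam is a small multiple of l^2. With x = n^(1/16),
    l = x^-2, T = 32 x and w = 1/n all remainders are O(n^(-1/2)). *)

From HB Require Import structures.
Require Import Defs.
From mathcomp Require Import all_boot all_order all_algebra.
From mathcomp Require Import all_classical all_reals all_analysis.
From mathcomp Require Import measurable_realfun ring lra.
Import Order.TTheory GRing.Theory Num.Theory.
Import numFieldNormedType.Exports.
Local Open Scope classical_set_scope.
Local Open Scope ring_scope.
Set Implicit Arguments.
Unset Strict Implicit.
Unset Printing Implicit Defensive.

(** * Integrals against densities and product laws *)

(** A posterior mean is a derivative of a log-marginal, and closeness in Hellinger distance does not
    control derivatives. A central difference with a fixed step [l] only needs values: its bias is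
    of order l^2, and the two translations it introduces disappear under the integral by translation
    invariance. The squared gap therefore costs l^-2 times the squared Hellinger distance plus an
    error l^4. Asking l^4 to be n^(-1/2) fixes l = n^(-1/8); the threshold [T] then only has to be a
    smaller power of 1/l, so that l T tends to 0, and still large enough for exp(-T) to beat every
    power of n. The choice n^(1/16) does both, and being a power of n it dominates [ln n], so that
    no logarithm is left in the bound. The excess loss enters with the first power of the
    probability, not through a supremum: the maximum over the net is replaced by the sum S of the
    exponentials, and ln S <= S / a + ln a makes the bound linear in S before any expectation is
    taken. *)

Section density.
Context d (T : measurableType d) (R : realType).
Variables (mu nu : {measure set T -> \bar R}) (q : T -> R).
Hypothesis q_ge0 : forall x, 0 <= q x.
Hypothesis mq : measurable_fun setT q.
Hypothesis nuE : forall A, measurable A -> nu A = (\int[mu]_(x in A) (q x)%:E)%E.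

Import HBNNSimple.
Local Open Scope ereal_scope.

Let mEq : measurable_fun setT (EFin \o q).
Proof. exact/measurable_EFinP. Qed.

Let density_nnsfun (h : {nnsfun T >-> R}) :
  \int[nu]_x (h x)%:E = \int[mu]_x ((h x)%:E * (q x)%:E).
Proof.
under eq_integral do rewrite fimfunE -fsumEFin//.
rewrite ge0_integral_fsum//; last 2 first.
  - by move=> r; exact/measurable_EFinP/measurableT_comp.
  - by move=> r x _; rewrite EFinM nnfun_muleindic_ge0.
under [RHS]eq_integral.
  move=> x _; rewrite fimfunE -fsumEFin// muleC ge0_mule_fsumr; last first.
    by move=> r; rewrite EFinM nnfun_muleindic_ge0.
  over.
rewrite ge0_integral_fsum//; last 2 first.
  - move=> r; apply: emeasurable_funM => //.
    by apply/measurable_EFinP/measurableT_comp.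
  - move=> r x _; apply: mule_ge0; first by rewrite lee_fin.
    by rewrite EFinM nnfun_muleindic_ge0.
apply: eq_fsbigr => r _.
rewrite integralZl_indic_nnsfun// integral_indic// setIT nuE//.
have [r0|r0] := ltP r 0%R.
  rewrite preimage_nnfun0// integral_set0 mule0 integral0_eq// => x _.
  by rewrite indicE in_set0 mulr0 mule0.
rewrite integral_mkcond -ge0_integralZl//; last 2 first.
  - by apply/(measurable_restrictT _ _).1 => //; exact: measurable_funTS.
  - by move=> x _; rewrite erestrict_ge0// => y _; rewrite lee_fin.
apply: eq_integral => x _; rewrite patchE indicE.
by case: ifPn => _; rewrite /= ?mulr1 ?mulr0 ?mule0// muleC.
Qed.

Lemma ge0_integral_density (f : T -> \bar R) :
  measurable_fun setT f -> (forall x, 0 <= f x) ->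
  \int[nu]_x f x = \int[mu]_x (f x * (q x)%:E).
Proof.
move=> mf f0; pose f_ := nnsfun_approx measurableT mf.
transitivity (lim (\int[nu]_x (f_ n x)%:E @[n --> \oo])).
  rewrite -monotone_convergence//=.
  - apply: eq_integral => x _; apply/esym/cvg_lim => //=.
    exact: cvg_nnsfun_approx.
  - by move=> n; exact/measurable_EFinP/measurable_funTS.
  - by move=> n ? _; rewrite lee_fin.
  - by move=> ? _ ? ? mn; rewrite lee_fin; exact/lefP/nd_nnsfun_approx.
under eq_fun do rewrite density_nnsfun.
rewrite -monotone_convergence//=.
- apply: eq_integral => x _; apply/cvg_lim => //=.
  under eq_fun do rewrite muleC; rewrite muleC.
  by apply: cvgeZl => //; exact: cvg_nnsfun_approx.
- move=> n; apply: emeasurable_funM => //.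
  exact/measurable_EFinP/measurable_funTS.
- by move=> n x _; rewrite mule_ge0// lee_fin.
- move=> x _ m n mn; apply: lee_wpmul2r; first by rewrite lee_fin.
  by rewrite lee_fin; exact/lefP/nd_nnsfun_approx.
Qed.

End density.

Section le_integral_nonmeasurable.
Context d (T : measurableType d) (R : realType) (mu : {measure set T -> \bar R}).
Import HBNNSimple.
Local Open Scope ereal_scope.

(** The integral of a nonnegative function is a supremum over the simple functions below it, hence
    monotone for arbitrary functions. [conditional_risk_le] applies this to the loss of a plug-in
    rule built from an arbitrary choice of maximizers. *)
Lemma ge0_le_integralT (f g : T -> \bar R) :
  (forall x, 0 <= f x) -> (forall x, f x <= g x) ->
  \int[mu]_x f x <= \int[mu]_x g x.
Proof.
move=> f0 fg; have g0 x : 0 <= g x by exact: le_trans (f0 x) (fg x).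
rewrite !ge0_integralTE//.
apply: ub_ereal_sup => _ [h hf <-]; apply: ereal_sup_ubound.
by exists h => // x; exact: le_trans (hf x) (fg x).
Qed.

End le_integral_nonmeasurable.

Section ge0_integral_EFin.
Context d (T : measurableType d) (R : realType) (mu : {measure set T -> \bar R}).
Local Open Scope ereal_scope.

Lemma ge0_integralD_EFin (f g : T -> R) :
  measurable_fun setT f -> (forall x, 0 <= f x)%R ->
  measurable_fun setT g -> (forall x, 0 <= g x)%R ->
  \int[mu]_x (f x + g x)%:E = \int[mu]_x (f x)%:E + \int[mu]_x (g x)%:E.
Proof.
move=> mf f0 mg g0; under eq_integral do rewrite EFinD.
apply: ge0_integralD => //; try by [move=> y _; rewrite lee_fin|exact/measurable_EFinP].
Qed.

Lemma ge0_integralZ_EFin (a : R) (f : T -> R) : (0 <= a)%R ->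
  measurable_fun setT f -> (forall x, 0 <= f x)%R ->
  \int[mu]_x (a * f x)%:E = a%:E * \int[mu]_x (f x)%:E.
Proof.
move=> a0 mf f0; under eq_integral do rewrite EFinM.
apply: ge0_integralZl => //; try by [move=> y _; rewrite lee_fin|exact/measurable_EFinP].
Qed.

Lemma ge0_integral_sum_EFin (I : finType) (f : I -> T -> R) :
  (forall i, measurable_fun setT (f i)) -> (forall i x, 0 <= f i x)%R ->
  \int[mu]_x (\sum_i f i x)%:E = \sum_i \int[mu]_x (f i x)%:E.
Proof.
move=> mf f0; under eq_integral do rewrite -sumEFin.
apply: ge0_integral_sum => //; first by move=> i; exact/measurable_EFinP.
by move=> i x _; rewrite lee_fin.
Qed.

End ge0_integral_EFin.

Section real_measures.
Context (R : realType).
Notation leb := (@lebesgue_measure R).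
Local Open Scope ereal_scope.

Let mshift (a : R) : measurable_fun [set: measurableTypeR R]
  ((fun x => x + a)%R : measurableTypeR R -> measurableTypeR R).
Proof. by apply: measurable_funD => //; exact: measurable_id. Qed.

(** The pushforward by the shift preserves the length of half-open intervals, and these determine
    Lebesgue measure. *)
Lemma lebesgue_measure_shift (a : R) (A : set (measurableTypeR R)) :
  measurable A -> leb ((fun x => x + a)%R @^-1` A) = leb A.
Proof.
pose m : {measure set (measurableTypeR R) -> \bar R} :=
  measure_function_pushforward__canonical__measure_function_Measure leb (mshift a).
move=> mA; apply/esym; apply: (@lebesgue_measure_unique R m) => // X [[u v] _ <-].
rewrite /m /= /pushforward (_ : _ @^-1` _ = `](u - a)%R, (v - a)%R]%classic).
  rewrite !lebesgue_measure_itv/= !lte_fin ltrD2r.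
  by case: ifPn => // _; rewrite -!EFinB; congr EFin; ring.
by apply/seteqP; split => x /=; rewrite !in_itv/= ltrBlDr lerBrDr.
Qed.

Lemma ge0_integral_lebesgue_shift (a : R) (f : R -> \bar R) :
  measurable_fun setT f -> (forall x, 0 <= f x) ->
  \int[leb]_x f (x + a)%R = \int[leb]_x f x.
Proof.
move=> mf f0.
have /= <- := @ge0_integral_pushforward _ _ _ _ _ _ (mshift a) leb setT f
  measurableT mf (fun x _ => f0 x).
apply: eq_measure_integral => A mA _; exact: lebesgue_measure_shift.
Qed.

(** The identity between the two displays of the reals pushes [normal_prob] forward to [normal_law],
    so the density of the former serves for the latter. *)
Lemma integral_normal_law (t s : R) (f : R -> \bar R) :
  measurable_fun setT f -> (forall x, 0 <= f x) ->
  \int[normal_law t s]_x f x = \int[leb]_x (f x * (normal_pdf t s x)%:E).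
Proof.
move=> mf f0.
have mi : measurable_fun [set: measurableTypeR R] (id : measurableTypeR R -> R).
  by move=> _ A mA; rewrite setTI.
transitivity (\int[normal_prob t s]_x f x).
  have /= <- := @ge0_integral_pushforward _ _ _ _ _ _ mi (normal_prob t s) setT f
    measurableT mf (fun x _ => f0 x).
  exact: eq_measure_integral.
apply: ge0_integral_density => //; first exact: normal_pdf_ge0.
exact: measurable_normal_pdf.
Qed.

(** Half-open intervals generate the Borel sets and are differences of half-lines. The class
    [empirical_class] prescribes only a mean distribution function, from which the law itself has to
    be recovered. *)
Lemma eq_probability_itvNyc (P Q : probability R R) :
  (forall t, P `]-oo, t]%classic = Q `]-oo, t]%classic) ->
  forall A, measurable A -> P A = Q A.
Proof.
move=> PQ A mA.
have PE (P' : probability R R) (u v : R) : (u <= v)%R ->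
    P' `]u, v]%classic = P' `]-oo, v]%classic - P' `]-oo, u]%classic.
  move=> uv; rewrite -(_ : `]-oo, v]%classic `\` `]-oo, u]%classic = `]u, v]%classic).
    rewrite measureD ?setIidr//; last by rewrite -ge0_fin_numE// fin_num_measure.
    by move=> x /=; rewrite !in_itv/= => /le_trans; exact.
  apply/seteqP; split => x /=; rewrite !in_itv/=.
    by move=> [-> /negP]; rewrite -ltNge => ->.
  by move=> /andP[ux ->]; split => //; apply/negP; rewrite -ltNge.
apply: (@measure_unique _ _ _ (@ocitv R) (fun k => `](- k%:R)%R, k%:R]%classic)) => //.
- by move=> ? ? ? ?; exact: ocitvI.
- by move=> k; exact: is_ocitv.
- exact: (bigcup_itvT false false).
- move=> _ [[u v] _ <-] /=; have [uv|vu] := leP u v; first by rewrite !PE// !PQ.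
  by rewrite set_itv_ge ?measure0// bnd_simp -leNgt ltW.
- by move=> k; rewrite (le_lt_trans (probability_le1 _ _)) ?ltry.
Qed.

(** With N(0, s^2) as reference, [y] enters only through exp(y t / s^2): translating [y] is an
    exponential tilt of the mixing law. *)
Definition gauss_ratio (s t y : R) : R := expR ((y * t - t ^+ 2 / 2) / s ^+ 2).

Lemma gauss_ratio_ge0 s t y : (0 <= gauss_ratio s t y)%R.
Proof. exact: expR_ge0. Qed.

Lemma measurable_gauss_ratio s t : measurable_fun setT (gauss_ratio s t).
Proof.
apply: measurableT_comp => //; apply: measurable_funM => //.
by apply: measurable_funB => //; exact: measurable_funM.
Qed.

Lemma normal_pdf_ratio (s t y : R) : s != 0%R ->
  normal_pdf t s y = (gauss_ratio s t y * normal_pdf 0 s y)%R.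
Proof.
move=> s0; rewrite !normal_pdfE// mulrCA; congr (_ * _)%R.
by rewrite /normal_fun /gauss_ratio -expRD; congr expR; field.
Qed.

Variables (s : R) (s_gt0 : (0 < s)%R).
Notation nu := (normal_law 0 s).

Lemma integral_normal_law_ratio (t : R) (f : R -> \bar R) :
  measurable_fun setT f -> (forall x, 0 <= f x) ->
  \int[normal_law t s]_x f x = \int[nu]_x (f x * (gauss_ratio s t x)%:E).
Proof.
move=> mf f0; rewrite integral_normal_law//.
under eq_integral do rewrite normal_pdf_ratio ?gt_eqF// EFinM muleA.
rewrite [RHS]integral_normal_law//.
- apply: emeasurable_funM => //; apply/measurable_EFinP.
  exact: measurable_gauss_ratio.
- by move=> x; rewrite mule_ge0// lee_fin gauss_ratio_ge0.
Qed.

Lemma integral_normal_law_shift (t : R) (f : R -> \bar R) :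
  measurable_fun setT f -> (forall x, 0 <= f x) ->
  \int[normal_law t s]_x f x = \int[nu]_x f (x + t)%R.
Proof.
move=> mf f0.
have mft : measurable_fun [set: R] (fun x : R => f (x + t)%R).
  by apply: measurableT_comp => //; exact: measurable_funD.
rewrite (integral_normal_law _ _ mf f0) (integral_normal_law 0 s mft (fun x => f0 _)).
have mg : measurable_fun [set: R] (fun x => f x * (normal_pdf t s x)%:E).
  apply: emeasurable_funM; first exact: mf.
  apply/measurable_EFinP; exact: measurable_normal_pdf.
have g0 x : 0 <= f x * (normal_pdf t s x)%:E.
  by rewrite mule_ge0// lee_fin normal_pdf_ge0.
rewrite -(ge0_integral_lebesgue_shift t mg g0).
apply: eq_integral => x _; congr (_ * _%:E).
by rewrite !normal_pdfE ?gt_eqF// /normal_fun addrK subr0.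
Qed.

Lemma integral_gauss_ratio t : \int[nu]_x (gauss_ratio s t x)%:E = 1.
Proof.
under eq_integral do rewrite -(mul1e (_)%:E).
rewrite -(@integral_normal_law_ratio t (cst 1))//=.
by rewrite integral_cst// mul1e; exact: (@probability_setT _ _ _ (normal_law t s)).
Qed.

End real_measures.

Lemma integral_probability_cst d (T : measurableType d) (R : realType)
  (P : probability T R) (r : \bar R) : (\int[P]_x r = r)%E.
Proof.
rewrite (integral_cst P measurableT r) [X in (_ * X)%E](@probability_setT _ _ _ P).
by rewrite mule1.
Qed.

Section tuple_prod_integral.
Context d (T : measurableType d) (R : realType).
Local Open Scope ereal_scope.

Lemma ge0_integral_tuple_prodS n (P : 'I_n.+1 -> probability T R)
    (F : n.+1.-tuple T -> \bar R) :
  measurable_fun setT F -> (forall x, 0 <= F x) ->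
  \int[tuple_prod P]_y F y = \int[P ord0]_x
    \int[tuple_prod (fun i => P (lift ord0 i))]_y F [tuple of x :: y].
Proof.
move=> mF F0.
have -> : \int[tuple_prod P]_y F y =
    \int[(P ord0 \x tuple_prod (fun i => P (lift ord0 i)))]_z (F \o @cons_pair _ T n) z.
  exact: (@ge0_integral_distribution _ _ _ _ _
    (P ord0 \x tuple_prod (fun i : 'I_n => P (lift ord0 i))) (@cons_pair _ T n)).
rewrite fubini_tonelli1; first by [].
  by apply: measurableT_comp => //; exact: measurable_cons_pair.
by move=> z; exact: F0.
Qed.

Lemma measurable_fun_cons_tuple n (x : T) (F : n.+1.-tuple T -> \bar R) :
  measurable_fun setT F -> measurable_fun setT (fun y : n.-tuple T => F [tuple of x :: y]).
Proof.
move=> mF; apply: (measurableT_comp mF).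
exact: (measurableT_comp (@measurable_cons_pair _ T n) (pair1_measurable x)).
Qed.

Lemma integral_tuple_prod0 (P : 'I_0 -> probability T R) (F : 0.-tuple T -> \bar R) :
  measurable_fun setT F -> \int[tuple_prod P]_y F y = F [tuple].
Proof. by move=> mF; rewrite /= integral_dirac// diracE in_setT mul1e. Qed.

Lemma integral_tuple_prod_prod n (P : 'I_n -> probability T R)
    (g : 'I_n -> T -> \bar R) :
  (forall i, measurable_fun setT (g i)) -> (forall i x, 0 <= g i x) ->
  \int[tuple_prod P]_y \prod_(i < n) g i (tnth y i) = \prod_(i < n) \int[P i]_x g i x.
Proof.
have mG m (h : 'I_m -> T -> \bar R) : (forall i, measurable_fun setT (h i)) ->
    measurable_fun setT (fun y : m.-tuple T => \prod_(i < m) h i (tnth y i)).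
  move=> mh; elim: (index_enum _) => [|j r IHr].
    rewrite (_ : (fun _ => _) = cst 1)//.
    by apply/funext => y; rewrite big_nil.
  rewrite (_ : (fun _ => _) =
      (fun y : m.-tuple T => h j (tnth y j) * \prod_(i <- r) h i (tnth y i))); last first.
    by apply/funext => y; rewrite big_cons.
  apply: emeasurable_funM => //.
  exact: (measurableT_comp (mh j) (measurable_tnth j)).
elim: n P g => [|n IH] P g mg g0.
  by rewrite integral_tuple_prod0 ?big_ord0//; exact: mG.
rewrite ge0_integral_tuple_prodS//; [|exact: mG|by move=> y; exact: prode_ge0].
under eq_integral => x _ do under eq_integral => y _ do
  (rewrite big_ord_recl; under eq_bigr => i _ do rewrite tnthS).
rewrite big_ord_recl -(IH (fun i => P (lift ord0 i)) (fun i => g (lift ord0 i)))//.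
set I := (X in _ = _ * X); have I0 : 0 <= I.
  by apply: integral_ge0 => y _; exact: prode_ge0.
rewrite [RHS]muleC -(ge0_integralZl _ measurableT (mg ord0))//.
apply: eq_integral => x _; rewrite muleC /= -ge0_integralZl//.
- exact: (mG _ (fun i => g (lift ord0 i))).
- by move=> y _; exact: prode_ge0.
Qed.

Lemma integral_tuple_prod_tnth n (P : 'I_n -> probability T R) (i : 'I_n)
    (g : T -> \bar R) :
  measurable_fun setT g -> (forall x, 0 <= g x) ->
  \int[tuple_prod P]_y g (tnth y i) = \int[P i]_x g x.
Proof.
move=> mg g0; elim: n P i => [|n IH] P i; first by case: i.
rewrite ge0_integral_tuple_prodS//; last first.
  exact: (measurableT_comp mg (measurable_tnth i)).
case: (unliftP ord0 i) => [j ->|->].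
  under eq_integral do under eq_integral do rewrite tnthS.
  by under eq_integral do rewrite IH; exact: integral_probability_cst.
by apply: eq_integral => x _; exact: (integral_probability_cst _ (g x)).
Qed.

(** With [h i] the translation by the i-th parameter, this writes the observations as parameters
    plus noise of a fixed law. *)
Lemma integral_tuple_prod_map n (P Q : 'I_n -> probability T R) (h : 'I_n -> T -> T)
    (F : n.-tuple T -> \bar R) :
  (forall i, measurable_fun setT (h i)) ->
  (forall i (g : T -> \bar R), measurable_fun setT g -> (forall x, 0 <= g x) ->
    \int[P i]_x g x = \int[Q i]_x g (h i x)) ->
  measurable_fun setT F -> (forall y, 0 <= F y) ->
  \int[tuple_prod P]_y F y =
  \int[tuple_prod Q]_y F [tuple h i (tnth y i) | i < n].
Proof.
have mmap m (k : 'I_m -> T -> T) : (forall i, measurable_fun setT (k i)) ->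
    measurable_fun setT (fun y : m.-tuple T => [tuple k i (tnth y i) | i < m]).
  move=> mk; apply/measurable_fun_tnthP => i.
  rewrite (_ : _ \o _ = k i \o (fun y : m.-tuple T => tnth y i)).
    exact: (measurableT_comp (mk i) (measurable_tnth i)).
  by apply/funext => y /=; rewrite tnth_mktuple.
move=> mh PQ; elim: n P Q h F mh PQ => [|n IH] P Q h F mh PQ mF F0.
  rewrite !integral_tuple_prod0//; last exact: (measurableT_comp mF (mmap _ _ mh)).
  by congr F; apply: eq_from_tnth => -[].
rewrite !ge0_integral_tuple_prodS//; last exact: (measurableT_comp mF (mmap _ _ mh)).
pose h' (i : 'I_n) := h (lift ord0 i).
have mh' i : measurable_fun setT (h' i) by exact: mh.
have mapS (x : T) (y : n.-tuple T) : [tuple h i (tnth [tuple of x :: y] i) | i < n.+1] =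
    [tuple of h ord0 x :: [tuple h' i (tnth y i) | i < n]].
  apply: eq_from_tnth => i; rewrite tnth_mktuple.
  by case: (unliftP ord0 i) => [j ->|->//]; rewrite !tnthS tnth_mktuple.
under eq_integral => x _.
  rewrite (IH _ (fun i => Q (lift ord0 i)) h')//; last 2 first.
    by move=> i; exact: PQ.
    exact: measurable_fun_cons_tuple.
  over.
under [RHS]eq_integral do under eq_integral do rewrite mapS.
apply: (PQ ord0 (fun x => \int[tuple_prod (fun i => Q (lift ord0 i))]_z
  F [tuple of x :: [tuple h' i (tnth z i) | i < n]])).
  apply: (@measurable_fun_fubini_tonelli_F _ _ _ _ R
    (tuple_prod (fun i => Q (lift ord0 i)))
    (fun z => F (cons_pair (z.1, [tuple h' i (tnth z.2 i) | i < n])))) => //.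
  apply: (measurableT_comp mF); apply: (measurableT_comp (@measurable_cons_pair _ T n)).
  apply: measurable_fun_pair; first exact: measurable_fst.
  exact: (measurableT_comp (mmap _ _ mh') measurable_snd).
by move=> x; exact: integral_ge0.
Qed.

End tuple_prod_integral.

(** * Elementary bounds for the exponential *)

Section exp_estimates.
Context (R : realType).
Implicit Types (x : R) (K : nat).

Lemma sum_exp_coeff_le_expR K x : 0 <= x -> series (exp_coeff x) K <= expR x.
Proof.
move=> x0; apply: nondecreasing_cvgn_le; last exact: is_cvg_series_exp_coeff.
apply/nondecreasing_seqP => n; rewrite /series/= big_nat_recr//= lerDl.
exact: exp_coeff_ge0.
Qed.

Lemma pow_fact_le_expR K x : 0 <= x -> x ^+ K / K`!%:R <= expR x.
Proof.
move=> x0; apply: le_trans (sum_exp_coeff_le_expR K.+1 x0).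
rewrite /series/= big_nat_recr//= lerDr sumr_ge0// => i _.
exact: exp_coeff_ge0.
Qed.

(** Since K! j! <= (K + j)!, the tail of the series from index [K] is dominated term by term by
    |x|^K / K! times the series of exp |x|. *)
Lemma expR_taylor K x :
  `|expR x - \sum_(k < K) x ^+ k / k`!%:R| <= `|x| ^+ K / K`!%:R * expR `|x|.
Proof.
have tail N : `|series (exp_coeff x) (K + N)%N - series (exp_coeff x) K|
    <= `|x| ^+ K / K`!%:R * expR `|x|.
  apply: (@le_trans _ _ (`|x| ^+ K / K`!%:R * series (exp_coeff `|x|) N)); last first.
    apply: ler_wpM2l; first by rewrite divr_ge0.
    exact: sum_exp_coeff_le_expR.
  rewrite /series/= (@big_cat_nat _ _ _ K)//= ?leq_addr// addrAC subrr add0r.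
  rewrite -{1}(add0n K) big_addn addKn.
  apply: le_trans (ler_norm_sum _ _ _) _; rewrite mulr_sumr; apply: ler_sum => j _.
  rewrite /exp_coeff normrM normrX normfV (ger0_norm (ler0n _ _)) addnC exprD.
  rewrite mulf_div -natrM ler_wpM2l ?mulr_ge0//.
  rewrite lef_pV2 ?posrE ?ltr0n ?muln_gt0 ?fact_gt0// ler_nat.
  by rewrite -(bin_fact (leq_addr j K)) addKn leq_pmull// bin_gt0 leq_addr.
rewrite (_ : \sum_(k < K) _ = series (exp_coeff x) K); last by rewrite /series/= big_mkord.
have cv : `|series (exp_coeff x) (K + N)%N - series (exp_coeff x) K| @[N --> \oo]
    --> `|expR x - series (exp_coeff x) K|.
  apply: cvg_norm; apply: cvgB; last exact: cvg_cst.
  rewrite (_ : (fun N => _) = [sequence series (exp_coeff x) (n + K)%N]_n).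
    by rewrite (cvg_shiftn K); exact: is_cvg_series_exp_coeff.
  by apply/funext => N /=; rewrite addnC.
rewrite -(cvg_lim _ cv)//; apply: limr_le; first by apply/cvg_ex; eexists; exact: cv.
by near=> N; exact: tail.
Unshelve. all: by end_near. Qed.

Lemma expR1_le4 : expR 1 <= 4 :> R.
Proof.
have h : expR (2^-1) <= 2 :> R.
  rewrite -[leLHS]invrK -expRN -[leRHS]invrK lef_pV2 ?posrE ?expR_gt0 ?invr_gt0//.
  by apply: le_trans (expR_ge1Dx _); lra.
have -> : expR 1 = expR 2^-1 * expR 2^-1 :> R by rewrite -expRD; congr expR; field.
have -> : 4 = 2 * 2 :> R by ring.
by apply: ler_pM => //; exact: expR_ge0.
Qed.

(** The even terms cancel, and each of the two third-order remainders is at most 4 |x|^3 / 6. *)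
Lemma expR_subN_le x : `|x| <= 1 -> `|expR x - expR (- x) - 2 * x| <= 2 * `|x| ^+ 3.
Proof.
move=> x1.
have e1 : expR `|x| <= 4 by apply: le_trans expR1_le4; rewrite ler_expR.
have := expR_taylor 3 x; have := expR_taylor 3 (- x).
rewrite normrN !big_ord_recl !big_ord0 /= !addr0 !expr0 !expr1 /=.
rewrite /bump /= !addn0 !addn1 (_ : 0`! = 1)%N// (_ : 1`! = 1)%N// (_ : 2`! = 2)%N// (_ : 3`! = 6)%N//.
set a := `|x| ^+ 3; have a0 : 0 <= a by rewrite exprn_ge0.
have : a * expR `|x| <= a * 4 by exact: ler_wpM2l.
rewrite sqrrN !ler_norml => h /andP[h1 h2] /andP[h3 h4].
apply/andP; split; nra.
Qed.

End exp_estimates.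

(** * Expectations over a compact interval *)

Section supported_expectation.
Context (R : realType) (c : R).
Implicit Types (H : probability R R) (g h : R -> R).

(** The bound is asked on [[-c, c]] only, since powers of [t] are unbounded on the line. *)
Definition bounded_meas g :=
  measurable_fun setT g /\ exists B, forall t, `|t| <= c -> `|g t| <= B.

Definition supported H := H `[-c, c]%classic = 1%E.

(** Integrating over [[-c, c]] makes every function in [bounded_meas] integrable for any [H], so
    that linearity and monotonicity carry no side condition on the support. *)
Definition expect H g : R := \int[H]_(t in `[-c, c]) g t.

Lemma bounded_meas_cst a : bounded_meas (fun=> a).
Proof. by split; [exact: measurable_cst|exists `|a|]. Qed.

Lemma bounded_meas_id : bounded_meas (fun t => t).
Proof. by split; [exact: measurable_id|exists c]. Qed.

Lemma bounded_measD g h : bounded_meas g -> bounded_meas h ->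
  bounded_meas (fun t => g t + h t).
Proof.
move=> [mg [B gB]] [mh [C hC]]; split; first exact: measurable_funD.
exists (B + C) => t tc; apply: le_trans (ler_normD _ _) _.
by apply: lerD; [exact: gB|exact: hC].
Qed.

Lemma bounded_measM g h : bounded_meas g -> bounded_meas h ->
  bounded_meas (fun t => g t * h t).
Proof.
move=> [mg [B gB]] [mh [C hC]]; split; first exact: measurable_funM.
exists (B * C) => t tc; rewrite normrM.
by apply: ler_pM => //; [exact: gB|exact: hC].
Qed.

Lemma bounded_measN g : bounded_meas g -> bounded_meas (fun t => - g t).
Proof.
move=> [mg [B gB]]; split; first exact: measurableT_comp.
by exists B => t tc; rewrite normrN; exact: gB.
Qed.

Lemma bounded_measB g h : bounded_meas g -> bounded_meas h ->
  bounded_meas (fun t => g t - h t).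
Proof. by move=> ? ?; apply: bounded_measD => //; exact: bounded_measN. Qed.

Lemma bounded_measX g n : bounded_meas g -> bounded_meas (fun t => g t ^+ n).
Proof.
move=> [mg [B gB]]; split; first exact: measurable_funX.
exists (B ^+ n) => t tc; rewrite normrX.
by apply: lerXn2r; rewrite ?nnegrE ?(le_trans (normr_ge0 _) (gB _ tc))//; exact: gB.
Qed.

Lemma bounded_meas_expR g : bounded_meas g -> bounded_meas (fun t => expR (g t)).
Proof.
move=> [mg [B gB]]; split; first exact: measurableT_comp.
exists (expR B) => t tc; rewrite ger0_norm ?expR_ge0// ler_expR.
exact: le_trans (ler_norm _) (gB _ tc).
Qed.

Lemma integrable_expect H g : bounded_meas g ->
  H.-integrable `[-c, c]%classic (EFin \o g).
Proof.
move=> [mg [B gB]]; apply: measurable_bounded_integrable => //.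
- by apply: (le_lt_trans (probability_le1 _ _)) => //; exact: ltry.
- exact: measurable_funTS.
exists B; split; first exact: num_real.
move=> x Bx t /=; rewrite in_itv/= => tc; apply: le_trans (ltW Bx).
by apply: gB; rewrite ler_norml.
Qed.

Lemma expectD H g h : bounded_meas g -> bounded_meas h ->
  expect H (fun t => g t + h t) = expect H g + expect H h.
Proof. by move=> bg bh; apply: RintegralD => //; exact: integrable_expect. Qed.

Lemma expectB H g h : bounded_meas g -> bounded_meas h ->
  expect H (fun t => g t - h t) = expect H g - expect H h.
Proof. by move=> bg bh; apply: RintegralB => //; exact: integrable_expect. Qed.

Lemma expectZ H a g : bounded_meas g -> expect H (fun t => a * g t) = a * expect H g.
Proof. by move=> bg; apply: RintegralZl => //; exact: integrable_expect. Qed.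

Lemma expect_sum H n (g : 'I_n -> R -> R) : (forall i, bounded_meas (g i)) ->
  bounded_meas (fun t => \sum_(i < n) g i t) /\
  expect H (fun t => \sum_(i < n) g i t) = \sum_(i < n) expect H (g i).
Proof.
elim: n g => [|n IH] g bg.
  rewrite (_ : (fun=> _) = (fun=> 0)); last by apply/funext => t; rewrite big_ord0.
  split; first exact: bounded_meas_cst.
  by rewrite big_ord0 /expect Rintegral_cst// mul0r.
rewrite (_ : (fun=> _) = (fun t => g ord0 t + \sum_(i < n) g (lift ord0 i) t)); last first.
  by apply/funext => t; rewrite big_ord_recl.
have [b e] := IH (fun i => g (lift ord0 i)) (fun i => bg _).
split; first exact: bounded_measD.
by rewrite expectD// e big_ord_recl.
Qed.

Lemma le_expect H g h : bounded_meas g -> bounded_meas h ->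
  (forall t, `|t| <= c -> g t <= h t) -> expect H g <= expect H h.
Proof.
move=> bg bh gh; apply: le_Rintegral => //; [exact: integrable_expect..|].
by move=> t /=; rewrite in_itv/= => tc; apply: gh; rewrite ler_norml.
Qed.

Lemma eq_expect H g h : (forall t, `|t| <= c -> g t = h t) -> expect H g = expect H h.
Proof.
move=> gh; apply: eq_Rintegral => t; rewrite inE/= in_itv/= => tc.
by apply: gh; rewrite ler_norml.
Qed.

Lemma expect_ge0 H g : (forall t, `|t| <= c -> 0 <= g t) -> 0 <= expect H g.
Proof.
move=> g0; apply: Rintegral_ge0 => t /=; rewrite in_itv/= => tc.
by apply: g0; rewrite ler_norml.
Qed.

Lemma norm_expect_le H g h : bounded_meas g -> bounded_meas h ->
  (forall t, `|t| <= c -> `|g t| <= h t) -> `|expect H g| <= expect H h.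
Proof.
move=> bg bh gh.
apply: (le_trans (le_normr_Rintegral (measurable_itv _) (integrable_expect H bg))).
apply: le_expect => //; split; first by case: bg => mg _; exact: measurableT_comp.
by case: bg => _ [B gB]; exists B => t tc; rewrite normr_id; exact: gB.
Qed.

Lemma expect_cst H a : supported H -> expect H (fun=> a) = a.
Proof.
move=> HI; rewrite /expect Rintegral_cst// [X in fine X](_ : _ = 1%E) ?mulr1//.
Qed.

Lemma supportedC0 H : supported H -> H (~` `[-c, c]%classic) = 0%E.
Proof. by move=> HI; rewrite probability_setC// [X in (_ - X)%E]HI subee. Qed.

Lemma integral_expectE H (g : R -> \bar R) : supported H ->
  measurable_fun setT g ->
  (\int[H]_t g t = \int[H]_(t in `[(- c)%R, c]) g t)%E.
Proof.
move=> HI mg; rewrite [RHS]integral_mkcond; apply: ae_eq_integral => //.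
  by apply/(measurable_restrictT _ _).1 => //; exact: measurable_funTS.
exists (~` `[-c, c]%classic); split => //; first exact: measurableC.
  exact: supportedC0.
move=> t /= h ti; apply: h => _.
by rewrite patchE mem_set.
Qed.

Lemma Rintegral_expectE H g : supported H -> measurable_fun setT g ->
  \int[H]_t g t = expect H g.
Proof.
move=> HI mg; rewrite /expect /Rintegral (integral_expectE HI)//.
exact/measurable_EFinP.
Qed.

Lemma EFin_expect H g : supported H -> bounded_meas g ->
  ((expect H g)%:E = \int[H]_t (g t)%:E)%E.
Proof.
move=> HI bg; rewrite (integral_expectE HI); last by apply/measurable_EFinP; case: bg.
rewrite /expect /Rintegral fineK//.
exact: integrable_fin_num (integrable_expect H bg).
Qed.

End supported_expectation.

(** * Marginal densities and posterior means *)

Lemma is_derive_affine (R : realType) (a b x : R) :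
  is_derive x 1 (fun x : R => a * x + b) a.
Proof. by apply: (@is_derive_eq _ _ _ (a \*: id + cst b)); rewrite addr0 /GRing.scale/= mulr1. Qed.

Lemma ln_sub_le (R : realType) (m a b : R) : 0 < m -> m <= a -> m <= b ->
  ln a - ln b <= `|a - b| / m.
Proof.
move=> m0 ma mb; have a0 := lt_le_trans m0 ma; have b0 := lt_le_trans m0 mb.
rewrite -ln_div ?posrE//; apply: (@le_trans _ _ ((a - b) / b)).
  rewrite mulrBl divff ?gt_eqF// -[X in ln X](subrKC 1) le_ln1Dx//.
  by have := divr_gt0 a0 b0; lra.
apply: (@le_trans _ _ (`|a - b| / b)).
  by rewrite ler_wpM2r ?invr_ge0 ?ler_norm// ltW.
by rewrite ler_wpM2l// lef_pV2 ?posrE.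
Qed.

Lemma norm_ln_sub_le (R : realType) (m a b : R) : 0 < m -> m <= a -> m <= b ->
  `|ln a - ln b| <= `|a - b| / m.
Proof.
move=> m0 ma mb; rewrite ler_norml lerNl opprB ln_sub_le// andbT.
by rewrite distrC ln_sub_le.
Qed.

Section posterior.
Context (R : realType) (s c : R) (s_gt0 : 0 < s) (c_gt0 : 0 < c).
Implicit Types (H : probability R R) (g : R -> R) (y : R).
Notation k := (gauss_ratio s).
Notation E := (expect c).
Notation bm := (bounded_meas c).

Definition marg H y : R := E H (fun t => k t y).
Definition tmarg H y : R := E H (fun t => t * k t y).
Definition pmean H y : R := tmarg H y / marg H y.

Let s2_gt0 : 0 < s ^+ 2. Proof. exact: exprn_gt0. Qed.

Lemma measurable_gauss_ratio_mean y : measurable_fun setT (fun t => k t y).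
Proof.
apply: measurableT_comp => //; apply: measurable_funM => //.
apply: measurable_funB; first exact: measurable_funM.
by apply: measurable_funM => //; exact: measurable_funX.
Qed.

Lemma gauss_ratio_le t y : `|t| <= c -> k t y <= expR (`|y| * c / s ^+ 2).
Proof.
move=> tc; rewrite ler_expR; apply: ler_wpM2r; first by rewrite invr_ge0 ltW.
apply: (@le_trans _ _ (y * t)); first by rewrite gerBl divr_ge0// sqr_ge0.
by apply: le_trans (ler_norm _) _; rewrite normrM ler_wpM2l.
Qed.

Lemma gauss_ratio_ge t y : `|t| <= c ->
  expR (- ((`|y| * c + c ^+ 2 / 2) / s ^+ 2)) <= k t y.
Proof.
move=> tc; rewrite ler_expR -mulNr; apply: ler_wpM2r; first by rewrite invr_ge0 ltW.
rewrite opprD; apply: lerD.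
  rewrite lerNl; apply: le_trans (ler_norm _) _.
  by rewrite normrN normrM ler_wpM2l.
by rewrite lerN2 ler_wpM2r// -[t ^+ 2]real_normK ?num_real// lerXn2r ?nnegrE// ltW.
Qed.

Lemma bounded_meas_gauss_ratio y : bm (fun t => k t y).
Proof.
split; first exact: measurable_gauss_ratio_mean.
exists (expR (`|y| * c / s ^+ 2)) => t tc.
by rewrite ger0_norm ?gauss_ratio_ge0// gauss_ratio_le.
Qed.

Hint Resolve bounded_meas_gauss_ratio : core.

Lemma marg_ge H y : supported c H ->
  expR (- ((`|y| * c + c ^+ 2 / 2) / s ^+ 2)) <= marg H y.
Proof.
move=> HI; rewrite -[leLHS](expect_cst _ HI); apply: le_expect => //.
  exact: bounded_meas_cst.
by move=> t; exact: gauss_ratio_ge.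
Qed.

Lemma marg_gt0 H y : supported c H -> 0 < marg H y.
Proof. by move=> /(marg_ge y); apply: lt_le_trans; exact: expR_gt0. Qed.

Lemma norm_tmarg_le H y : supported c H -> `|tmarg H y| <= c * marg H y.
Proof.
move=> HI; rewrite -expectZ//; apply: norm_expect_le.
- by apply: bounded_measM => //; exact: bounded_meas_id.
- by apply: bounded_measM => //; exact: bounded_meas_cst.
- by move=> t tc; rewrite normrM (ger0_norm (gauss_ratio_ge0 _ _ _)) ler_wpM2r// gauss_ratio_ge0.
Qed.

Lemma norm_pmean_le H y : supported c H -> `|pmean H y| <= c.
Proof.
move=> HI; rewrite normrM normfV (ger0_norm (ltW (marg_gt0 y HI))).
by rewrite ler_pdivrMr ?marg_gt0// norm_tmarg_le.
Qed.

Lemma tmargE H y : supported c H -> tmarg H y = pmean H y * marg H y.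
Proof. by move=> HI; rewrite divfK// gt_eqF// marg_gt0. Qed.

Lemma is_derive_gauss_ratio t y :
  is_derive y 1 (fun x => k t x) (t / s ^+ 2 * k t y).
Proof.
have h := is_derive_affine (t / s ^+ 2) (- (t ^+ 2 / 2 / s ^+ 2)) y.
have := is_derive1_comp (is_derive_expR _) h.
rewrite (_ : _ \o _ = fun x => k t x); last first.
  by apply/funext => x /=; rewrite /gauss_ratio; congr expR; field; rewrite gt_eqF.
move=> D; suff -> : t / s ^+ 2 * k t y =
  expR (t / s ^+ 2 * y - t ^+ 2 / 2 / s ^+ 2) * (t / s ^+ 2) by [].
by rewrite mulrC; congr (_ * _); rewrite /gauss_ratio; congr expR; field; rewrite gt_eqF.
Qed.

Lemma derive_expect_gauss_ratio H g y : bm g ->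
  derivable (fun x => E H (fun t => g t * k t x)) y 1 /\
  derive1 (fun x => E H (fun t => g t * k t x)) y =
    E H (fun t => g t * t * k t y) / s ^+ 2.
Proof.
move=> bg.
have bgk x : bm (fun t => g t * k t x) by exact: bounded_measM.
have df (x t : R) : is_derive x 1 (fun x : R => g t * k t x) (g t * (t / s ^+ 2 * k t x)).
  by apply: (is_derive_eq (is_deriveZ (g t) (is_derive_gauss_ratio t x))).
have yI : `]y - 1, y + 1[%classic y by rewrite /= in_itv/=; apply/andP; split; lra.
have [B gB] := bg.2.
have B0 : 0 <= B by apply: le_trans (normr_ge0 _) (gB 0 _); rewrite normr0 ltW.
(* Dominates the derivative of the integrand uniformly in |t| <= c and in the points at distance
   less than 1 from [y]. *)
pose D := B * (c / s ^+ 2 * expR ((`|y| + 1) * c / s ^+ 2)).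
have D0 : 0 <= D by rewrite mulr_ge0// mulr_ge0 ?expR_ge0// divr_ge0// ltW.
have dfE (x t : R) : partial1of2 (fun x t : R => g t * k t x) x t = g t * (t / s ^+ 2 * k t x).
  by rewrite partial1of2E; exact: derive_val.
have Gub (x t : R) : `]y - 1, y + 1[%classic x -> `[-c, c]%classic t ->
    `|partial1of2 (fun x t : R => g t * k t x) x t| <= D.
  rewrite /= !in_itv/= -ler_norml => /andP[x1 x2] tc; rewrite dfE !normrM.
  apply: ler_pM => //; first exact: gB.
  apply: ler_pM => //.
    by rewrite normfV (gtr0_norm s2_gt0) ler_wpM2r// invr_ge0 ltW.
  rewrite (ger0_norm (gauss_ratio_ge0 _ _ _)).
  apply: le_trans (gauss_ratio_le _ tc) _.
  rewrite ler_expR ler_wpM2r ?invr_ge0 ?(ltW s2_gt0)// ler_wpM2r ?(ltW c_gt0)//.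
  have xy : `|x - y| <= 1 by rewrite ler_norml; lra.
  by have := ler_normD (x - y) y; rewrite subrK; lra.
have int (x : R) : H.-integrable `[- c, c]%classic (EFin \o (fun t => g t * k t x)).
  exact: integrable_expect.
have intD : H.-integrable `[- c, c]%classic (EFin \o cst D).
  by apply: integrable_expect; exact: bounded_meas_cst.
have dd (x t : R) : `]y - 1, y + 1[%classic x -> `[-c, c]%classic t ->
    derivable (fun x : R => g t * k t x) x 1.
  by move=> _ _; exact: ex_derive.
split.
  exact: (derivable_under_integral (measurable_itv _) yI (fun x _ => int x) dd (fun=> D0) intD Gub).
rewrite [LHS](differentiation_under_integral (measurable_itv _) yI (fun x _ => int x) dd (fun=> D0) intD Gub).
rewrite mulrC -expectZ; last by apply: bounded_measM => //; exact: bounded_measM (bounded_meas_id c).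
by apply: eq_expect => t _; rewrite dfE; field; rewrite gt_eqF.
Qed.

Lemma continuous_expect_gauss_ratio H g : bm g ->
  continuous (fun y => E H (fun t => g t * k t y)).
Proof.
move=> bg y; apply: differentiable_continuous.
by apply/derivable1_diffP; have [] := derive_expect_gauss_ratio H y bg.
Qed.

Lemma marg1E H : marg H = fun y => E H (fun t => 1 * k t y).
Proof. by apply/funext => y; apply: eq_expect => t _; rewrite mul1r. Qed.

Lemma measurable_marg H : measurable_fun setT (marg H).
Proof.
rewrite marg1E; apply: continuous_measurable_fun.
by apply: continuous_expect_gauss_ratio; exact: bounded_meas_cst.
Qed.

Lemma measurable_pmean H : supported c H -> measurable_fun setT (pmean H).
Proof.
move=> HI; apply: continuous_measurable_fun => y; apply: cvgM.
  by apply: continuous_expect_gauss_ratio; exact: bounded_meas_id.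
apply: cvgV; first by rewrite gt_eqF// marg_gt0.
rewrite marg1E.
by apply: continuous_expect_gauss_ratio; exact: bounded_meas_cst.
Qed.

Lemma mixture_densityE H y : supported c H ->
  mixture_density s H y = s^-1 * normal_pdf 0 1 (y / s) * marg H y.
Proof.
move=> HI; rewrite /mixture_density -mulrA; congr (_ * _).
rewrite -expectZ// -(Rintegral_expectE HI); last first.
  by apply: measurable_funM => //; exact: measurable_gauss_ratio_mean.
apply: eq_Rintegral => t _; rewrite !normal_pdfE ?oner_eq0// -mulrA; congr (_ * _).
rewrite /normal_fun /gauss_ratio -expRD; congr expR; field.
by rewrite gt_eqF.
Qed.

Lemma is_derive_normal_pdf_scaled y :
  is_derive y 1 (fun y => s^-1 * normal_pdf 0 1 (y / s))
    (- (y / s ^+ 2) * (s^-1 * normal_pdf 0 1 (y / s))).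
Proof.
have D := is_derive1_comp (is_derive_expR _)
  (is_deriveZ (- (2 * s ^+ 2)^-1) (is_deriveX 2 (is_derive_id y (1 : R)))).
rewrite (_ : (fun _ => _) = (s^-1 * normal_peak 1) \*:
    (expR \o (- (2 * s ^+ 2)^-1 \*: (id ^+ 2)))); last first.
  apply/funext => x; rewrite normal_pdfE ?oner_eq0//.
  transitivity (s^-1 * normal_peak 1 * expR (- (2 * s ^+ 2)^-1 * x ^+ 2)); last by [].
  rewrite -mulrA /normal_fun; congr (_ * (_ * expR _)); field; by rewrite gt_eqF.
apply: (is_derive_eq (is_deriveZ _ D)).
rewrite normal_pdfE ?oner_eq0// /GRing.scale/=.
rewrite (_ : normal_fun 0 1 (y / s) = expR (- (2 * s ^+ 2)^-1 * y ^+ 2)); last first.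
  by rewrite /normal_fun; congr expR; field; rewrite gt_eqF.
transitivity (s^-1 * normal_peak 1 * (expR (- (2 * s ^+ 2)^-1 * y ^+ 2) *
  (- (2 * s ^+ 2)^-1 * (2 * y ^+ 1 * 1)))); first by [].
by field; rewrite gt_eqF.
Qed.

(** Tweedie's formula: the mixture density is the N(0, s^2) density times [marg H]. The logarithmic
    derivative of the first factor is - y / s^2, which cancels the leading [y]; that of the second
    is [pmean H y / s ^+ 2]. *)
Lemma posterior_meanE H y : supported c H -> posterior_mean s H y = pmean H y.
Proof.
move=> HI; rewrite /posterior_mean (_ : mixture_density s H =
   (fun y => s^-1 * normal_pdf 0 1 (y / s)) * marg H); last first.
  by apply/funext => x; rewrite mixture_densityE.
have [dm dmE] := derive_expect_gauss_ratio H y (bounded_meas_cst c 1).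
have Dm : is_derive y 1 (marg H) (tmarg H y / s ^+ 2).
  rewrite marg1E; apply: DeriveDef => //; rewrite -derive1E dmE; congr (_ / _).
  by apply: eq_expect => t _; rewrite mul1r.
have D := is_deriveM (is_derive_normal_pdf_scaled y) Dm.
rewrite derive1E (derive_val (is_derive := D)) /GRing.scale/= !fctE.
have q0 : s^-1 * normal_pdf 0 1 (y / s) != 0.
  rewrite mulf_neq0 ?invr_neq0 ?gt_eqF// normal_pdfE ?oner_eq0//.
  by rewrite mulr_gt0 ?expR_gt0// normal_peak_gt0// oner_eq0.
set q := s^-1 * _; rewrite -/q in q0.
rewrite tmargE//; field.
by rewrite q0 !gt_eqF// marg_gt0.
Qed.

(** Passing from [y] to [y + l] multiplies [k t] by exp(l t / s^2), which is at least exp(- |l| c /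
    s^2) when |t| <= c. *)
Lemma marg_shift_le H l y : supported c H ->
  marg H y <= expR (`|l| * c / s ^+ 2) * marg H (y + l).
Proof.
move=> HI; rewrite -expectZ//; apply: le_expect => //.
  by apply: bounded_measM => //; exact: bounded_meas_cst.
move=> t tc; rewrite -expRD ler_expR -mulrDl; apply: ler_wpM2r; first by rewrite invr_ge0 ltW.
rewrite mulrDl -addrA [leRHS]addrC -!addrA lerD2l.
have : - (l * t) <= `|l| * c; last by lra.
by apply: le_trans (ler_norm _) _; rewrite normrN normrM ler_wpM2l.
Qed.

(* Both exponential moments of the centred variable [w] are at least [1] and
   they differ by a third-order term. *)
Lemma central_difference_ln_marg H l y : supported c H -> 0 < l ->
  2 * l * c / s ^+ 2 <= 1 ->
  `|ln (marg H (y + l)) - ln (marg H (y - l)) - 2 * l * pmean H y / s ^+ 2|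
    <= 2 * (2 * l * c / s ^+ 2) ^+ 3.
Proof.
move=> HI l0 lc.
pose a := l * pmean H y / s ^+ 2.
pose w t := l * t / s ^+ 2 - a.
have bw : bm w.
  rewrite /w; apply: bounded_measB; last exact: bounded_meas_cst.
  apply: bounded_measM; last exact: bounded_meas_cst.
  by apply: bounded_measM; [exact: bounded_meas_cst|exact: bounded_meas_id].
have bwN : bm (fun t => - w t) by exact: bounded_measN.
have bwk : bm (fun t => w t * k t y) by exact: bounded_measM.
have s2i : 0 <= (s ^+ 2)^-1 by rewrite invr_ge0 ltW.
have wc t : `|t| <= c -> `|w t| <= 2 * l * c / s ^+ 2.
  move=> tc; rewrite (_ : 2 * l * c / s ^+ 2 = l * c / s ^+ 2 + l * c / s ^+ 2); last by ring.
  apply: le_trans (ler_normB _ _) _.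
  rewrite /a !normrM (gtr0_norm l0) (ger0_norm s2i).
  apply: lerD; rewrite ler_wpM2r// ler_wpM2l ?(ltW l0)//.
  by rewrite -normrM; exact: norm_pmean_le.
have Ewk : E H (fun t => w t * k t y) = 0.
  rewrite (@eq_expect _ _ _ _ (fun t => l / s ^+ 2 * (t * k t y) - a * k t y)); last first.
    by move=> t _; rewrite /w; field; rewrite gt_eqF.
  have b1 : bm (fun t => t * k t y) by apply: bounded_measM => //; exact: bounded_meas_id.
  rewrite expectB ?expectZ//; last 2 first.
    by apply: bounded_measM => //; exact: bounded_meas_cst.
    by apply: bounded_measM => //; exact: bounded_meas_cst.
  by rewrite -/(tmarg H y) -/(marg H y) tmargE// /a; field; rewrite gt_eqF.
pose A v := E H (fun t => expR (v * w t) * k t y).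
have bvw v : bm (fun t => v * w t) by apply: bounded_measM => //; exact: bounded_meas_cst.
have bA v : bm (fun t => expR (v * w t) * k t y).
  by apply: bounded_measM => //; exact: bounded_meas_expR.
(* Tilting by [v * w] translates [y] by [v * l], up to the constant that comes from the centring of
   [w]. *)
have AE v : A v = marg H (y + v * l) * expR (- (v * a)).
  rewrite mulrC -[RHS](expectZ _ (expR _) (bounded_meas_gauss_ratio _)).
  apply: eq_expect => t _.
  by rewrite /gauss_ratio -!expRD; congr expR; rewrite /w; field; rewrite gt_eqF.
have bvwk v : bm (fun t => v * (w t * k t y)) by apply: bounded_measM => //; exact: bounded_meas_cst.
have Age v : marg H y <= A v.
  rewrite -[leLHS]addr0 -(mulr0 v) -Ewk -expectZ// -expectD//; apply: le_expect => //.
    exact: bounded_measD.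
  move=> t _; rewrite -[X in X + _]mul1r mulrA -mulrDl ler_wpM2r ?gauss_ratio_ge0//.
  exact: expR_ge1Dx.
have AB : `|A 1 - A (- 1)| <= 2 * (2 * l * c / s ^+ 2) ^+ 3 * marg H y.
  (* Subtracting twice [Ewk], which is 0, removes the linear term and leaves the cubic remainder of
     [expR_subN_le]. *)
  rewrite -[A 1 - _]subr0 -(mulr0 2) -Ewk -expectZ// -expectB// -expectB//; last exact: bounded_measB.
  rewrite -expectZ//; apply: norm_expect_le.
  - by apply: bounded_measB => //; exact: bounded_measB.
  - by apply: bounded_measM => //; exact: bounded_meas_cst.
  move=> t tc; rewrite mulrA -!mulrBl normrM (ger0_norm (gauss_ratio_ge0 _ _ _)).
  rewrite ler_wpM2r ?gauss_ratio_ge0// mul1r mulN1r.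
  apply: le_trans (expR_subN_le (le_trans (wc _ tc) lc)) _.
  by rewrite ler_wpM2l// lerXn2r ?nnegrE ?wc// (le_trans (normr_ge0 _) (wc _ tc)).
have lnA v : ln (A v) = ln (marg H (y + v * l)) - v * a.
  by rewrite AE lnM ?posrE ?expR_gt0 ?marg_gt0// expRK.
have := norm_ln_sub_le (marg_gt0 y HI) (Age 1) (Age (-1)).
have -> : ln (A 1) - ln (A (-1)) =
    ln (marg H (y + l)) - ln (marg H (y - l)) - 2 * l * pmean H y / s ^+ 2.
  rewrite (lnA 1) (lnA (-1)) !mul1r !mulN1r /a.
  by move: (ln _) (ln _) (pmean H y) => u v p; ring.
by move=> /le_trans; apply; rewrite ler_pdivrMr// marg_gt0.
Qed.

(** As a function of the action, the weighted loss is a quadratic with leading coefficient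
    [marg H y] and vertex [pmean H y]. *)
Lemma expect_pmean_le H y (a : R) : supported c H ->
  E H (fun t => (pmean H y - t) ^+ 2 * k t y) <= E H (fun t => (a - t) ^+ 2 * k t y).
Proof.
move=> HI.
have b2 : bm (fun t => t ^+ 2 * k t y).
  by apply: bounded_measM => //; apply: bounded_measX; exact: bounded_meas_id.
have b1 : bm (fun t => t * k t y) by apply: bounded_measM => //; exact: bounded_meas_id.
have bZ (x : R) h : bm h -> bm (fun t => x * h t).
  by move=> bh; apply: bounded_measM => //; exact: bounded_meas_cst.
have eE x : E H (fun t => (x - t) ^+ 2 * k t y) =
    x ^+ 2 * marg H y - 2 * x * tmarg H y + E H (fun t => t ^+ 2 * k t y).
  rewrite -(expectZ H (x ^+ 2) (bounded_meas_gauss_ratio y)).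
  rewrite -(expectZ H (2 * x) b1) -expectB; [|exact: bZ|exact: bZ].
  rewrite -expectD//; last by apply: bounded_measB; exact: bZ.
  by apply: eq_expect => t _; ring.
rewrite !eE lerD2r tmargE//.
have := mulr_ge0 (sqr_ge0 (a - pmean H y)) (ltW (marg_gt0 y HI)).
by set m := marg H y; set p := pmean H y; nra.
Qed.

End posterior.

(** * A finite net of marginal densities *)

Section covering.
Context (R : realType) (s c : R) (s_gt0 : 0 < s) (c_gt0 : 0 < c).
Implicit Types (H : probability R R) (y T : R).
Notation k := (gauss_ratio s).
Notation E := (expect c).
Notation bm := (bounded_meas c).

Definition damping (t : R) : R := expR (- (t ^+ 2 / 2 / s ^+ 2)).

(** Expanding exp(y t / s^2) in powers of [t] expresses [marg] and [tmarg] through these numbers: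
    [damping] is the factor of [k t y] free of [y], and dividing by [c] keeps the moments in
    [-1, 1]. *)
Definition moment H n : R := E H (fun t => (t / c) ^+ n * damping t).

Let s2_gt0 : 0 < s ^+ 2. Proof. exact: exprn_gt0. Qed.

Lemma damping_le1 t : damping t <= 1.
Proof. by rewrite expR_le1 oppr_le0 !divr_ge0// sqr_ge0. Qed.

Lemma bounded_meas_moment n : bm (fun t => (t / c) ^+ n * damping t).
Proof.
apply: bounded_measM.
  by apply: bounded_measX; apply: bounded_measM; [exact: bounded_meas_id|exact: bounded_meas_cst].
apply: bounded_meas_expR; apply: bounded_measN; apply: bounded_measM; last exact: bounded_meas_cst.
by apply: bounded_measM; [apply: bounded_measX; exact: bounded_meas_id|exact: bounded_meas_cst].
Qed.

Lemma norm_moment_le1 H n : supported c H -> `|moment H n| <= 1.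
Proof.
move=> HI; rewrite -(expect_cst 1 HI); apply: norm_expect_le.
- exact: bounded_meas_moment.
- exact: bounded_meas_cst.
move=> t tc; rewrite normrM -[leRHS]mulr1; apply: ler_pM => //; last first.
  by rewrite ger0_norm ?expR_ge0// damping_le1.
rewrite normrX exprn_ile1// normrM normfV (gtr0_norm c_gt0).
by rewrite ler_pdivrMr// mul1r.
Qed.

(** The case i = 0 is meant for [marg], the case i = 1 for [tmarg]. The error is the Taylor
    remainder of exp(y t / s^2), whose exponent is at most T c / s^2. *)
Lemma expect_gauss_ratio_moments H T y i K : supported c H -> `|y| <= T ->
  `|E H (fun t => t ^+ i * k t y) -
    c ^+ i * \sum_(j < K) (y * c / s ^+ 2) ^+ j / j`!%:R * moment H (j + i)%N|
  <= c ^+ i * ((T * c / s ^+ 2) ^+ K / K`!%:R * expR (T * c / s ^+ 2)).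
Proof.
move=> HI yT; set X := T * c / s ^+ 2.
have T0 : 0 <= T := le_trans (normr_ge0 _) yT.
have X0 : 0 <= X by rewrite divr_ge0 ?mulr_ge0// ltW.
pose F (j : 'I_K) t := c ^+ i * ((y * c / s ^+ 2) ^+ j / j`!%:R) * ((t / c) ^+ (j + i) * damping t).
have bF j : bm (F j).
  by apply: bounded_measM; [exact: bounded_meas_cst|exact: bounded_meas_moment].
have [bS eS] := expect_sum H bF.
have btk : bm (fun t => t ^+ i * k t y).
  apply: bounded_measM; last exact: bounded_meas_gauss_ratio.
  by apply: bounded_measX; exact: bounded_meas_id.
have -> : c ^+ i * \sum_(j < K) (y * c / s ^+ 2) ^+ j / j`!%:R * moment H (j + i)%N =
    E H (fun t => \sum_(j < K) F j t).
  rewrite eS mulr_sumr; apply: eq_bigr => j _; rewrite mulrA.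
  by rewrite /F -expectZ//; exact: bounded_meas_moment.
rewrite -expectB// -[leRHS](expect_cst _ HI); apply: norm_expect_le.
- exact: bounded_measB.
- exact: bounded_meas_cst.
move=> t tc; pose v := y * t / s ^+ 2.
have vX : `|v| <= X.
  rewrite !normrM normfV (gtr0_norm s2_gt0) ler_wpM2r ?invr_ge0 ?(ltW s2_gt0)//.
  exact: ler_pM.
have -> : t ^+ i * k t y - \sum_(j < K) F j t =
    t ^+ i * damping t * (expR v - \sum_(j < K) v ^+ j / j`!%:R).
  rewrite mulrBr; congr (_ - _).
    by rewrite -mulrA -expRD /gauss_ratio; congr (_ * expR _); rewrite /v; field; rewrite gt_eqF.
  rewrite mulr_sumr; apply: eq_bigr => j _; rewrite /F /v exprD !exprMn !exprVn.
  field; rewrite !expf_neq0 ?gt_eqF//= ltr0n fact_gt0.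
rewrite !normrM normrX; apply: ler_pM => //.
- rewrite -[leRHS]mulr1; apply: ler_pM => //.
    by rewrite lerXn2r ?nnegrE// ltW.
  by rewrite ger0_norm ?expR_ge0// damping_le1.
apply: le_trans (expR_taylor K v) _.
apply: ler_pM; rewrite ?expR_ge0 ?ler_expR//.
by rewrite ler_wpM2r ?invr_ge0// lerXn2r ?nnegrE.
Qed.

(** Two Taylor remainders, plus the moment differences weighted by the terms of an exponential
    series. *)
Lemma expect_gauss_ratio_close H H' T y i K (eta : R) : supported c H -> supported c H' ->
  0 <= eta -> `|y| <= T -> (forall j, (j < K + i)%N -> `|moment H j - moment H' j| <= eta) ->
  `|E H (fun t => t ^+ i * k t y) - E H' (fun t => t ^+ i * k t y)| <=
  c ^+ i * (2 * ((T * c / s ^+ 2) ^+ K / K`!%:R * expR (T * c / s ^+ 2)) +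
    eta * expR (T * c / s ^+ 2)).
Proof.
move=> HI HI' eta0 yT He.
have h := expect_gauss_ratio_moments i K HI yT.
have h' := expect_gauss_ratio_moments i K HI' yT.
have T0 : 0 <= T := le_trans (normr_ge0 _) yT.
set X := T * c / s ^+ 2 in h h' *.
have X0 : 0 <= X by rewrite divr_ge0 ?mulr_ge0// ltW.
have ci0 : 0 <= c ^+ i by rewrite exprn_ge0// ltW.
set eps := X ^+ K / K`!%:R * expR X in h h' *.
set S := \sum_(j < K) _ in h; set S' := \sum_(j < K) _ in h'.
have SS : `|S - S'| <= eta * expR X.
  rewrite -sumrB; apply: le_trans (ler_norm_sum _ _ _) _.
  apply: (@le_trans _ _ (\sum_(j < K) eta * exp_coeff X j)).
    apply: ler_sum => j _; rewrite -mulrBr normrM mulrC ler_pM//.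
      by rewrite He// ltn_add2r.
    rewrite /exp_coeff/= normrM normrX normfV (ger0_norm (ler0n _ _)) ler_wpM2r ?invr_ge0//.
    rewrite lerXn2r ?nnegrE// !normrM normfV (gtr0_norm s2_gt0) (gtr0_norm c_gt0).
    by rewrite ler_wpM2r ?invr_ge0 ?(ltW s2_gt0)// ler_wpM2r// ltW.
  rewrite -mulr_sumr ler_wpM2l//; apply: le_trans (sum_exp_coeff_le_expR K X0).
  by rewrite /series/= big_mkord.
move: (E H _) (E H' _) h h' => e e' h h'.
have -> : e - e' = (e - c ^+ i * S) - (e' - c ^+ i * S') + c ^+ i * (S - S') by ring.
apply: le_trans (ler_normD _ _) _; rewrite [leRHS]mulrDr; apply: lerD.
  apply: le_trans (ler_normB _ _) _; apply: le_trans (lerD h h') _.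
  by rewrite mulrA (mulrC _ 2) -mulrA mulr2n mulrDl mul1r.
by rewrite normrM (ger0_norm ci0) ler_wpM2l.
Qed.

(** The moments are rounded down to a grid of mesh [eta], so two laws in one cell have moments
    within [eta]. Each occupied cell is represented by a law lying in it, which keeps the net inside
    the supported laws. *)
Lemma moment_net K (eta : R) : 0 < eta ->
  exists (J : finType) (Hs : J -> probability R R),
    [/\ forall j, supported c (Hs j), (0 < #|J|)%N,
        #|J|%:R <= (2 / eta + 1) ^+ K
      & forall H, supported c H -> exists j,
          forall i, (i < K)%N -> `|moment H i - moment (Hs j) i| <= eta].
Proof.
move=> eta0; pose N := Num.truncn (2 / eta).
pose q H : {ffun 'I_K -> 'I_N.+1} :=
  [ffun i : 'I_K => inord (Num.truncn ((moment H i + 1) / eta))].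
have ex (j : {ffun 'I_K -> 'I_N.+1}) : exists H',
    supported c H' /\ forall H, supported c H -> q H = j -> q H' = j.
  have [[H [HI qH]]|nH] := pselect (exists H, supported c H /\ q H = j).
    by exists H; split.
  (* Default value for an empty cell. *)
  exists (\d_(0 : R)); split.
    rewrite /supported /= diracE mem_set//= in_itv/=.
    by rewrite oppr_le0 !ltW.
  by move=> H HI qH; case: nH; exists H.
pose Hs j := sval (cid (ex j)).
have HsP j := svalP (cid (ex j)).
exists {ffun 'I_K -> 'I_N.+1}, Hs; split.
- by move=> j; case: (HsP j).
- by rewrite card_ffun !card_ord expn_gt0.
- rewrite card_ffun !card_ord natrX lerXn2r ?nnegrE//.
    by rewrite addr_ge0// divr_ge0// ltW.
  by rewrite -natr1 lerD2r truncn_le divr_ge0// ltW.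
move=> H HI; exists (q H) => i iK.
have [HsI /(_ H HI erefl) qE] := HsP (q H); rewrite -/(Hs (q H)) in HsI qE *.
have := congr1 (fun f : {ffun 'I_K -> 'I_N.+1} => f (Ordinal iK)) qE; rewrite !ffunE.
have nn H' : supported c H' -> 0 <= (moment H' i + 1) / eta.
  move=> /(norm_moment_le1 i); rewrite ler_norml => /andP[h _].
  by rewrite divr_ge0 ?(ltW eta0)//; lra.
have lt H' : supported c H' -> (Num.truncn ((moment H' i + 1) / eta) < N.+1)%N.
  move=> /(norm_moment_le1 i); rewrite ler_norml => /andP[_ h].
  by rewrite ltnS le_truncn// ler_wpM2r ?invr_ge0 ?(ltW eta0)//; lra.
move=> /(congr1 val); rewrite /= !inordK ?lt// => tE.
have /andP[a1 a2] := truncn_itv (nn _ HI).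
have /andP[] := truncn_itv (nn _ HsI); rewrite tE => b1 b2.
rewrite -natr1 in a2 b2.
have -> : moment H i - moment (Hs (q H)) i =
   ((moment H i + 1) / eta - (moment (Hs (q H)) i + 1) / eta) * eta.
  by rewrite -mulrBl divfK ?gt_eqF//; ring.
rewrite normrM (gtr0_norm eta0) -[leRHS]mul1r ler_wpM2r ?(ltW eta0)//.
by rewrite ler_norml; apply/andP; split; lra.
Qed.

(** With p m and p' m' for the numerators, p - p' is ((p m - p' m') - p (m - m')) / m', and |p| <= c
    makes each part at most [c * w]. *)
Lemma pmean_close H H' (w y : R) : supported c H -> supported c H' ->
  `|marg s c H y - marg s c H' y| <= w * marg s c H' y ->
  `|tmarg s c H y - tmarg s c H' y| <= c * (w * marg s c H' y) ->
  `|pmean s c H y - pmean s c H' y| <= 2 * c * w.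
Proof.
move=> HI HI' mm tt.
have m0 := marg_gt0 s_gt0 c_gt0 y HI; have m0' := marg_gt0 s_gt0 c_gt0 y HI'.
have pc := norm_pmean_le s_gt0 c_gt0 y HI.
rewrite tmargE// (tmargE s_gt0 c_gt0 y HI') in tt.
move: mm tt m0 m0' pc.
move: (marg s c H y) (marg s c H' y) (pmean s c H y) (pmean s c H' y) => m m' p p'.
move=> mm tt m0 m0' pc.
have -> : p - p' = ((p * m - p' * m') - p * (m - m')) / m' by field; rewrite gt_eqF.
rewrite normrM normfV (gtr0_norm m0') ler_pdivrMr//.
apply: le_trans (ler_normB _ _) _.
have := ler_pM (normr_ge0 _) (normr_ge0 _) pc mm; rewrite -normrM => h.
by apply: le_trans (lerD tt h) _; rewrite le_eqVlt; apply/orP; left; apply/eqP; ring.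
Qed.

(** On |y| <= T every marginal is at least exp(- A) with [A] affine in [T], so the relative
    precision [w] follows from the absolute precision w exp(- A). For this, both the number of
    moments and the logarithm of the number of grid points per moment can be taken linear in T - ln
    w; the logarithm of the size of the net is their product. *)
Lemma marginal_net : exists2 C : R, 0 < C & forall T w : R, 1 <= T -> 0 < w -> w <= 1 ->
  exists (J : finType) (Hs : J -> probability R R),
    [/\ forall j, supported c (Hs j), (0 < #|J|)%N,
        ln #|J|%:R <= C * (T - ln w) ^+ 2
      & forall H, supported c H -> exists j, forall y, `|y| <= T ->
          `|marg s c H y - marg s c (Hs j) y| <= w * marg s c (Hs j) y /\
          `|pmean s c H y - pmean s c (Hs j) y| <= 2 * c * w].
Proof.
pose kap := c / s ^+ 2; pose b := c ^+ 2 / 2 / s ^+ 2.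
have kap0 : 0 < kap by rewrite divr_gt0.
have b0 : 0 <= b by rewrite !divr_ge0// sqr_ge0.
(* Each of the two factors is at most (6 kap + b + 6) (T - ln w); the additive constants are
   absorbed by T >= 1. *)
exists ((6 * kap + b + 6) ^+ 2); first by rewrite exprn_gt0//; lra.
move=> T w T1 w0 w1.
have T0 : 0 <= T by lra.
have lnw : ln w <= 0 by exact: ln_le0.
pose X := T * c / s ^+ 2; have XE : X = kap * T by rewrite /X /kap; ring.
have X0 : 0 <= X by rewrite XE mulr_ge0// ltW.
pose A := X + b.
(* Since X^K / K! <= exp(4 X - K), this order makes X^K / K! times exp(X + A) smaller than w
   exp(-3). *)
have [K K1 K2] : exists2 K : nat, 5 * X + A - ln w + 3 < K%:R &
    K%:R <= 5 * X + A - ln w + 4.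
  have X5 : 0 <= 5 * X + A - ln w + 3 by rewrite /A; lra.
  have /andP[h1 h2] := truncn_itv X5.
  by exists (Num.truncn (5 * X + A - ln w + 3)).+1 => //; rewrite -natr1; lra.
(* Half of the precision is left to the Taylor remainders; the moments get the other half, as eta
   exp(X + A) = w / 2. The net below controls K + 1 moments because [tmarg] involves one more than
   [marg]. *)
pose eta := w * expR (- (X + A)) / 2.
have eta0 : 0 < eta by rewrite divr_gt0// mulr_gt0// expR_gt0.
have [J [Hs [HsI J0 cJ net]]] := @moment_net K.+1 eta eta0.
exists J, Hs; split => //.
  have e1 : 2 / eta + 1 <= expR (5 + X + A - ln w).
    have -> : expR (5 + X + A - ln w) = expR 5 * (expR (X + A) / w).
      by rewrite expRB lnK ?posrE// -addrA expRD mulrA.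
    have -> : 2 / eta = 4 * (expR (X + A) / w).
      by rewrite /eta expRN; field; rewrite !gt_eqF ?expR_gt0.
    have : 1 <= expR (X + A) / w.
      rewrite ler_pdivlMr// mul1r (le_trans w1)// -expR0 ler_expR.
      by rewrite !addr_ge0.
    have : 1 + 5 <= expR 5 :> R by exact: expR_ge1Dx.
    by move: (expR 5) (expR (X + A) / w); clear - s_gt0 c_gt0 s2_gt0 => e f; nra.
  apply: (@le_trans _ _ (ln (expR (5 + X + A - ln w) ^+ K.+1))).
    rewrite ler_ln ?posrE ?exprn_gt0 ?expR_gt0 ?ltr0n//.
    apply: le_trans cJ _; rewrite lerXn2r// nnegrE ?expR_ge0//.
    by rewrite addr_ge0// divr_ge0// ltW.
  rewrite lnXn ?expR_gt0// expRK -[_ *+ K.+1]mulr_natl -exprMn expr2.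
  have nlw : 0 <= - ln w by rewrite oppr_ge0.
  have aux (n m : R) : 0 <= n -> m <= 6 * (kap * T) + b + n + 5 ->
      m <= (6 * kap + b + 6) * (T + n).
    move=> n0; have p1 := mulr_ge0 (ltW kap0) n0; have p2 := mulr_ge0 b0 n0.
    have p3 : 0 <= b * (T - 1) by rewrite mulr_ge0// subr_ge0.
    by move: n0 p1 p2 p3 T1; clear - s_gt0 c_gt0 s2_gt0; nra.
  have kT : 0 <= kap * T by rewrite mulr_ge0// ltW.
  have n1 : 0 <= 5 + X + A - ln w by rewrite !addr_ge0.
  apply: ler_pM => //; apply: aux => //.
    by rewrite -[K.+1%:R]natr1; move: K2; rewrite /A XE; clear - s_gt0 c_gt0 s2_gt0; lra.
  by move: kT; rewrite /A XE; clear - s_gt0 c_gt0 s2_gt0; lra.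
move=> H HI; have [j jH] := net _ HI; exists j => y yT.
pose eps := X ^+ K / K`!%:R * expR X.
have epsA : 2 * eps * expR A <= w / 2.
  have h1 : X ^+ K / K`!%:R <= expR (4 * X - K%:R).
    have := pow_fact_le_expR K (mulr_ge0 (ler0n R 4) X0).
    rewrite exprMn -mulrA expRB => h.
    rewrite ler_pdivlMr ?expR_gt0// (le_trans _ h)// mulrC.
    rewrite ler_wpM2r ?divr_ge0 ?exprn_ge0// -[K%:R]mulr1 expRM_natl.
    by rewrite lerXn2r ?nnegrE ?expR_ge0// expR1_le4.
  have h2 : expR (4 * X - K%:R) * expR X * expR A <= w / 4.
    rewrite -!expRD; apply: (@le_trans _ _ (expR (ln w - 3))).
      by rewrite ler_expR; move: K1; clear - s_gt0 c_gt0 s2_gt0; lra.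
    rewrite expRB lnK ?posrE// ler_wpM2l ?(ltW w0)// lef_pV2 ?posrE ?expR_gt0//.
    by apply: le_trans (expR_ge1Dx _); clear - s_gt0 c_gt0 s2_gt0; lra.
  have h3 : eps * expR A <= expR (4 * X - K%:R) * expR X * expR A.
    by rewrite !ler_wpM2r ?expR_ge0.
  by rewrite -mulrA; move: h2 h3; clear - s_gt0 c_gt0 s2_gt0; lra.
have etaA : eta * expR X * expR A = w / 2.
  by rewrite /eta expRN expRD; field; rewrite !gt_eqF ?expR_gt0.
have wE : 2 * eps + eta * expR X <= w * expR (- A).
  rewrite -ler_pdivrMr ?expR_gt0// -expRN opprK.
  by move: epsA etaA; clear - s_gt0 c_gt0 s2_gt0; lra.
have mA : expR (- A) <= marg s c (Hs j) y.
  apply: le_trans (marg_ge s_gt0 c_gt0 y (HsI j)); rewrite ler_expR lerN2.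
  rewrite mulrDl; apply: lerD => //.
  by rewrite ler_wpM2r ?invr_ge0 ?(ltW s2_gt0)// ler_wpM2r ?(ltW c_gt0).
have clo i : (i <= 1)%N -> `|E H (fun t => t ^+ i * k t y) - E (Hs j) (fun t => t ^+ i * k t y)|
   <= c ^+ i * (w * marg s c (Hs j) y).
  move=> i1; apply: le_trans (expect_gauss_ratio_close (K := K) HI (HsI j) (ltW eta0) yT _) _.
    by move=> l lK; apply: jH; apply: leq_trans lK _; rewrite -(addn1 K) leq_add2l.
  rewrite -/X; apply: ler_wpM2l; first by rewrite exprn_ge0// ltW.
  exact: (le_trans wE (ler_wpM2l (ltW w0) mA)).
have m0 := clo 0%N isT; have m1 := clo 1%N isT.
have mE H' : E H' (fun t => t ^+ 0 * k t y) = marg s c H' y.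
  by apply: eq_expect => t _; rewrite expr0 mul1r.
have tE H' : E H' (fun t => t ^+ 1 * k t y) = tmarg s c H' y by [].
rewrite !mE expr0 mul1r in m0; rewrite !tE expr1 in m1.
by split => //; exact: pmean_close.
Qed.

End covering.

(** * Hellinger control of the excess loss *)

Section hellinger.
Context (R : realType).

(** exp x is at least 1 + x + x^2 / 2, whose inverse is at most 1 - x + x^2 / 2 because the product
    of the two polynomials is 1 + x^4 / 4. *)
Lemma expR_sub_ge (x : R) : 0 <= x -> 2 * x <= expR x - expR (- x).
Proof.
move=> x0; have := sum_exp_coeff_le_expR 3 x0.
rewrite /series/= /exp_coeff/= !big_nat_recr//= big_geq// add0r !expr0 !expr1.
rewrite (_ : 0`! = 1)%N// (_ : 1`! = 1)%N// (_ : 2`! = 2)%N// !divr1 => h.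
have x2 := sqr_ge0 x.
have a0 : 0 < 1 + x + x ^+ 2 / 2 by lra.
have : expR (- x) <= 1 - x + x ^+ 2 / 2; last by move: h; clear; lra.
rewrite expRN; apply: (@le_trans _ _ (1 + x + x ^+ 2 / 2)^-1).
  by rewrite lef_pV2 ?posrE ?expR_gt0.
rewrite -[leLHS]mul1r ler_pdivrMr//.
have -> : (1 - x + x ^+ 2 / 2) * (1 + x + x ^+ 2 / 2) = 1 + (x ^+ 2 / 2) ^+ 2 by field.
by rewrite lerDl sqr_ge0.
Qed.

(** The geometric mean is at most the logarithmic mean: with x half of ln r - ln q, (r - q)^2 equals
    r q (exp x - exp(- x))^2. *)
Lemma mul_sqr_ln_le (r q : R) : 0 < r -> 0 < q ->
  r * q * (ln r - ln q) ^+ 2 <= (r - q) ^+ 2.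
Proof.
wlog qr : r q / q <= r => [h r0 q0|r0 q0].
  have [|/ltW] := leP q r; first by move=> ?; exact: h.
  move=> rq; rewrite [r * q]mulrC -sqrrN opprB -[leRHS]sqrrN opprB; exact: h.
pose x := (ln r - ln q) / 2.
have x0 : 0 <= x by rewrite divr_ge0// subr_ge0 ler_ln.
have rE : r = q * expR x * expR x.
  rewrite -mulrA -expRD (_ : x + x = ln r - ln q); last by rewrite /x; field.
  by rewrite expRB !lnK// mulrCA divff ?mulr1// gt_eqF.
have -> : ln r - ln q = 2 * x by rewrite /x; field.
have h := expR_sub_ge x0.
have h2 : (2 * x) ^+ 2 <= (expR x - expR (- x)) ^+ 2.
  have x20 : 0 <= 2 * x by rewrite mulr_ge0.
  by rewrite lerXn2r ?nnegrE// (le_trans x20 h).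
have -> : (r - q) ^+ 2 = r * q * (expR x - expR (- x)) ^+ 2.
  rewrite rE expRN; field; by rewrite gt_eqF// expR_gt0.
by rewrite ler_wpM2l// mulr_ge0// ltW.
Qed.

End hellinger.

Section regret_hellinger.
Context (R : realType) (s c : R) (s_gt0 : 0 < s) (c_gt0 : 0 < c).
Variables (H0 H1 : probability R R).
Hypotheses (H0c : supported c H0) (H1c : supported c H1).
Notation k := (gauss_ratio s).

Definition sqrt_marg (H : probability R R) y := Num.sqrt (marg s c H y).

Notation r0 := (sqrt_marg H0).
Notation r1 := (sqrt_marg H1).
Definition pmean_gap y := pmean s c H1 y - pmean s c H0 y.
Definition log_gap y := ln (marg s c H1 y) - ln (marg s c H0 y).
(** The central-difference remainders of both marginals, rescaled by s^2 / (2 l) and squared: a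
    quantity of order l^4. The leading 3 comes from squaring a sum of three terms. *)
Definition difference_error (l : R) :=
  3 * (s ^+ 2 / (2 * l)) ^+ 2 * (4 * (2 * l * c / s ^+ 2) ^+ 3) ^+ 2.
Definition sqr_hellinger y := (r1 y - r0 y) ^+ 2.

Let s2_gt0 : 0 < s ^+ 2. Proof. exact: exprn_gt0. Qed.

Lemma sqrt_marg_gt0 H y : supported c H -> 0 < sqrt_marg H y.
Proof. by move=> HI; rewrite sqrtr_gt0 marg_gt0. Qed.

Lemma sqr_sqrt_marg H y : supported c H -> sqrt_marg H y ^+ 2 = marg s c H y.
Proof. by move=> HI; rewrite sqr_sqrtr// ltW// marg_gt0. Qed.

Lemma sqrt_marg_shift_le H l y : supported c H ->
  sqrt_marg H y <= expR (`|l| * c / s ^+ 2 / 2) * sqrt_marg H (y + l).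
Proof.
move=> HI; rewrite -ler_sqr ?nnegrE ?mulr_ge0 ?expR_ge0 ?sqrtr_ge0//.
rewrite exprMn (sqr_sqrt_marg _ HI) (sqr_sqrt_marg _ HI).
have -> : expR (`|l| * c / s ^+ 2 / 2) ^+ 2 = expR (`|l| * c / s ^+ 2).
  by rewrite -expRM_natl; congr expR; field; rewrite gt_eqF.
exact: marg_shift_le.
Qed.

Lemma log_marg_hellinger y :
  r0 y * r1 y * log_gap y ^+ 2 <= 4 * sqr_hellinger y.
Proof.
rewrite /log_gap -!sqr_sqrt_marg// !lnXn ?sqrt_marg_gt0//.
have := mul_sqr_ln_le (sqrt_marg_gt0 y H1c) (sqrt_marg_gt0 y H0c).
rewrite /sqr_hellinger mulrC; move: (ln (r1 y)) (ln (r0 y)) => u v.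
have -> : u *+ 2 - v *+ 2 = 2 * (u - v) by ring.
rewrite exprMn => h.
by move: h; move: (r0 y) (r1 y) => a b; clear - s_gt0 c_gt0 s2_gt0; lra.
Qed.

(** The log gaps are evaluated at y + l and y - l, so the weight is moved there too. The roots
    change by at most exp(|l| c / s^2), and [k (- l) y], the density that will undo the translation
    under the integral, is not small for |y| <= T; together they cost a factor exp 1 <= 4. *)
Lemma shifted_weight_le (l T y : R) :
  `|l| * (c + T + `|l|) / s ^+ 2 <= 1 -> `|y| <= T ->
  r0 y * r1 y <= 4 * (k (- l) y * (r0 (y + l) * r1 (y + l))).
Proof.
move=> lT yT; rewrite mulrA.
apply: (@le_trans _ _ (expR (`|l| * c / s ^+ 2) * (r0 (y + l) * r1 (y + l)))).
  have -> : expR (`|l| * c / s ^+ 2) =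
      expR (`|l| * c / s ^+ 2 / 2) * expR (`|l| * c / s ^+ 2 / 2).
    by rewrite -expRD; congr expR; field; rewrite gt_eqF.
  rewrite mulrACA; apply: ler_pM; rewrite ?sqrtr_ge0//; exact: sqrt_marg_shift_le.
rewrite ler_wpM2r ?mulr_ge0 ?sqrtr_ge0//.
apply: (@le_trans _ _ (expR 1 * k (- l) y)); last first.
  by rewrite ler_wpM2r ?gauss_ratio_ge0// expR1_le4.
rewrite -expRD ler_expR; apply: le_trans (lerD lT (lexx _)).
rewrite -mulrDl ler_wpM2r ?invr_ge0 ?(ltW s2_gt0)//.
have h1 : y * l <= `|l| * T.
  by apply: le_trans (ler_norm _) _; rewrite normrM mulrC ler_wpM2l.
have h2 : `|l| * `|l| = l ^+ 2 by rewrite -expr2 real_normK ?num_real.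
have h3 := sqr_ge0 l.
rewrite sqrrN mulrN !mulrDr h2; move: h1 h3; move: (`|l| * T) (`|l| * c) (y * l) (l ^+ 2).
clear - s_gt0 c_gt0 s2_gt0 => *; lra.
Qed.

Lemma norm_pmean_gap_le y : `|pmean_gap y| <= 2 * c.
Proof.
apply: le_trans (ler_normB _ _) _; rewrite mulr2n mulrDl mul1r.
by apply: lerD; exact: norm_pmean_le.
Qed.

Lemma sqr_pmean_gap_le (l y : R) : 0 < l -> 2 * l * c / s ^+ 2 <= 1 ->
  pmean_gap y ^+ 2 <= 3 * s ^+ 4 / (4 * l ^+ 2) *
    (log_gap (y + l) ^+ 2 + log_gap (y - l) ^+ 2) + difference_error l.
Proof.
move=> l0 lc; set u := log_gap.
have h1 := central_difference_ln_marg s_gt0 c_gt0 y H1c l0 lc.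
have h0 := central_difference_ln_marg s_gt0 c_gt0 y H0c l0 lc.
set B := 2 * (2 * l * c / s ^+ 2) ^+ 3 in h0 h1.
have uB : `|u (y + l) - u (y - l) - 2 * l * pmean_gap y / s ^+ 2| <= 2 * B.
  have -> : 2 * B = B + B by ring.
  apply: le_trans (lerD h1 h0); rewrite /u /log_gap /pmean_gap.
  apply: le_trans (ler_normB _ _); rewrite le_eqVlt; apply/orP; left; apply/eqP; congr `|_|.
  move: (ln _) (ln _) (ln _) (ln _) (pmean s c H1 y) (pmean s c H0 y).
  move=> *; field; by rewrite gt_eqF.
(* [e] is the joint remainder of the two central differences, and [eE] solves its definition for the
   gap. *)
have [e eB eE] : exists2 e : R, e ^+ 2 <= (2 * B) ^+ 2 &
    pmean_gap y = s ^+ 2 / (2 * l) * (u (y + l) - u (y - l) - e).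
  exists (u (y + l) - u (y - l) - 2 * l * pmean_gap y / s ^+ 2).
    by rewrite -[leLHS]real_normK ?num_real// lerXn2r ?nnegrE// (le_trans _ uB).
  move: (u _) (u _) (pmean_gap y); move=> *; field; by rewrite !gt_eqF.
rewrite eE exprMn; move: (u (y + l)) (u (y - l)) => a b.
have abe : (a - b - e) ^+ 2 <= 3 * (a ^+ 2 + b ^+ 2) + 3 * (2 * B) ^+ 2.
  have := sqr_ge0 (a + b); have := sqr_ge0 (a + e); have := sqr_ge0 (b - e).
  move: eB; move: ((2 * B) ^+ 2); clear - s_gt0 c_gt0 s2_gt0 => B2 *; nra.
apply: le_trans (ler_wpM2l (sqr_ge0 _) abe) _.
rewrite le_eqVlt; apply/orP; left; apply/eqP; rewrite /B /difference_error.
by field; rewrite !gt_eqF.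
Qed.

Lemma pmean_gap_hellinger (l T y : R) : 0 < l -> 0 <= T ->
  l * (c + T + l) / s ^+ 2 <= 1 -> 2 * l * c / s ^+ 2 <= 1 ->
  pmean_gap y ^+ 2 * (r0 y * r1 y) <=
    12 * s ^+ 4 / l ^+ 2 * (k (- l) y * sqr_hellinger (y + l) + k l y * sqr_hellinger (y - l))
    + (difference_error l + 4 * c ^+ 2 * (expR (- T) * (expR y + expR (- y))))
      * (r0 y * r1 y).
Proof.
move=> l0 T0 lT lc.
set W := r0 y * r1 y; have W0 : 0 <= W by rewrite mulr_ge0 ?sqrtr_ge0.
have e0 : 0 <= difference_error l.
  by rewrite mulr_ge0 ?sqr_ge0// mulr_ge0 ?sqr_ge0.
have t0 : 0 <= 4 * c ^+ 2 * (expR (- T) * (expR y + expR (- y))).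
  apply: mulr_ge0; first by rewrite mulr_ge0// sqr_ge0.
  by rewrite mulr_ge0 ?addr_ge0 ?expR_ge0.
have kh0 : 0 <= k (- l) y * sqr_hellinger (y + l) + k l y * sqr_hellinger (y - l).
  by rewrite addr_ge0// mulr_ge0 ?gauss_ratio_ge0 ?sqr_ge0.
have C0 : 0 <= 3 * s ^+ 4 / (4 * l ^+ 2).
  by rewrite divr_ge0 ?mulr_ge0 ?exprn_ge0// ltW.
(* Beyond [T] the gap is only known to be at most 2 c, and exp(- T) (exp y + exp(- y)) >= 1 pays for
   it. *)
have [yT|yT] := leP `|y| T; last first.
  have gap4 : pmean_gap y ^+ 2 <= 4 * c ^+ 2.
    rewrite (_ : 4 * c ^+ 2 = (2 * c) ^+ 2); last by ring.
    rewrite -[leLHS]real_normK ?num_real// lerXn2r ?nnegrE ?norm_pmean_gap_le//.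
    by rewrite mulr_ge0// ltW.
  have eT : 1 <= expR (- T) * (expR y + expR (- y)).
    rewrite expRN mulrC ler_pdivlMr ?expR_gt0// mul1r.
    apply: (@le_trans _ _ (expR `|y|)); first by rewrite ler_expR ltW.
    by have [?|?] := ger0P y; rewrite ?lerDl ?lerDr expR_ge0.
  apply: (@le_trans _ _ (4 * c ^+ 2 * (expR (- T) * (expR y + expR (- y))) * W)).
    rewrite ler_wpM2r//; apply: le_trans gap4 _.
    by rewrite ler_peMr// mulr_ge0// sqr_ge0.
  rewrite -[leLHS]add0r; apply: lerD; last by rewrite ler_wpM2r// lerDr.
  apply: mulr_ge0 => //.
  by rewrite divr_ge0 ?mulr_ge0 ?exprn_ge0// ltW.
have nl : `|l| = l by rewrite gtr0_norm.
have nNl : `|- l| = l by rewrite normrN gtr0_norm.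
have w1 : W <= 4 * (k (- l) y * (r0 (y + l) * r1 (y + l))).
  by apply: (@shifted_weight_le l T y) => //; rewrite nl.
have w2 : W <= 4 * (k l y * (r0 (y - l) * r1 (y - l))).
  by rewrite -[X in k X y]opprK; apply: (@shifted_weight_le (- l) T y) => //; rewrite nNl.
have g1 := log_marg_hellinger (y + l); have g2 := log_marg_hellinger (y - l).
have hg := sqr_pmean_gap_le y l0 lc.
have := ler_wpM2r W0 hg => /le_trans; apply.
set q1 := sqr_hellinger (y + l) in g1 kh0 *; set q2 := sqr_hellinger (y - l) in g2 kh0 *.
(* The 16 is 4 from moving the weight times 4 from [log_marg_hellinger]; multiplied by 3/4 it gives
   the 12 of the statement. *)
have wg (p a b u q : R) : 0 <= p -> W <= 4 * (p * a) -> a * u ^+ 2 <= 4 * q ->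
    u ^+ 2 * W <= 16 * (p * q).
  move=> p0 Wa aq; apply: (@le_trans _ _ (u ^+ 2 * (4 * (p * a)))).
    by rewrite ler_wpM2l// sqr_ge0.
  have := ler_wpM2l p0 aq; move: (u ^+ 2); clear - s_gt0 c_gt0 s2_gt0 => *; lra.
have v1 := wg _ _ 0 _ _ (gauss_ratio_ge0 s (- l) y) w1 g1.
have v2 := wg _ _ 0 _ _ (gauss_ratio_ge0 s l y) w2 g2.
rewrite [leLHS]mulrDl; apply: lerD; last first.
  by rewrite ler_wpM2r// lerDl.
have -> : 12 * s ^+ 4 / l ^+ 2 * (k (- l) y * q1 + k l y * q2) =
   3 * s ^+ 4 / (4 * l ^+ 2) * (16 * (k (- l) y * q1) + 16 * (k l y * q2)).
  by field; rewrite gt_eqF.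
rewrite -[leLHS]mulrA; apply: ler_wpM2l => //.
rewrite mulrDl; exact: (lerD v1 v2).
Qed.

End regret_hellinger.

Section mixture_integrals.
Context (R : realType) (s c : R) (s_gt0 : 0 < s) (c_gt0 : 0 < c).
Notation k := (gauss_ratio s).
Notation nu := (normal_law 0 s).
Local Open Scope ereal_scope.

Lemma measurable_gauss_ratio2 : measurable_fun setT (fun z : R * R => k z.1 z.2).
Proof.
apply: measurableT_comp => //; apply: measurable_funM => //.
apply: measurable_funB; first by apply: measurable_funM; [exact: measurable_snd|exact: measurable_fst].
by apply: measurable_funM => //; apply: measurable_funX; exact: measurable_fst.
Qed.

Lemma integral_mul_marg (H : probability R R) (phi : R -> \bar R) : supported c H ->
  measurable_fun setT phi -> (forall y, 0 <= phi y) ->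
  \int[nu]_y (phi y * (marg s c H y)%:E) = \int[H]_t \int[nu]_y (phi y * (k t y)%:E).
Proof.
move=> HI mphi phi0.
transitivity (\int[nu]_y \int[H]_t (phi y * (k t y)%:E)).
  apply: eq_integral => y _.
  rewrite (EFin_expect HI); last exact: bounded_meas_gauss_ratio.
  rewrite ge0_integralZl//.
  - by apply/measurable_EFinP; exact: measurable_gauss_ratio_mean.
  - by move=> t _; rewrite lee_fin gauss_ratio_ge0.
apply/esym.
apply: (@fubini_tonelli _ _ _ _ _ H nu (fun z => phi z.2 * (k z.1 z.2)%:E)).
  apply: emeasurable_funM; first exact: (measurableT_comp mphi measurable_snd).
  by apply/measurable_EFinP; exact: measurable_gauss_ratio2.
by move=> z; rewrite mule_ge0// lee_fin gauss_ratio_ge0.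
Qed.

Lemma integral_marg (H : probability R R) : supported c H ->
  \int[nu]_y (marg s c H y)%:E = 1.
Proof.
move=> HI; transitivity (\int[nu]_y (cst 1 y * (marg s c H y)%:E)).
  by apply: eq_integral => y _; rewrite mul1e.
rewrite (integral_mul_marg HI)//.
rewrite -[RHS](integral_probability_cst H); apply: eq_integral => t _.
rewrite -[RHS](integral_gauss_ratio s_gt0 t).
by apply: eq_integral => y _; rewrite mul1e.
Qed.

(** Completing the square turns exp(a y) [k t y] into a constant times the density ratio of mean t +
    a s^2. *)
Lemma integral_normal_law_expR (t a : R) : (a ^+ 2 = 1)%R ->
  \int[normal_law t s]_y (expR (a * y))%:E = (expR (a * t + s ^+ 2 / 2))%:E.
Proof.
move=> a1.
have me : measurable_fun setT (fun y : R => (expR (a * y))%:E).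
  by apply/measurable_EFinP; apply: measurableT_comp => //; exact: measurable_funM.
have e0 y : 0 <= (expR (a * y))%:E :> \bar R by rewrite lee_fin expR_ge0.
rewrite (integral_normal_law_ratio s_gt0 t me e0).
rewrite -[RHS]mule1 -(integral_gauss_ratio s_gt0 (t + a * s ^+ 2)%R).
have mk : measurable_fun setT (fun y => (k (t + a * s ^+ 2) y)%:E).
  by apply/measurable_EFinP; exact: measurable_gauss_ratio.
have k0 y : 0 <= (k (t + a * s ^+ 2) y)%:E by rewrite lee_fin gauss_ratio_ge0.
have ee0 : 0 <= (expR (a * t + s ^+ 2 / 2))%:E by rewrite lee_fin expR_ge0.
rewrite -(ge0_integralZl nu measurableT mk (fun y _ => k0 y) ee0).
apply: eq_integral => y _; rewrite -!EFinM /gauss_ratio -!expRD; congr (expR _)%:E.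
have -> : (s ^+ 2 / 2 = a ^+ 2 * s ^+ 2 / 2)%R by rewrite a1 mul1r.
by field; rewrite gt_eqF.
Qed.

(** Bounds the means of exp Y and exp(- Y) when Y has law N(t, s^2) with |t| <= c, and thereby all
    tail terms. *)
Definition exp_moment_bound : R := expR (c + s ^+ 2 / 2).

Lemma integral_expR_marg (H : probability R R) (a : R) : supported c H ->
  (a ^+ 2 = 1)%R ->
  \int[nu]_y ((expR (a * y))%:E * (marg s c H y)%:E) <= exp_moment_bound%:E.
Proof.
move=> HI a1; rewrite (integral_mul_marg HI); last 2 first.
  by apply/measurable_EFinP; apply: measurableT_comp => //; exact: measurable_funM.
  by move=> y; rewrite lee_fin expR_ge0.
have mexp : measurable_fun setT (fun t : R => (expR (a * t + s ^+ 2 / 2))%:E).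
  apply/measurable_EFinP; apply: measurableT_comp => //.
  apply: measurable_funD; last exact: measurable_cst.
  by apply: measurable_funM; [exact: measurable_cst|exact: measurable_id].
have mexpy : measurable_fun setT (fun y : R => (expR (a * y))%:E).
  by apply/measurable_EFinP; apply: measurableT_comp => //; exact: measurable_funM.
have expy0 y : 0 <= (expR (a * y))%:E :> \bar R by rewrite lee_fin expR_ge0.
have E t : \int[nu]_y ((expR (a * y))%:E * (k t y)%:E) = (expR (a * t + s ^+ 2 / 2))%:E.
  by rewrite -(integral_normal_law_ratio s_gt0 t mexpy expy0) integral_normal_law_expR.
under eq_integral do rewrite E.
rewrite (integral_expectE HI mexp).
apply: (@le_trans _ _ (\int[H]_(t in `[(- c)%R, c]) (cst exp_moment_bound%:E t))).
  apply: ge0_le_integral => //.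
  - exact: measurable_funTS.
  - move=> t; rewrite /= in_itv/= -ler_norml => tc; rewrite lee_fin ler_expR lerD2r.
    apply: le_trans (ler_norm _) _; rewrite normrM.
    suff -> : `|a|%R = 1%R by rewrite mul1r.
    by apply/eqP; rewrite -(@eqrXn2 _ 2)// real_normK ?num_real// a1 expr1n.
rewrite integral_cst//= [X in _ * X](_ : _ = 1) ?mule1//.
Qed.

End mixture_integrals.

Section tilted.
Context (R : realType) (s c : R) (s_gt0 : 0 < s) (c_gt0 : 0 < c).
Variables (H0 H1 : probability R R).
Hypotheses (H0c : supported c H0) (H1c : supported c H1).
Notation k := (gauss_ratio s).
Notation E := (expect c).
Notation bm := (bounded_meas c).
Notation r0 := (sqrt_marg s c H0).
Notation r1 := (sqrt_marg s c H1).
Notation gap := (pmean_gap s c H0 H1).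

Definition excess_loss (t y : R) := (pmean s c H1 y - t) ^+ 2 - (pmean s c H0 y - t) ^+ 2.

Definition tilted (lam t y : R) := expR (lam * excess_loss t y) * (r1 y / r0 y).

Lemma excess_lossE t y : excess_loss t y =
  gap y * (pmean s c H1 y + pmean s c H0 y - 2 * t).
Proof. by rewrite /excess_loss /pmean_gap; ring. Qed.

Lemma norm_excess_loss_le t y : `|t| <= c -> `|excess_loss t y| <= 4 * c * `|gap y|.
Proof.
move=> tc; rewrite excess_lossE normrM mulrC ler_wpM2r//.
have h1 := norm_pmean_le s_gt0 c_gt0 y H1c; have h0 := norm_pmean_le s_gt0 c_gt0 y H0c.
move: h1 h0 tc; move: (pmean _ _ _ _) (pmean _ _ _ _) => a b.
by rewrite !ler_norml => /andP[? ?] /andP[? ?] /andP[? ?]; apply/andP; split; lra.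
Qed.

(** Under the posterior of [H0] the parameter has mean [pmean H0 y], so the cross term vanishes. The
    first-order effect of the tilt is thus quadratic in the gap, as it must be to be paid for by a
    squared Hellinger distance. *)
Lemma expect_excess_loss y : E H0 (fun t => excess_loss t y * k t y) =
  gap y ^+ 2 * marg s c H0 y.
Proof.
have b0 : bm (fun t => k t y) by exact: bounded_meas_gauss_ratio.
have b1 : bm (fun t => t * k t y) by apply: bounded_measM => //; exact: bounded_meas_id.
have bZ (x : R) h : bm h -> bm (fun t => x * h t).
  by move=> bh; apply: bounded_measM => //; exact: bounded_meas_cst.
rewrite (@eq_expect _ _ _ _ (fun t => gap y * (pmean s c H1 y + pmean s c H0 y) * k t y
   - 2 * gap y * (t * k t y))); last first.
  move=> t _; rewrite excess_lossE; move: (gap y) (pmean _ _ _ _) (pmean _ _ _ _) (k t y) => *; ring.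
rewrite expectB; [|exact: bZ|exact: bZ].
rewrite !expectZ// -/(marg s c H0 y) -/(tmarg s c H0 y) tmargE// /pmean_gap.
by move: (pmean _ _ _ _) (pmean _ _ _ _) (marg _ _ _ _) => *; ring.
Qed.

(** The second-order Taylor remainder is at most 4 v^2 / 2. *)
Lemma expR_le_sqr (v : R) : `|v| <= 1 -> expR v <= 1 + v + 2 * v ^+ 2.
Proof.
move=> v1; have := expR_taylor 2 v.
rewrite !big_ord_recl big_ord0 /= addr0 expr0 expr1 /bump /= addn0 (_ : 0`! = 1)%N// (_ : 1`! = 1)%N// (_ : 2`! = 2)%N//.
rewrite real_normK ?num_real// ler_norml => /andP[_].
have : v ^+ 2 * expR `|v| <= v ^+ 2 * 4.
  by rewrite ler_wpM2l ?sqr_ge0// (le_trans _ (expR1_le4 R))// ler_expR.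
by move: (v ^+ 2) (expR _) (expR _) => *; lra.
Qed.

Lemma bounded_meas_excess_loss y : bm (fun t => excess_loss t y).
Proof.
apply: bounded_measB; apply: bounded_measX; apply: bounded_measB.
all: by [exact: bounded_meas_cst|exact: bounded_meas_id].
Qed.

(** The exponential is expanded to second order. The linear term averages to lam gap^2, the
    quadratic one is at most 32 c^2 lam^2 gap^2, and the smallness of [lam] makes their sum at most
    3 lam gap^2. The factor r1 / r0 times the marginal r0^2 leaves r0 r1. *)
Lemma expect_tilted_le lam y : 0 <= lam -> lam * (16 * c ^+ 2) <= 1 ->
  E H0 (fun t => tilted lam t y * k t y) <= r0 y * r1 y * (1 + 3 * lam * gap y ^+ 2).
Proof.
move=> lam0 lamc.
have b0 : bm (fun t => k t y) by exact: bounded_meas_gauss_ratio.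
have bx : bm (fun t => excess_loss t y * k t y).
  by apply: bounded_measM => //; exact: bounded_meas_excess_loss.
have bZ (x : R) h : bm h -> bm (fun t => x * h t).
  by move=> bh; apply: bounded_measM => //; exact: bounded_meas_cst.
have r00 := sqrt_marg_gt0 s_gt0 c_gt0 y H0c.
have r10 := sqrt_marg_gt0 s_gt0 c_gt0 y H1c.
pose q := r1 y / r0 y; have q0 : 0 <= q by rewrite divr_ge0// ltW.
have gc := norm_pmean_gap_le s_gt0 c_gt0 H0c H1c y.
have bt : bm (fun t => tilted lam t y * k t y).
  apply: bounded_measM => //; apply: bounded_measM; last exact: bounded_meas_cst.
  by apply: bounded_meas_expR; apply: bZ; exact: bounded_meas_excess_loss.
pose D := q * (1 + 32 * c ^+ 2 * lam ^+ 2 * gap y ^+ 2).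
have g2 : gap y ^+ 2 = `|gap y| ^+ 2 by rewrite real_normK ?num_real.
apply: (@le_trans _ _ (E H0 (fun t => D * k t y + q * lam * (excess_loss t y * k t y)))).
  apply: le_expect => //; first by apply: bounded_measD; exact: bZ.
  move=> t tc.
  have xc := norm_excess_loss_le y tc.
  have v1 : `|lam * excess_loss t y| <= 1.
    rewrite normrM (ger0_norm lam0); apply: le_trans _ lamc; rewrite ler_wpM2l//.
    apply: le_trans xc _; apply: (@le_trans _ _ (4 * c * (2 * c))).
      by rewrite ler_wpM2l// mulr_ge0// ltW.
    have -> : 16 * c ^+ 2 = 4 * c * (2 * c) + 8 * c ^+ 2 by ring.
    by rewrite lerDl mulr_ge0// sqr_ge0.
  have x2 : excess_loss t y ^+ 2 <= 16 * c ^+ 2 * gap y ^+ 2.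
    rewrite (_ : 16 * c ^+ 2 * gap y ^+ 2 = (4 * c * `|gap y|) ^+ 2); last by rewrite g2; ring.
    by rewrite -[leLHS]real_normK ?num_real// lerXn2r ?nnegrE// (le_trans _ xc).
  have -> : D * k t y + q * lam * (excess_loss t y * k t y) =
      (1 + lam * excess_loss t y + 2 * lam ^+ 2 * (16 * c ^+ 2 * gap y ^+ 2)) * q * k t y.
    by rewrite /D; move: (gap y) (excess_loss _ _) (k _ _) => *; ring.
  rewrite ler_wpM2r ?gauss_ratio_ge0// ler_wpM2r//; apply: le_trans (expR_le_sqr v1) _.
  by rewrite lerD2l exprMn -mulrA ler_wpM2l// ler_wpM2l// sqr_ge0.
rewrite expectD; [|exact: bZ|exact: bZ].
rewrite !expectZ// expect_excess_loss -/(marg s c H0 y) -(sqr_sqrt_marg s_gt0 c_gt0 y H0c) /D /q.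
have -> : r1 y / r0 y * (1 + 32 * c ^+ 2 * lam ^+ 2 * gap y ^+ 2) * r0 y ^+ 2 +
   r1 y / r0 y * lam * (gap y ^+ 2 * r0 y ^+ 2) =
   r0 y * r1 y * (1 + lam * gap y ^+ 2 * (1 + 2 * (lam * (16 * c ^+ 2)))).
  move: r00; move: (r0 y) (r1 y) (gap y) => a b g a0; field; by rewrite gt_eqF.
apply: ler_wpM2l; first by rewrite mulr_ge0 ?ltW.
have lg : 0 <= lam * gap y ^+ 2 by rewrite mulr_ge0// sqr_ge0.
have := ler_wpM2l lg lamc.
by move: (lam * gap y ^+ 2) (lam * (16 * c ^+ 2)) (mulrA 3 lam (gap y ^+ 2)) => p q' <-; lra.
Qed.

Definition hellinger_error (l T y : R) :=
  difference_error s c l + 4 * c ^+ 2 * (expR (- T) * (expR y + expR (- y))).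

(* [lam] is chosen so that [3 * lam * (12 * s ^+ 4 / l ^+ 2) = 4^-1]: once
   integrated, the two shifted Hellinger terms are then absorbed by the one on
   the left. *)
Lemma expect_tilted_hellinger_le (l T y : R) : 0 < l -> 0 <= T ->
  l * (c + T + l) / s ^+ 2 <= 1 -> 2 * l * c / s ^+ 2 <= 1 ->
  let lam := l ^+ 2 / (144 * s ^+ 4) in lam * (16 * c ^+ 2) <= 1 ->
  E H0 (fun t => tilted lam t y * k t y) + 2^-1 * sqr_hellinger s c H0 H1 y <=
    (1 + 3 * lam * hellinger_error l T y) * (2^-1 * (marg s c H0 y + marg s c H1 y)) +
    4^-1 * (k (- l) y * sqr_hellinger s c H0 H1 (y + l) +
            k l y * sqr_hellinger s c H0 H1 (y - l)).
Proof.
move=> l0 T0 lT lc lam lamc.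
have s0 : s != 0 by rewrite gt_eqF.
have lam0 : 0 <= lam by rewrite divr_ge0 ?mulr_ge0 ?exprn_ge0// ltW.
have h1 := expect_tilted_le y lam0 lamc.
have h2 := pmean_gap_hellinger s_gt0 c_gt0 H0c H1c y l0 T0 lT lc.
rewrite -/(hellinger_error l T y) in h2.
have e0 : 0 <= hellinger_error l T y.
  apply: addr_ge0; first by rewrite mulr_ge0 ?sqr_ge0// mulr_ge0 ?sqr_ge0.
  apply: mulr_ge0; first by rewrite mulr_ge0// sqr_ge0.
  by rewrite mulr_ge0 ?addr_ge0 ?expR_ge0.
(* The source of the Hellinger gain: a product of roots is the mean of the marginals minus half the
   squared difference of the roots. *)
have W2 : r0 y * r1 y = 2^-1 * (marg s c H0 y + marg s c H1 y) - 2^-1 * sqr_hellinger s c H0 H1 y.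
  rewrite -!sqr_sqrt_marg// /sqr_hellinger; move: (r0 y) (r1 y) => a b; by field.
have hh0 : 0 <= sqr_hellinger s c H0 H1 y by exact: sqr_ge0.
set hh := sqr_hellinger _ _ _ _ y in W2 hh0 *.
set avg := 2^-1 * (_ + _) in W2 *.
have lamE : 3 * lam * (12 * s ^+ 4 / l ^+ 2) = 4^-1.
  by rewrite /lam; field; rewrite !gt_eqF.
have h3 : 3 * lam * (gap y ^+ 2 * (r0 y * r1 y)) <=
    4^-1 * (k (- l) y * sqr_hellinger s c H0 H1 (y + l) + k l y * sqr_hellinger s c H0 H1 (y - l))
    + 3 * lam * (hellinger_error l T y * (r0 y * r1 y)).
  apply: le_trans (ler_wpM2l (mulr_ge0 (ler0n R 3) lam0) h2) _.
  by rewrite [leLHS]mulrDr [X in X + _]mulrA lamE.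
set W := r0 y * r1 y in h1 h3 W2.
have h4 : 3 * lam * (hellinger_error l T y * W) <= 3 * lam * hellinger_error l T y * avg.
  rewrite [leLHS]mulrA; apply: ler_wpM2l; first exact: mulr_ge0 (mulr_ge0 (ler0n R 3) lam0) e0.
  by rewrite W2 gerBl mulr_ge0.
apply: (@le_trans _ _ (W + 3 * lam * (gap y ^+ 2 * W) + 2^-1 * hh)).
  rewrite lerD2r; apply: le_trans h1 _.
  rewrite le_eqVlt; apply/orP; left; apply/eqP.
  by move: (gap y) W {W2 h3 h4} => g W; ring.
have -> : (1 + 3 * lam * hellinger_error l T y) * avg =
    avg + 3 * lam * hellinger_error l T y * avg by ring.
move: W2 h3 h4 {h1 h2}.
move: (3 * lam * (gap y ^+ 2 * W)) (3 * lam * (hellinger_error l T y * W)) (k (- l) y * _ + _).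
move: (3 * lam * hellinger_error l T y * avg) => p g b z.
by clear - s_gt0 c_gt0 H0c H1c => *; lra.
Qed.

End tilted.

Section tilted_integral.
Context (R : realType) (s c : R) (s_gt0 : 0 < s) (c_gt0 : 0 < c).
Variables (H0 H1 : probability R R).
Hypotheses (H0c : supported c H0) (H1c : supported c H1).
Notation k := (gauss_ratio s).
Notation E := (expect c).
Notation nu := (normal_law 0 s).
Notation F0 := (marg s c H0).
Notation F1 := (marg s c H1).
Notation hh := (sqr_hellinger s c H0 H1).
Notation tilt := (tilted s c H0 H1).

Lemma continuous_sqrt_marg H : continuous (sqrt_marg s c H).
Proof.
move=> y; apply: (@continuous_comp _ _ _ (marg s c H) Num.sqrt); last exact: sqrt_continuous.
rewrite marg1E.
by apply: continuous_expect_gauss_ratio => //; exact: bounded_meas_cst.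
Qed.

Lemma measurable_sqrt_marg H : measurable_fun setT (sqrt_marg s c H).
Proof. by apply: continuous_measurable_fun; exact: continuous_sqrt_marg. Qed.

Lemma measurable_excess_loss t : measurable_fun setT (excess_loss s c H0 H1 t).
Proof.
by apply: measurable_funB; apply: measurable_funX; apply: measurable_funB => //;
  exact: measurable_pmean.
Qed.

Lemma measurable_tilted lam t : measurable_fun setT (tilt lam t).
Proof.
apply: measurable_funM.
  apply: measurableT_comp => //; apply: measurable_funM => //.
  exact: measurable_excess_loss.
apply: continuous_measurable_fun => y; apply: cvgM; first exact: continuous_sqrt_marg.
apply: cvgV; first by rewrite gt_eqF// sqrt_marg_gt0.
exact: continuous_sqrt_marg.
Qed.

Lemma tilted_gt0 lam t y : 0 < tilt lam t y.
Proof. by rewrite mulr_gt0 ?expR_gt0// divr_gt0// sqrt_marg_gt0. Qed.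

Lemma measurable_sqr_hellinger : measurable_fun setT hh.
Proof. by apply: measurable_funX; apply: measurable_funB; exact: measurable_sqrt_marg. Qed.

(** Bounds how much the average factor exceeds 1. The 8 is 4 for each of exp y and exp(- y). *)
Definition tilted_error (l T : R) : R :=
  3 * (l ^+ 2 / (144 * s ^+ 4)) *
    (difference_error s c l + 8 * c ^+ 2 * expR (- T) * exp_moment_bound s c).

Local Open Scope ereal_scope.

Let J (f : R -> R) := \int[nu]_y (f y)%:E.

Let nn (f : R -> R) := measurable_fun setT f /\ forall y, (0 <= f y)%R.

Let nnD f g : nn f -> nn g -> nn (fun y => f y + g y)%R.
Proof.
by move=> [mf f0] [mg g0]; split; [exact: measurable_funD|move=> y; exact: addr_ge0].
Qed.

Let nnZ a f : (0 <= a)%R -> nn f -> nn (fun y => a * f y)%R.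
Proof.
by move=> a0 [mf f0]; split; [exact: measurable_funM|move=> y; exact: mulr_ge0].
Qed.

Let JD f g : nn f -> nn g -> J (fun y => f y + g y)%R = J f + J g.
Proof. by move=> [mf f0] [mg g0]; exact: ge0_integralD_EFin. Qed.

Let JZ (a : R) f : (0 <= a)%R -> nn f -> J (fun y => a * f y)%R = a%:E * J f.
Proof. by move=> a0 [mf f0]; exact: ge0_integralZ_EFin. Qed.

Let le_J (f g : R -> R) : nn f -> measurable_fun setT g ->
  (forall y, f y <= g y)%R -> J f <= J g.
Proof.
move=> [mf f0] mg fg; apply: ge0_le_integral => //.
all: by [exact/measurable_EFinP|move=> y _; rewrite lee_fin].
Qed.

(** The weight [k (- l)] turns N(0, s^2) into N(- l, s^2), and recentring this law translates the
    argument back: the shifted Hellinger terms integrate to the unshifted one. *)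
Let J_shift (l : R) f : nn f ->
  J (fun y => k (- l) y * f (y + l))%R = J f.
Proof.
move=> [mf f0]; rewrite /J.
have mfl : measurable_fun setT (fun y : R => (f (y + l))%:E).
  by apply/measurable_EFinP; apply: (measurableT_comp mf); exact: measurable_funD.
have fl0 y : 0 <= (f (y + l))%:E by rewrite lee_fin.
have h1 := integral_normal_law_ratio s_gt0 (- l)%R mfl fl0.
have h2 := integral_normal_law_shift s_gt0 (- l)%R mfl fl0.
under eq_integral do rewrite mulrC EFinM.
by rewrite -h1 h2; apply: eq_integral => y _; rewrite subrK.
Qed.

(** Finiteness is what allows this integral to be cancelled from both sides of an inequality between
    extended reals. *)
Lemma integral_sqr_hellinger_fin : \int[nu]_y (hh y)%:E \is a fin_num.
Proof.
have mF H := @measurable_marg R s c s_gt0 c_gt0 H.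
have F_ge0 H : supported c H -> forall y, (0 <= marg s c H y)%R.
  by move=> HI y; rewrite ltW// marg_gt0.
rewrite ge0_fin_numE; last by apply: integral_ge0 => y _; rewrite lee_fin sqr_ge0.
apply: (@le_lt_trans _ _ (J (fun y => F0 y + F1 y)%R)).
  apply: le_J; first by split; [exact: measurable_sqr_hellinger|move=> y; exact: sqr_ge0].
    by apply: measurable_funD; exact: mF.
  move=> y; rewrite /sqr_hellinger sqrrB (sqr_sqrt_marg s_gt0 c_gt0 y H0c) (sqr_sqrt_marg s_gt0 c_gt0 y H1c).
  by rewrite addrAC [leRHS]addrC gerBl mulrn_wge0// mulr_ge0 ?sqrtr_ge0.
rewrite JD; [|by split; [exact: mF|exact: F_ge0]|by split; [exact: mF|exact: F_ge0]].
by rewrite /J (integral_marg s_gt0 H0c) (integral_marg s_gt0 H1c) -EFinD ltry.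
Qed.

Lemma integral_expect_tilted_le (l T : R) : (0 < l)%R -> (0 <= T)%R ->
  (l * (c + T + l) / s ^+ 2 <= 1)%R -> (2 * l * c / s ^+ 2 <= 1)%R ->
  let lam := (l ^+ 2 / (144 * s ^+ 4))%R in (lam * (16 * c ^+ 2) <= 1)%R ->
  measurable_fun setT (fun y => E H0 (fun t => tilt lam t y * k t y)%R) ->
  \int[nu]_y (E H0 (fun t => tilt lam t y * k t y)%R)%:E <= (1 + tilted_error l T)%:E.
Proof.
move=> l0 T0 lT lc lam lamc mS.
set S := (fun y => E H0 (fun t => tilt lam t y * k t y)%R) in mS *.
have S0 y : (0 <= S y)%R.
  by apply: expect_ge0 => t _; rewrite mulr_ge0 ?gauss_ratio_ge0// ltW// tilted_gt0.
have lam0 : (0 <= lam)%R by rewrite divr_ge0 ?mulr_ge0 ?exprn_ge0// ltW.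
have mF H := @measurable_marg R s c s_gt0 c_gt0 H.
have F_ge0 H : supported c H -> forall y, (0 <= marg s c H y)%R.
  by move=> HI y; rewrite ltW// marg_gt0.
have F00 := F_ge0 _ H0c; have F10 := F_ge0 _ H1c.
have mh := measurable_sqr_hellinger.
have hh0 y : (0 <= hh y)%R by exact: sqr_ge0.
have mexp (a : R) : measurable_fun setT (fun y : R => expR (a * y)).
  by apply: measurableT_comp => //; exact: measurable_funM.
pose avg (g : R -> R) y := (2^-1 * (g y * F0 y + g y * F1 y))%R.
have mavg g : measurable_fun setT g -> measurable_fun setT (avg g).
  by move=> mg; apply: measurable_funM => //; apply: measurable_funD; apply: measurable_funM.
have avg0 g : (forall y, 0 <= g y)%R -> forall y, (0 <= avg g y)%R.
  by move=> g0 y; rewrite mulr_ge0// addr_ge0// mulr_ge0.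
pose de := difference_error s c l.
have de0 : (0 <= de)%R by rewrite mulr_ge0 ?sqr_ge0// mulr_ge0 ?sqr_ge0.
pose a := (3 * lam * de)%R; have a0 : (0 <= a)%R by rewrite mulr_ge0// mulr_ge0.
pose b := (3 * lam * (4 * c ^+ 2 * expR (- T)))%R.
have b0 : (0 <= b)%R.
  by apply: mulr_ge0; [rewrite mulr_ge0|rewrite mulr_ge0 ?expR_ge0// mulr_ge0// sqr_ge0].
pose one : R -> R := fun=> 1%R; pose e1 y := expR (1 * y) : R; pose e2 y := expR (-1 * y) : R.
pose sh (l : R) y := (k (- l) y * hh (y + l))%R.
have msh x : measurable_fun setT (sh x).
  apply: measurable_funM; first exact: measurable_gauss_ratio.
  by apply: (measurableT_comp mh); exact: measurable_funD.
have sh0 x y : (0 <= sh x y)%R by rewrite mulr_ge0// gauss_ratio_ge0.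
have pt y : (S y + 2^-1 * hh y <= (1 + a) * avg one y + b * (avg e1 y + avg e2 y)
    + 4^-1 * (sh l y + sh (- l) y))%R.
  have := expect_tilted_hellinger_le s_gt0 c_gt0 H0c H1c y l0 T0 lT lc lamc.
  rewrite /sh opprK => /le_trans; apply; rewrite lerD2r le_eqVlt; apply/orP; left; apply/eqP.
  rewrite /avg /a /b /one /e1 /e2 /hellinger_error -/de -/lam /= !mul1r !mulN1r.
  by move: (F0 y) (F1 y) (expR y) (expR (- y)) (expR (- T)) => *; ring.
have mpR : measurable_fun setT (fun y => (1 + a) * avg one y + b * (avg e1 y + avg e2 y)
    + 4^-1 * (sh l y + sh (- l) y))%R.
  apply: measurable_funD; first apply: measurable_funD; apply: measurable_funM => //.
  - by apply: mavg; exact: measurable_cst.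
  - by apply: measurable_funD; apply: mavg; exact: mexp.
  - by apply: measurable_funD; exact: msh.
have none : nn one by split; [exact: measurable_cst|move=> y; exact: ler01].
have nc : nn (avg one) by split; [apply: mavg; exact: none.1|apply: avg0; exact: none.2].
have n1 : nn (fun y => (1 + a) * avg one y)%R by apply: nnZ => //; rewrite addr_ge0.
have ne1 : nn (avg e1) by split; [apply: mavg; exact: mexp|apply: avg0 => y; exact: expR_ge0].
have ne2 : nn (avg e2) by split; [apply: mavg; exact: mexp|apply: avg0 => y; exact: expR_ge0].
have nh : nn hh by [].
have nS : nn S by [].
have nsh x : nn (sh x) by [].
have n3 : nn (fun y => avg e1 y + avg e2 y)%R by exact: nnD.
have n4 : nn (fun y => sh l y + sh (- l) y)%R by exact: nnD.
have n2 : nn (fun y => b * (avg e1 y + avg e2 y))%R by exact: nnZ.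
have n5 : nn (fun y => 4^-1 * (sh l y + sh (- l) y))%R by exact: nnZ.
have n12 : nn (fun y => (1 + a) * avg one y + b * (avg e1 y + avg e2 y))%R.
  exact: (nnD n1 n2).
have n6 : nn (fun y => 2^-1 * hh y)%R by exact: nnZ.
have Jle := le_J (nnD nS n6) mpR pt.
rewrite (JD nS n6) (JZ _ nh)// (JD n12 n5) (JD n1 n2) (JZ _ nc) ?addr_ge0// in Jle.
rewrite (JZ b0 n3) (JD ne1 ne2) (JZ _ n4)// (JD (nsh _) (nsh _)) in Jle.
have shE x : J (sh x) = J hh by exact: J_shift.
rewrite (shE l) (shE (- l)%R) in Jle.
have nF0 g : nn g -> nn (fun y => g y * F0 y)%R.
  by move=> [mg g0]; split; [exact: measurable_funM|move=> y; exact: mulr_ge0].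
have nF1 g : nn g -> nn (fun y => g y * F1 y)%R.
  by move=> [mg g0]; split; [exact: measurable_funM|move=> y; exact: mulr_ge0].
have Javg g : nn g -> J (avg g) =
    2^-1%:E * (J (fun y => g y * F0 y)%R + J (fun y => g y * F1 y)%R).
  move=> ng; rewrite /avg (JZ _ (nnD (nF0 _ ng) (nF1 _ ng)))//.
  by rewrite (JD (nF0 _ ng) (nF1 _ ng)).
have half : 2^-1%:E * (1%:E + 1%:E) = 1%:E :> \bar R.
  by rewrite -EFinD -EFinM; congr EFin; field.
have avg1 : J (avg one) = 1.
  rewrite (Javg _ none).
  rewrite (_ : J _ = 1%:E); last first.
    by rewrite -(integral_marg s_gt0 H0c); apply: eq_integral => y _; rewrite mul1r.
  rewrite (_ : J _ = 1%:E)//.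
  by rewrite -(integral_marg s_gt0 H1c); apply: eq_integral => y _; rewrite mul1r.
set M := exp_moment_bound s c.
have avge (x : R) : (x ^+ 2 = 1)%R -> J (avg (fun y => expR (x * y))%R) <= M%:E.
  move=> x1; rewrite Javg; last by split=> // y; exact: expR_ge0.
  have h0 : J (fun y => expR (x * y) * F0 y)%R <= M%:E.
    rewrite /J; under eq_integral do rewrite EFinM.
    exact: integral_expR_marg.
  have h1 : J (fun y => expR (x * y) * F1 y)%R <= M%:E.
    rewrite /J; under eq_integral do rewrite EFinM.
    exact: integral_expR_marg.
  have -> : M%:E = 2^-1%:E * (M%:E + M%:E) by rewrite -EFinD -EFinM; congr EFin; field.
  by apply: lee_wpmul2l; [rewrite lee_fin|exact: leeD].
have := integral_sqr_hellinger_fin; rewrite -/(J hh) => I_fin.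
rewrite -(leeD2rE _ _ (x := 2^-1%:E * J hh)); last by rewrite fin_numM.
apply: le_trans Jle _; rewrite avg1 -(fineK I_fin); set i := fine _.
have -> : 4^-1%:E * (i%:E + i%:E) = 2^-1%:E * i%:E.
  by rewrite -EFinD -!EFinM; congr EFin; field.
apply: leeD => //.
have -> : (1 + tilted_error l T)%:E = (1 + a)%:E * 1 + b%:E * (M%:E + M%:E).
  transitivity ((1 + a) + b * (M + M))%R%:E; last by rewrite mule1 EFinD EFinM [(M + M)%:E]EFinD.
  congr EFin; rewrite /tilted_error /a /b -/de -/lam -/M; ring.
apply: leeD => //; apply: lee_wpmul2l; first by rewrite lee_fin.
by apply: leeD; apply: avge; rewrite ?sqrrN expr1n.
Qed.

End tilted_integral.

(** * Empirical distributions and the exponential moment of the product *)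

Section average_probability.
Context d (T : measurableType d) (R : realType) (n : nat).
Variable P : 'I_n.+1 -> probability T R.
Local Open Scope ereal_scope.

(** Built from [mscale] and [msum] to inherit the measure structure; [msum] is indexed by natural
    numbers, whence [inord]. *)
Definition average_prob : set T -> \bar R :=
  mscale (NngNum (ltac:(by rewrite invr_ge0) : 0 <= n.+1%:R^-1 :> R)%R)
    (msum (fun k => P (inord k)) n.+1).

HB.instance Definition _ := Measure.on average_prob.

Lemma average_probE A : average_prob A = (n.+1%:R^-1)%:E * \sum_(i < n.+1) P i A.
Proof.
rewrite /average_prob /mscale /= /msum; congr (_ * _).
by apply: eq_bigr => i _; rewrite inord_val.
Qed.

Let average_prob_setT : average_prob setT = 1.
Proof.
rewrite average_probE; under eq_bigr do rewrite probability_setT.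
by rewrite sumEFin -EFinM sumr_const card_ord mulVf.
Qed.

HB.instance Definition _ := Measure_isProbability.Build _ _ _ average_prob average_prob_setT.

Lemma ge0_integral_average_prob (D : set T) (f : T -> \bar R) : measurable D ->
  measurable_fun D f -> (forall x, D x -> 0 <= f x) ->
  \int[average_prob]_(x in D) f x =
  (n.+1%:R^-1)%:E * \sum_(i < n.+1) \int[P i]_(x in D) f x.
Proof.
move=> mD mf f0; rewrite ge0_integral_mscale// ge0_integral_measure_sum//.
by congr (_ * _); apply: eq_bigr => i _; rewrite inord_val.
Qed.

End average_probability.

Section empirical.
Context (R : realType) (c : R) (n : nat) (th : n.+1.-tuple R).
Hypothesis thc : forall i, `|tnth th i| <= c.

Definition empirical_prob : probability R R :=
  average_prob (fun i => \d_(tnth th i) : probability R R).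

Let thI i : \d_(tnth th i) `[-c, c]%classic = 1%E :> \bar R.
Proof. by rewrite diracE mem_set//= in_itv/= -ler_norml. Qed.

Lemma supported_empirical : supported c empirical_prob.
Proof.
rewrite /supported /empirical_prob /= average_probE.
rewrite (eq_bigr (fun=> 1%E)); last by move=> i _; exact: thI.
by rewrite sumEFin -EFinM sumr_const card_ord mulVf.
Qed.

Let expect_ge0_empirical (g : R -> R) : measurable_fun setT g ->
  (forall t, `|t| <= c -> 0 <= g t) ->
  expect c empirical_prob g = n.+1%:R^-1 * \sum_(i < n.+1) g (tnth th i).
Proof.
move=> mg g0; rewrite /expect /Rintegral ge0_integral_average_prob//.
- rewrite (eq_bigr (fun i => (g (tnth th i))%:E)); last first.
    move=> i _; rewrite integral_dirac//; last exact/measurable_EFinP/measurable_funTS.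
    by rewrite [X in (X * _)%E]thI mul1e.
  by rewrite sumEFin -EFinM.
- exact/measurable_EFinP/measurable_funTS.
- by move=> t /=; rewrite in_itv/= -ler_norml lee_fin; exact: g0.
Qed.

Lemma expect_empirical (g : R -> R) : bounded_meas c g ->
  expect c empirical_prob g = n.+1%:R^-1 * \sum_(i < n.+1) g (tnth th i).
Proof.
move=> bg; have [mg [B gB]] := bg.
have bB : bounded_meas c (fun=> B) by exact: bounded_meas_cst.
(* Adding the bound [B] makes the integrand nonnegative on [[-c, c]]. *)
have := @expect_ge0_empirical (fun t => g t + B).
rewrite expectD// (expect_cst _ supported_empirical) => h.
apply: (@addIr _ B); rewrite h.
- by rewrite big_split/= sumr_const card_ord -[B *+ _]mulr_natl mulrDr mulrA mulVf ?mul1r.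
- exact: measurable_funD.
- by move=> t /gB; rewrite ler_norml => /andP[h' _]; rewrite -lerBlDr sub0r.
Qed.

End empirical.

(** From A <= exp(A - 1), only the sum of the factors matters. For the tilted factors this sum is an
    average over the empirical law, and only on that average does the first-order term become
    quadratic in the gap. *)
Lemma prode_le_expR (R : realType) n (A : 'I_n -> \bar R) (B : R) :
  (forall i, 0 <= A i)%E -> (\sum_(i < n) A i <= (n%:R + B)%:E)%E ->
  (\prod_(i < n) A i <= (expR B)%:E)%E.
Proof.
move=> A0 sumA.
have Afin i : A i \is a fin_num.
  rewrite ge0_fin_numE//; apply: le_lt_trans (ltry (n%:R + B)).
  apply: le_trans sumA; rewrite (bigD1 i)//= leeDl//.
  by apply: sume_ge0 => j _.
have AfE i : A i = (fine (A i))%:E by rewrite fineK.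
have sumA2 : \sum_(i < n) fine (A i) <= n%:R + B.
  by rewrite -lee_fin -sumEFin; under eq_bigr do rewrite -AfE.
have -> : (\prod_(i < n) A i)%E = (\prod_(i < n) fine (A i))%:E.
  by rewrite -prodEFin; apply: eq_bigr => i _; exact: AfE.
rewrite lee_fin; apply: (@le_trans _ _ (\prod_(i < n) expR (fine (A i) - 1))).
  apply: ler_prod => i _; rewrite fine_ge0//=.
  by apply: le_trans (expR_ge1Dx _); rewrite addrC subrK.
rewrite -expR_sum ler_expR sumrB sumr_const card_ord.
by rewrite lerBlDr addrC.
Qed.

Section exponential_moment.
Context (R : realType) (s c : R) (s_gt0 : 0 < s) (c_gt0 : 0 < c).
Context (n : nat) (th : n.+1.-tuple R).
Hypothesis thc : forall i, `|tnth th i| <= c.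
Variable (H1 : probability R R).
Hypothesis (H1c : supported c H1).
Notation k := (gauss_ratio s).
Notation H0 := (empirical_prob th).
Notation nu := (normal_law 0 s).
Notation tilt := (tilted s c H0 H1).
Let H0c : supported c H0 := supported_empirical thc.

Lemma bounded_meas_tilted lam y : bounded_meas c (fun t => tilt lam t y * k t y).
Proof.
apply: bounded_measM; last exact: bounded_meas_gauss_ratio.
apply: bounded_measM; last exact: bounded_meas_cst.
apply: bounded_meas_expR; apply: bounded_measM; first exact: bounded_meas_cst.
exact: bounded_meas_excess_loss.
Qed.

Lemma integral_prod_tilted_le (l T : R) : 0 < l -> 0 <= T ->
  l * (c + T + l) / s ^+ 2 <= 1 -> 2 * l * c / s ^+ 2 <= 1 ->
  let lam := l ^+ 2 / (144 * s ^+ 4) in lam * (16 * c ^+ 2) <= 1 ->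
  (\int[obs_law s th]_y (\prod_(i < n.+1) tilt lam (tnth th i) (tnth y i))%:E <=
   (expR (n.+1%:R * tilted_error s c l T))%:E)%E.
Proof.
move=> l0 T0 lT lc lam lamc.
have mtilt i : measurable_fun setT (tilt lam (tnth th i)) by exact: measurable_tilted.
have tilt0 t y : 0 <= tilt lam t y by rewrite ltW// tilted_gt0.
have mEtilt i : measurable_fun setT (fun y => (tilt lam (tnth th i) y)%:E).
  exact/measurable_EFinP.
have tilt0E t y : (0 <= (tilt lam t y)%:E)%E by rewrite lee_fin.
under eq_integral do rewrite -prodEFin.
rewrite (@integral_tuple_prod_prod _ _ _ _ (fun i => normal_law (tnth th i) s)
  (fun i y => (tilt lam (tnth th i) y)%:E))//.
pose A i := (\int[normal_law (tnth th i) s]_y (tilt lam (tnth th i) y)%:E)%E.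
have A0 i : (0 <= A i)%E by apply: integral_ge0.
have AE i : A i = (\int[nu]_y (tilt lam (tnth th i) y * k (tnth th i) y)%:E)%E.
  rewrite /A (integral_normal_law_ratio s_gt0 _ (mEtilt i) (tilt0E _)).
  by apply: eq_integral => y _; rewrite -EFinM.
have eS y : expect c H0 (fun t => tilt lam t y * k t y) =
    n.+1%:R^-1 * \sum_(i < n.+1) tilt lam (tnth th i) y * k (tnth th i) y.
  by rewrite expect_empirical//; exact: bounded_meas_tilted.
have mt i : measurable_fun setT (fun y => tilt lam (tnth th i) y * k (tnth th i) y).
  by apply: measurable_funM => //; exact: measurable_gauss_ratio.
have mS : measurable_fun setT (fun y => expect c H0 (fun t => tilt lam t y * k t y)).
  under eq_fun do rewrite eS.
  by apply: measurable_funM => //; exact: measurable_sum.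
have hS := integral_expect_tilted_le s_gt0 c_gt0 H0c H1c l0 T0 lT lc lamc mS.
(* [H0] weights the entries of [th] equally, so the sum of the factors is n + 1 times the integral
   of the [H0]-expectation. *)
have sumA : (\sum_(i < n.+1) A i <= (n.+1%:R * (1 + tilted_error s c l T))%:E)%E.
  rewrite EFinM; apply: le_trans (lee_wpmul2l _ hS); last by rewrite lee_fin.
  have mSE : measurable_fun setT (fun y => (expect c H0 (fun t => tilt lam t y * k t y))%:E).
    exact/measurable_EFinP.
  have S0E y : (0 <= (expect c H0 (fun t => tilt lam t y * k t y))%:E)%E.
    by rewrite lee_fin; apply: expect_ge0 => t _; rewrite mulr_ge0// gauss_ratio_ge0.
  have nE : (0 <= n.+1%:R%:E :> \bar R)%E by rewrite lee_fin.
  rewrite -(ge0_integralZl nu measurableT mSE (fun y _ => S0E y) nE).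
  rewrite (eq_bigr _ (fun i _ => AE i)).
  have mtE i : measurable_fun setT (fun y => (tilt lam (tnth th i) y * k (tnth th i) y)%:E).
    exact/measurable_EFinP.
  have t0E i y : (0 <= (tilt lam (tnth th i) y * k (tnth th i) y)%:E)%E.
    by rewrite lee_fin mulr_ge0// gauss_ratio_ge0.
  rewrite -(ge0_integral_sum nu measurableT mtE (fun i y _ => t0E i y)).
  rewrite le_eqVlt; apply/orP; left; apply/eqP; apply: eq_integral => y _.
  by rewrite eS -EFinM mulrA divff ?pnatr_eq0// mul1r sumEFin.
apply: (prode_le_expR A0); apply: le_trans sumA _.
by rewrite mulrDr mulr1.
Qed.

End exponential_moment.

(** * Risk given the parameters *)

Section conditional_risk.
Context (R : realType) (s c : R) (s_gt0 : 0 < s) (c_gt0 : 0 < c).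
Context (n : nat) (th : n.+1.-tuple R).
Hypothesis thc : forall i, `|tnth th i| <= c.
Notation H0 := (empirical_prob th).
Let H0c : supported c H0 := supported_empirical thc.

(** [H0] is itself a competitor in the maximization, and the N(0, s^2) density factor common to all
    mixtures cancels. *)
Lemma npmle_sum_ln_marg_ge (y : n.+1.-tuple R) H : is_npmle s c y H ->
  \sum_(i < n.+1) ln (marg s c H0 (tnth y i)) <= \sum_(i < n.+1) ln (marg s c H (tnth y i)).
Proof.
move=> [HI /(_ _ H0c)].
have lE H' : supported c H' -> log_likelihood s y H' =
    \sum_(i < n.+1) ln (s^-1 * normal_pdf 0 1 (tnth y i / s)) +
    \sum_(i < n.+1) ln (marg s c H' (tnth y i)).
  move=> HI'; rewrite -big_split; apply: eq_bigr => i _.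
  rewrite (mixture_densityE s_gt0 _ HI') lnM ?posrE ?marg_gt0// mulr_gt0 ?invr_gt0//.
  rewrite normal_pdfE ?oner_eq0// mulr_gt0 ?expR_gt0//.
  by rewrite normal_peak_gt0// oner_eq0.
by rewrite (lE _ H0c) (lE _ HI) lerD2l.
Qed.

Lemma sqr_sub_le (a b t e : R) : `|a| <= c -> `|b| <= c -> `|t| <= c ->
  `|a - b| <= e -> (a - t) ^+ 2 <= (b - t) ^+ 2 + 4 * c * e.
Proof.
move=> ac bc tc abe; rewrite -lerBlDl.
have -> : (a - t) ^+ 2 - (b - t) ^+ 2 = (a - b) * (a + b - 2 * t) by ring.
apply: le_trans (ler_norm _) _; rewrite normrM mulrC; apply: ler_pM => //.
by move: ac bc tc; rewrite !ler_norml => /andP[? ?] /andP[? ?] /andP[? ?]; apply/andP; split; lra.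
Qed.

Variables (J : finType) (Hs : J -> probability R R) (T : R).
Hypothesis Hsc : forall j, supported c (Hs j).
(** With this relative precision, passing to a net point lowers the log-likelihood of n + 1
    observations by at most 1 in total. *)
Let w : R := n.+1%:R^-1.
Hypothesis coverP : forall H, supported c H -> exists j, forall y, `|y| <= T ->
  `|marg s c H y - marg s c (Hs j) y| <= w * marg s c (Hs j) y /\
  `|pmean s c H y - pmean s c (Hs j) y| <= 2 * c * w.
Variable lam : R.
Hypothesis lam0 : 0 < lam.

Definition prod_tilted j (y : n.+1.-tuple R) : R :=
  \prod_(i < n.+1) tilted s c H0 (Hs j) lam (tnth th i) (tnth y i).

Lemma prod_tilted_gt0 j y : 0 < prod_tilted j y.
Proof. by apply: prodr_gt0 => i _; exact: tilted_gt0. Qed.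

(** The logarithm of [prod_tilted j y] is [lam] times the excess loss plus half the log-likelihood
    ratio of [Hs j] to [H0]. That ratio is at least -1, since [H] is at least as likely as [H0] and
    the net point loses at most 1. *)
Lemma sum_excess_loss_le (a : R) j H y : 0 < a -> supported c H ->
  (forall i, `|marg s c H (tnth y i) - marg s c (Hs j) (tnth y i)| <= w * marg s c (Hs j) (tnth y i)) ->
  \sum_(i < n.+1) ln (marg s c H0 (tnth y i)) <= \sum_(i < n.+1) ln (marg s c H (tnth y i)) ->
  \sum_(i < n.+1) excess_loss s c H0 (Hs j) (tnth th i) (tnth y i) <=
  lam^-1 * ((\sum_j prod_tilted j y) / a + ln a + 2^-1).
Proof.
move=> a0 HI mm HH0; rewrite ler_pdivlMl//.
set X := \sum_(i < n.+1) excess_loss _ _ _ _ _ _.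
have n0 : n.+1%:R != 0 :> R by rewrite pnatr_eq0.
have lnP : ln (prod_tilted j y) = lam * X + 2^-1 *
   (\sum_(i < n.+1) ln (marg s c (Hs j) (tnth y i)) - \sum_(i < n.+1) ln (marg s c H0 (tnth y i))).
  rewrite mulr_sumr -sumrB mulr_sumr -big_split/= -[RHS]expRK expR_sum.
  congr (ln _); apply: eq_bigr => i _; rewrite expRD; congr (_ * _).
  rewrite -[marg s c (Hs j) _](sqr_sqrt_marg s_gt0 c_gt0 _ (Hsc j)).
  rewrite -[marg s c H0 _](sqr_sqrt_marg s_gt0 c_gt0 _ H0c).
  have p1 := sqrt_marg_gt0 s_gt0 c_gt0 (tnth y i) (Hsc j).
  have p0 := sqrt_marg_gt0 s_gt0 c_gt0 (tnth y i) H0c.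
  rewrite !lnXn//.
  have -> (u v : R) : 2^-1 * (u *+ 2 - v *+ 2) = u - v by field.
  by rewrite expRB !lnK.
have lnH : \sum_(i < n.+1) ln (marg s c H (tnth y i)) <=
    \sum_(i < n.+1) ln (marg s c (Hs j) (tnth y i)) + 1.
  have -> : 1 = \sum_(i < n.+1) w.
    by rewrite sumr_const card_ord -[w *+ _]mulr_natl divff.
  rewrite -big_split; apply: ler_sum => i _ /=.
  have mj := marg_gt0 s_gt0 c_gt0 (tnth y i) (Hsc j).
  have mH := marg_gt0 s_gt0 c_gt0 (tnth y i) HI.
  have w0 : 0 < w by rewrite invr_gt0.
  apply: (@le_trans _ _ (ln (marg s c (Hs j) (tnth y i) * (1 + w)))).
    rewrite ler_ln ?posrE ?mulr_gt0 ?addr_gt0//.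
    have := mm i; rewrite ler_norml => /andP[_].
    by rewrite lerBlDr mulrDr mulr1 addrC [w * _]mulrC.
  rewrite lnM ?posrE ?addr_gt0// lerD2l le_ln1Dx//; apply: lt_trans w0.
  by rewrite ltrN10.
(* The index [j] depends on [y], hence the sum over the whole net; ln(S / a) <= S / a then makes the
   bound linear in the sum. *)
have lnS : ln (prod_tilted j y) <= (\sum_j prod_tilted j y) / a + ln a.
  have S0 : prod_tilted j y <= \sum_j prod_tilted j y.
    rewrite (bigD1 j)//= lerDl; apply: sumr_ge0 => i _; exact/ltW/prod_tilted_gt0.
  have Sp := lt_le_trans (prod_tilted_gt0 j y) S0.
  apply: (@le_trans _ _ (ln (\sum_j prod_tilted j y))); first by rewrite ler_ln ?posrE ?prod_tilted_gt0.
  have -> : \sum_j prod_tilted j y = (\sum_j prod_tilted j y) / a * a.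
    by rewrite divfK// gt_eqF.
  rewrite lnM ?posrE ?divr_gt0// lerD2r divfK ?gt_eqF//.
  exact/ltW/ln_sublinear/divr_gt0.
move: lnP lnH lnS HH0; move: (ln (prod_tilted j y)) (lam * X).
move: (\sum_(i < n.+1) ln (marg s c H0 _)) (\sum_(i < n.+1) ln (marg s c H _)) (\sum_(i < n.+1) ln (marg s c (Hs j) _)).
move: (_ / a + ln a) => *; lra.
Qed.

Lemma pointwise_loss_le (a : R) H y : 1 <= a -> is_npmle s c y H ->
  n.+1%:R^-1 * \sum_(i < n.+1) (posterior_mean s H (tnth y i) - tnth th i) ^+ 2 <=
  n.+1%:R^-1 * (\sum_(i < n.+1) (pmean s c H0 (tnth y i) - tnth th i) ^+ 2)
  + n.+1%:R^-1 * (lam^-1 * ((\sum_j prod_tilted j y) / a + ln a + 2^-1) + 8 * c ^+ 2)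
  + 4 * c ^+ 2 * (expR (- T) * \sum_(i < n.+1) (expR (tnth y i) + expR (- tnth y i))).
Proof.
move=> a1 npH; have HI : supported c H by case: npH.
have a0 : 0 < a by lra.
have n0 : n.+1%:R != 0 :> R by rewrite pnatr_eq0.
have ni0 : 0 <= n.+1%:R^-1 :> R by rewrite invr_ge0.
have e0 : 0 <= \sum_(i < n.+1) (expR (tnth y i) + expR (- tnth y i)).
  by apply: sumr_ge0 => i _; rewrite addr_ge0// expR_ge0.
have S0 : 0 <= lam^-1 * ((\sum_j prod_tilted j y) / a + ln a + 2^-1).
  rewrite mulr_ge0 ?invr_ge0 ?(ltW lam0)// !addr_ge0 ?ln_ge0//.
  by rewrite divr_ge0 ?(ltW a0)// sumr_ge0// => j _; exact/ltW/prod_tilted_gt0.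
have c20 := sqr_ge0 c.
under eq_bigr do rewrite (posterior_meanE s_gt0 c_gt0 _ HI).
have pH y' := norm_pmean_le s_gt0 c_gt0 y' HI.
have p0 y' := norm_pmean_le s_gt0 c_gt0 y' H0c.
(* If some observation exceeds [T], the trivial bound 4 c^2 on the loss is charged to the
   exponential term. *)
have [allT|/existsNP[i /negP]] := pselect (forall i, `|tnth y i| <= T); last first.
  rewrite -ltNge => yT.
  have eT : 1 <= expR (- T) * \sum_(i < n.+1) (expR (tnth y i) + expR (- tnth y i)).
    rewrite expRN mulrC ler_pdivlMr ?expR_gt0// mul1r.
    apply: (@le_trans _ _ (expR (tnth y i) + expR (- tnth y i))); last first.
      rewrite (bigD1 i)//= lerDl; apply: sumr_ge0 => i' _.
      by rewrite addr_ge0// expR_ge0.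
    apply: (@le_trans _ _ (expR `|tnth y i|)); first by rewrite ler_expR ltW.
    by have [?|?] := ger0P (tnth y i); rewrite ?lerDl ?lerDr expR_ge0.
  rewrite -[leLHS]add0r; apply: lerD.
    rewrite addr_ge0//; apply: mulr_ge0 => //.
      by apply: sumr_ge0 => i' _; exact: sqr_ge0.
    by rewrite addr_ge0// mulr_ge0.
  apply: (@le_trans _ _ (4 * c ^+ 2)); last by rewrite ler_peMr// mulr_ge0.
  rewrite ler_pdivrMl//.
  have -> : n.+1%:R * (4 * c ^+ 2) = \sum_(i < n.+1) 4 * c ^+ 2.
    by rewrite sumr_const card_ord -[RHS]mulr_natl.
  apply: ler_sum => i' _; rewrite (_ : 4 * c ^+ 2 = (2 * c) ^+ 2); last by ring.
  rewrite -[leLHS]real_normK ?num_real// lerXn2r ?nnegrE ?mulr_ge0// ?(ltW c_gt0)//.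
  apply: le_trans (ler_normB _ _) _; rewrite mulr2n mulrDl mul1r.
  by apply: lerD; [exact: pH|exact: thc].
have [j jP] := coverP HI.
have pj y' := norm_pmean_le s_gt0 c_gt0 y' (Hsc j).
rewrite -[leLHS]addr0; apply: lerD; last first.
  by apply: mulr_ge0; [exact: mulr_ge0|rewrite mulr_ge0 ?expR_ge0].
rewrite -mulrDr ler_wpM2l//.
(* Passing from the estimate to its net point moves each posterior mean by at most [2 * c * w]; over
   all coordinates this costs 8 c^2. *)
apply: (@le_trans _ _ (\sum_(i < n.+1) ((pmean s c H0 (tnth y i) - tnth th i) ^+ 2 +
   excess_loss s c H0 (Hs j) (tnth th i) (tnth y i) + 4 * c * (2 * c * w)))).
  apply: ler_sum => i _; rewrite /excess_loss [_ ^+ 2 + (_ - _)]addrC subrK.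
  by apply: sqr_sub_le => //; have [] := jP _ (allT i).
rewrite big_split/= big_split/= -[leLHS]addrA lerD2l; apply: lerD.
  apply: (sum_excess_loss_le a0 HI); last exact: npmle_sum_ln_marg_ge.
  by move=> i; have [] := jP _ (allT i).
rewrite sumr_const card_ord -[_ *+ n.+1]mulr_natl /w le_eqVlt; apply/orP; left; apply/eqP.
by field.
Qed.

End conditional_risk.

Section bayes_risk.
Context (R : realType) (s c : R) (s_gt0 : 0 < s) (c_gt0 : 0 < c).
Notation k := (gauss_ratio s).
Notation nu := (normal_law 0 s).
Local Open Scope ereal_scope.

Definition point_risk (g : R -> R) (t : R) : \bar R :=
  \int[normal_law t s]_y ((g y - t) ^+ 2)%:E.

Lemma point_risk_ge0 g t : 0 <= point_risk g t.
Proof. by apply: integral_ge0 => y _; rewrite lee_fin sqr_ge0. Qed.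

Lemma point_riskE g t : measurable_fun setT g ->
  point_risk g t = \int[nu]_y ((g y - t) ^+ 2 * k t y)%:E.
Proof.
move=> mg.
have ml : measurable_fun setT (fun y => ((g y - t) ^+ 2)%:E).
  by apply/measurable_EFinP; apply: measurable_funX; exact: measurable_funB.
have l0 y : 0 <= ((g y - t) ^+ 2)%:E by rewrite lee_fin sqr_ge0.
rewrite /point_risk (integral_normal_law_ratio s_gt0 t ml l0).
by apply: eq_integral => y _; rewrite -EFinM.
Qed.

Lemma measurable_weighted_loss (g : R -> R) : measurable_fun setT g ->
  measurable_fun setT (fun z : R * R => ((g z.2 - z.1) ^+ 2 * k z.1 z.2)%:E).
Proof.
move=> mg; apply/measurable_EFinP; apply: measurable_funM; last exact: measurable_gauss_ratio2.
apply: measurable_funX; apply: measurable_funB; last exact: measurable_fst.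
exact: (measurableT_comp mg measurable_snd).
Qed.

Lemma measurable_point_risk g : measurable_fun setT g -> measurable_fun setT (point_risk g).
Proof.
move=> mg; rewrite (_ : point_risk g =
    fun t => \int[nu]_y ((g y - t) ^+ 2 * k t y)%:E); last first.
  by apply/funext => t; exact: point_riskE.
apply: (@measurable_fun_fubini_tonelli_F _ _ _ _ R nu
  (fun z : R * R => ((g z.2 - z.1) ^+ 2 * k z.1 z.2)%:E)).
  exact: measurable_weighted_loss.
by move=> z; rewrite lee_fin mulr_ge0 ?sqr_ge0// gauss_ratio_ge0.
Qed.

Lemma bounded_meas_weighted_loss (a y : R) :
  bounded_meas c (fun t => (a - t) ^+ 2 * k t y)%R.
Proof.
apply: bounded_measM; last exact: bounded_meas_gauss_ratio.
by apply: bounded_measX; apply: bounded_measB; [exact: bounded_meas_cst|exact: bounded_meas_id].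
Qed.

Lemma integral_point_riskE (H : probability R R) g : supported c H -> measurable_fun setT g ->
  \int[H]_t point_risk g t =
  \int[nu]_y (expect c H (fun t => (g y - t) ^+ 2 * k t y)%R)%:E.
Proof.
move=> HI mg; transitivity (\int[H]_t \int[nu]_y ((g y - t) ^+ 2 * k t y)%:E).
  by apply: eq_integral => t _; exact: point_riskE.
transitivity (\int[nu]_y \int[H]_t ((g y - t) ^+ 2 * k t y)%:E).
  apply: (@fubini_tonelli _ _ _ _ _ H nu (fun z : R * R => ((g z.2 - z.1) ^+ 2 * k z.1 z.2)%:E)).
    exact: measurable_weighted_loss.
  by move=> z; rewrite lee_fin mulr_ge0 ?sqr_ge0// gauss_ratio_ge0.
apply: eq_integral => y _; rewrite (EFin_expect HI)//.
exact: bounded_meas_weighted_loss.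
Qed.

(** By Tonelli the risk is an integral over [y] of expected losses, each minimized by the posterior
    mean at that [y]. *)
Lemma bayes_risk_le (H : probability R R) g : supported c H -> measurable_fun setT g ->
  \int[H]_t point_risk (pmean s c H) t <= \int[H]_t point_risk g t.
Proof.
move=> HI mg; rewrite !integral_point_riskE//; last exact: measurable_pmean.
apply: ge0_le_integralT => y.
  rewrite lee_fin; apply: expect_ge0 => t _.
  by rewrite mulr_ge0 ?sqr_ge0// gauss_ratio_ge0.
by rewrite lee_fin; exact: expect_pmean_le.
Qed.

Lemma integral_empirical n (th : n.+1.-tuple R) (f : R -> \bar R) :
  measurable_fun setT f -> (forall t, 0 <= f t) ->
  \int[empirical_prob th]_t f t = (n.+1%:R^-1)%:E * \sum_(i < n.+1) f (tnth th i).
Proof.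
move=> mf f0; rewrite ge0_integral_average_prob//; congr (_ * _).
apply: eq_bigr => i _; rewrite integral_dirac// [X in X * _](_ : _ = 1) ?mul1e//.
by rewrite diracT.
Qed.

End bayes_risk.

Section conditional_risk_integral.
Context (R : realType) (s c : R) (s_gt0 : 0 < s) (c_gt0 : 0 < c).
Context (n : nat) (th : n.+1.-tuple R).
Hypothesis thc : forall i, `|tnth th i| <= c.
Notation H0 := (empirical_prob th).
Let H0c : supported c H0 := supported_empirical thc.
Variables (J : finType) (Hs : J -> probability R R) (T l : R).
Hypothesis J_gt0 : (0 < #|J|)%N.
Hypothesis Hsc : forall j, supported c (Hs j).
Hypothesis coverP : forall H, supported c H -> exists j, forall y, `|y| <= T ->
  `|marg s c H y - marg s c (Hs j) y| <= n.+1%:R^-1 * marg s c (Hs j) y /\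
  `|pmean s c H y - pmean s c (Hs j) y| <= 2 * c * n.+1%:R^-1.
Hypotheses (l0 : 0 < l) (T0 : 0 <= T) (lT : l * (c + T + l) / s ^+ 2 <= 1)
  (lc : 2 * l * c / s ^+ 2 <= 1).
Let lam := l ^+ 2 / (144 * s ^+ 4).
Hypothesis lamc : lam * (16 * c ^+ 2) <= 1.
Notation tau := (tilted_error s c l T).
Notation M := (exp_moment_bound s c).

(** Bounds the mean of the remainders in [pointwise_loss_le] when ln a is ln #|J| + (n + 1) tau; the
    3/2 is the 1/2 found there plus 1 for the mean of S / a. *)
Definition regret_bound : R :=
  n.+1%:R^-1 * (lam^-1 * (ln #|J|%:R + n.+1%:R * tau + 3 / 2) + 8 * c ^+ 2) +
  8 * c ^+ 2 * n.+1%:R * expR (- T) * M.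

Lemma conditional_risk_le (Ghat : n.+1.-tuple R -> probability R R) :
  (forall y, is_npmle s c y (Ghat y)) ->
  (\int[obs_law s th]_y (squared_loss th (plugin_rule s Ghat y))%:E <=
   (n.+1%:R^-1)%:E * \sum_(i < n.+1) point_risk s (pmean s c H0) (tnth th i)
   + regret_bound%:E)%E.
Proof.
move=> np.
have lam0 : 0 < lam by rewrite divr_gt0 ?mulr_gt0 ?exprn_gt0.
(* [a] bounds the mean of the sum [S] over the net, so that S / a has mean at most 1. *)
pose a := #|J|%:R * expR (n.+1%:R * tau).
have tau0 : 0 <= tau.
  have de0 : 0 <= difference_error s c l by rewrite mulr_ge0 ?sqr_ge0// mulr_ge0 ?sqr_ge0.
  apply: mulr_ge0; first by rewrite mulr_ge0// ltW.
  apply: addr_ge0 => //; apply: mulr_ge0; last exact: expR_ge0.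
  by apply: mulr_ge0; [rewrite mulr_ge0// sqr_ge0|exact: expR_ge0].
have J1 : 1 <= #|J|%:R :> R by rewrite ler1n.
have a1 : 1 <= a.
  rewrite -[leLHS]mulr1; apply: ler_pM => //.
  by apply: le_trans (expR_ge1Dx _); rewrite lerDl mulr_ge0.
have a0 : 0 < a by apply: lt_le_trans a1.
have lna : ln a = ln #|J|%:R + n.+1%:R * tau.
  by rewrite lnM ?posrE ?expR_gt0 ?expRK// (lt_le_trans _ J1).
pose f1 (y : n.+1.-tuple R) := \sum_(i < n.+1) (pmean s c H0 (tnth y i) - tnth th i) ^+ 2.
pose S (y : n.+1.-tuple R) := \sum_j prod_tilted s c th Hs lam j y.
pose X (y : n.+1.-tuple R) := \sum_(i < n.+1) (expR (tnth y i) + expR (- tnth y i)).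
pose ni : R := n.+1%:R^-1.
have ni0 : 0 <= ni by rewrite invr_ge0.
pose C1 := ni * (lam^-1 / a); pose C0 := ni * (lam^-1 * (ln a + 2^-1) + 8 * c ^+ 2).
pose C2 := 4 * c ^+ 2 * expR (- T).
have pt y : squared_loss th (plugin_rule s Ghat y) <= ni * f1 y + (C1 * S y + C0) + C2 * X y.
  apply: (@le_trans _ _ (n.+1%:R^-1 * \sum_(i < n.+1)
      (posterior_mean s (Ghat y) (tnth y i) - tnth th i) ^+ 2)).
    rewrite /squared_loss ler_wpM2l// le_eqVlt; apply/orP; left; apply/eqP.
    by apply: eq_bigr => i _; rewrite tnth_mktuple.
  apply: le_trans (pointwise_loss_le s_gt0 c_gt0 thc Hsc coverP lam0 a1 (np y)) _.
  rewrite -/(f1 y) -/(S y) -/(X y) -/ni le_eqVlt; apply/orP; left; apply/eqP.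
  rewrite /C1 /C0 /C2; move: (f1 y) (S y) (X y) (ln a) (lam^-1) (a^-1) (expR (- T)).
  by move=> *; ring.
have C10 : 0 <= C1 by rewrite mulr_ge0// divr_ge0 ?invr_ge0 ?(ltW lam0) ?(ltW a0).
have C00 : 0 <= C0.
  apply: mulr_ge0 => //; apply: addr_ge0; last by rewrite mulr_ge0// sqr_ge0.
  by rewrite mulr_ge0 ?invr_ge0 ?(ltW lam0)// addr_ge0// ln_ge0.
have C20 : 0 <= C2 by rewrite mulr_ge0 ?expR_ge0// mulr_ge0// sqr_ge0.
have mtn i : measurable_fun setT (fun y : n.+1.-tuple R => tnth y i) by exact: measurable_tnth.
have ml i : measurable_fun setT (fun y : R => (pmean s c H0 y - tnth th i) ^+ 2).
  by apply: measurable_funX; apply: measurable_funB => //; exact: measurable_pmean.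
have mli i : measurable_fun setT
    (fun y : n.+1.-tuple R => (pmean s c H0 (tnth y i) - tnth th i) ^+ 2).
  exact: (measurableT_comp (ml i) (mtn i)).
have mf1 : measurable_fun setT f1 by exact: measurable_sum.
have f10 y : 0 <= f1 y by apply: sumr_ge0 => i _; exact: sqr_ge0.
have mSj j : measurable_fun setT (prod_tilted s c th Hs lam j).
  apply: measurable_prod => i _.
  exact: (measurableT_comp (measurable_tilted s_gt0 c_gt0 H0c (Hsc j) lam (tnth th i)) (mtn i)).
have Sj0 j y : 0 <= prod_tilted s c th Hs lam j y by exact/ltW/prod_tilted_gt0.
have mS : measurable_fun setT S by exact: measurable_sum.
have S0 y : 0 <= S y by exact: sumr_ge0.
have me (b : R) : measurable_fun setT (fun y : R => expR (b * y)).
  by apply: measurableT_comp => //; exact: measurable_funM.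
have meN : measurable_fun setT (fun y : R => expR (- y)).
  by under eq_fun do rewrite -mulN1r; exact: me.
have mex : measurable_fun setT (fun y : R => expR y + expR (- y)) by exact: measurable_funD.
have mXi i : measurable_fun setT (fun y : n.+1.-tuple R => expR (tnth y i) + expR (- tnth y i)).
  exact: (measurableT_comp mex (mtn i)).
have Xi0 (y : R) : 0 <= expR y + expR (- y) by rewrite addr_ge0 ?expR_ge0.
have mX : measurable_fun setT X by exact: measurable_sum.
have X0 y : 0 <= X y by exact: sumr_ge0.
pose P := obs_law s th.
apply: (@le_trans _ _ (\int[P]_y (ni * f1 y + (C1 * S y + C0) + C2 * X y)%:E)%E).
  apply: ge0_le_integralT => y; last by rewrite lee_fin pt.
  by rewrite lee_fin mulr_ge0 ?invr_ge0// sumr_ge0// => i _; exact: sqr_ge0.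
have mCS : measurable_fun setT (fun y => C1 * S y + C0) by apply: measurable_funD => //; exact: measurable_funM.
have CS0 y : 0 <= C1 * S y + C0 by rewrite addr_ge0// mulr_ge0.
have mnf : measurable_fun setT (fun y => ni * f1 y) by exact: measurable_funM.
have nf0 y : 0 <= ni * f1 y by rewrite mulr_ge0.
rewrite ge0_integralD_EFin; last 4 first.
- exact: measurable_funD.
- by move=> y; rewrite addr_ge0.
- exact: measurable_funM.
- by move=> y; rewrite mulr_ge0.
rewrite (ge0_integralD_EFin _ mnf nf0 mCS CS0) (ge0_integralZ_EFin _ ni0 mf1 f10).
rewrite (ge0_integralZ_EFin _ C20 mX X0).
have If1 : (\int[P]_y (f1 y)%:E = \sum_(i < n.+1) point_risk s (pmean s c H0) (tnth th i))%E.
  rewrite /f1 ge0_integral_sum_EFin//; last by move=> i y; exact: sqr_ge0.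
  apply: eq_bigr => i _.
  apply: (integral_tuple_prod_tnth (fun i => normal_law (tnth th i) s) i
    (g := fun y => ((pmean s c H0 y - tnth th i) ^+ 2)%:E)).
    exact/measurable_EFinP.
  by move=> y; rewrite lee_fin sqr_ge0.
have IS : (\int[P]_y (S y)%:E <= a%:E)%E.
  rewrite /S ge0_integral_sum_EFin//.
  apply: (@le_trans _ _ (\sum_(j in J) (expR (n.+1%:R * tau))%:E)%E).
    by apply: lee_sum => j _; exact: integral_prod_tilted_le.
  by rewrite sumEFin sumr_const lee_fin -[leLHS]mulr_natl.
have ICS : (\int[P]_y (C1 * S y + C0)%:E <= (C1 * a + C0)%:E)%E.
  rewrite ge0_integralD_EFin//; last by move=> y; rewrite mulr_ge0.
    rewrite (ge0_integralZ_EFin _ C10 mS S0) integral_probability_cst EFinD.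
    have C1E : (0 <= C1%:E)%E by rewrite lee_fin.
    by apply: leeD => //; exact: (lee_wpmul2l C1E IS).
  exact: measurable_funM.
have M0 : 0 <= M by exact: expR_ge0.
have IX : (\int[P]_y (X y)%:E <= (n.+1%:R * (2 * M))%:E)%E.
  rewrite /X ge0_integral_sum_EFin//.
  apply: (@le_trans _ _ (\sum_(i in 'I_n.+1) (2 * M)%:E)%E); last first.
    by rewrite sumEFin sumr_const card_ord lee_fin -[leLHS]mulr_natl.
  apply: lee_sum => i _.
  rewrite (integral_tuple_prod_tnth (fun i => normal_law (tnth th i) s) i
    (g := fun y => (expR y + expR (- y))%:E)); last 2 first.
  - exact/measurable_EFinP.
  - by move=> y; rewrite lee_fin.
  rewrite ge0_integralD_EFin//.
  have e1 := integral_normal_law_expR s_gt0 (tnth th i) (expr1n R 2).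
  have e2 := integral_normal_law_expR s_gt0 (tnth th i) (_ : (-1) ^+ 2 = 1 :> R).
  under eq_integral do rewrite -[X in expR X]mul1r.
  under [X in (_ + X)%E]eq_integral do rewrite -mulN1r.
  rewrite e1 e2; last by rewrite sqrrN expr1n.
  have -> : 2 * M = M + M by ring.
  rewrite -EFinD lee_fin; apply: lerD; rewrite ler_expR lerD2r.
    by rewrite mul1r (le_trans (ler_norm _)).
  by rewrite mulN1r (le_trans (ler_norm _))// normrN.
rewrite If1 -addeA; apply: leeD => //.
have -> : regret_bound = C1 * a + C0 + C2 * (n.+1%:R * (2 * M)).
  rewrite /regret_bound -lna /C0 /C1 /C2 -/ni.
  have -> : ni * (lam^-1 / a) * a = ni * lam^-1 by field; rewrite !gt_eqF.
  by move: (ln a) lam^-1 (expR (- T)) => *; field.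
have C2E : (0 <= C2%:E)%E by rewrite lee_fin.
by rewrite EFinD; apply: leeD => //; exact: (lee_wpmul2l C2E IX).
Qed.

End conditional_risk_integral.

(** * Minimax lower bound *)

Section double_tuple.
Context d (T : measurableType d) (R : realType).
Local Open Scope ereal_scope.

Lemma measurable_cons_double n (F : n.+1.-tuple T * n.+1.-tuple T -> \bar R) :
  measurable_fun setT F ->
  measurable_fun setT (fun w : (T * T) * (n.-tuple T * n.-tuple T) =>
    F (cons_pair (w.1.1, w.2.1), cons_pair (w.1.2, w.2.2))).
Proof.
move=> mF; apply: (measurableT_comp mF); apply: measurable_fun_pair.
  apply: (measurableT_comp (@measurable_cons_pair _ T n)); apply: measurable_fun_pair.
    exact: (measurableT_comp measurable_fst measurable_fst).
  exact: (measurableT_comp measurable_fst measurable_snd).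
apply: (measurableT_comp (@measurable_cons_pair _ T n)); apply: measurable_fun_pair.
  exact: (measurableT_comp measurable_snd measurable_fst).
exact: (measurableT_comp measurable_snd measurable_snd).
Qed.

(** Splits off the first entry of each tuple; Tonelli moves the first entry of the second tuple past
    the rest of the first one. *)
Lemma integral_double_tupleS (P Q : probability T R) n
    (F : n.+1.-tuple T * n.+1.-tuple T -> \bar R) :
  measurable_fun setT F -> (forall x, 0 <= F x) ->
  \int[tuple_prod (fun _ : 'I_n.+1 => P)]_x \int[tuple_prod (fun _ : 'I_n.+1 => Q)]_y F (x, y) =
  \int[P]_a \int[Q]_b \int[tuple_prod (fun _ : 'I_n => P)]_x
    \int[tuple_prod (fun _ : 'I_n => Q)]_y
      F ([tuple of a :: x], [tuple of b :: y]).
Proof.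
move=> mF F0.
rewrite ge0_integral_tuple_prodS; last 2 first.
- exact: (@measurable_fun_fubini_tonelli_F _ _ _ _ R (tuple_prod (fun _ : 'I_n.+1 => Q)) F).
- by move=> x; exact: integral_ge0.
apply: eq_integral => a _.
under eq_integral => x _.
  rewrite ge0_integral_tuple_prodS//; last exact: measurable_fun_pair2.
  over.
apply: (@fubini_tonelli _ _ _ _ R (tuple_prod (fun _ : 'I_n => P)) Q
  (fun z : n.-tuple T * T => \int[tuple_prod (fun _ : 'I_n => Q)]_y F ([tuple of a :: z.1], [tuple of z.2 :: y]))).
  apply: (@measurable_fun_fubini_tonelli_F _ _ _ _ R (tuple_prod (fun _ : 'I_n => Q))
   (fun w : (n.-tuple T * T) * n.-tuple T =>
      F ([tuple of a :: w.1.1], [tuple of w.1.2 :: w.2]))) => //.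
  have mg : measurable_fun setT (fun w : (n.-tuple T * T) * n.-tuple T =>
      ((a, w.1.2), (w.1.1, w.2))).
    apply: measurable_fun_pair.
      by apply: measurable_fun_pair => //; exact: (measurableT_comp measurable_snd measurable_fst).
    by apply: measurable_fun_pair => //; exact: (measurableT_comp measurable_fst measurable_fst).
  exact: (measurableT_comp (measurable_cons_double mF) mg).
by move=> z; exact: integral_ge0.
Qed.

(** Grouping the first entries into one pair and the remaining ones into another, a single Tonelli
    exchange puts the first entries innermost; the rest has total mass 1. *)
Lemma double_tuple_swap (P Q : probability T R) n
    (F : n.+1.-tuple T * n.+1.-tuple T -> \bar R) (r : \bar R) :
  measurable_fun setT F -> (forall x, 0 <= F x) -> 0 <= r ->
  (forall x y : n.-tuple T,
    r <= \int[P]_a \int[Q]_b F ([tuple of a :: x], [tuple of b :: y])) ->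
  r <= \int[P]_a \int[Q]_b \int[tuple_prod (fun _ : 'I_n => P)]_x
    \int[tuple_prod (fun _ : 'I_n => Q)]_y
      F ([tuple of a :: x], [tuple of b :: y]).
Proof.
move=> mF F0 r0 rF.
pose Pn := tuple_prod (fun _ : 'I_n => P); pose Qn := tuple_prod (fun _ : 'I_n => Q).
pose R1 : probability (T * T)%type R := (P \x Q)%E.
pose R2 : probability (n.-tuple T * n.-tuple T)%type R := (Pn \x Qn)%E.
pose G (w : (T * T) * (n.-tuple T * n.-tuple T)) :=
  F (cons_pair (w.1.1, w.2.1), cons_pair (w.1.2, w.2.2)).
have mG : measurable_fun setT G by exact: measurable_cons_double.
have G0 w : 0 <= G w by exact: F0.
have mG1 p : measurable_fun setT (fun q => G (p, q)) by exact: measurable_fun_pair2.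
have mG2 q : measurable_fun setT (fun p => G (p, q)) by exact: measurable_fun_pair1.
pose I (p : T * T) := \int[R2]_q G (p, q).
have mI : measurable_fun setT I.
  by apply: (@measurable_fun_fubini_tonelli_F _ _ _ _ R R2 G).
have I0 (p : T * T) : 0 <= I p by exact: integral_ge0.
have E1 : \int[R1]_p I p = \int[P]_a \int[Q]_b I (a, b).
  exact: (@fubini_tonelli1 _ _ _ _ R P Q I mI I0).
have E2 p : I p = \int[Pn]_x \int[Qn]_y G (p, (x, y)).
  exact: (@fubini_tonelli1 _ _ _ _ R Pn Qn (fun q => G (p, q)) (mG1 p) (fun q => G0 (p, q))).
have E3 : \int[R1]_p I p = \int[R2]_q \int[R1]_p G (p, q).
  exact: (@fubini_tonelli _ _ _ _ R R1 R2 G mG G0).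
have -> : \int[P]_a \int[Q]_b \int[Pn]_x \int[Qn]_y F ([tuple of a :: x], [tuple of b :: y]) =
    \int[R2]_q \int[R1]_p G (p, q).
  rewrite -E3 E1; apply: eq_integral => a _; apply: eq_integral => b _.
  by rewrite E2.
apply: (@le_trans _ _ (\int[R2]_q r)).
  by rewrite (integral_probability_cst R2).
apply: ge0_le_integralT => [//|q].
rewrite (_ : \int[R1]_p G (p, q) = \int[P]_a \int[Q]_b G ((a, b), q)).
  exact: rF.
exact: (@fubini_tonelli1 _ _ _ _ R P Q (fun p => G (p, q)) (mG2 q) (fun p => G0 (p, q))).
Qed.

End double_tuple.

Section location_model.
Context (R : realType) (s : R) (s_gt0 : 0 < s).
Notation nu := (normal_law 0 s).
Local Open Scope ereal_scope.

Definition add_tuple n (x y : n.-tuple R) : n.-tuple R :=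
  [tuple (tnth y i + tnth x i)%R | i < n].

Lemma add_tuple_cons n (a b : R) (x y : n.-tuple R) :
  add_tuple [tuple of a :: x] [tuple of b :: y] = [tuple of (b + a)%R :: add_tuple x y].
Proof.
apply: eq_from_tnth => i; rewrite tnth_mktuple.
by case: (unliftP ord0 i) => [j ->|->//]; rewrite !tnthS tnth_mktuple.
Qed.

Lemma measurable_add_tuple n :
  measurable_fun setT (fun w : n.-tuple R * n.-tuple R => add_tuple w.1 w.2).
Proof.
apply/measurable_fun_tnthP => i.
rewrite (_ : _ \o _ = fun w : n.-tuple R * n.-tuple R => (tnth w.2 i + tnth w.1 i)%R).
  apply: measurable_funD.
    exact: (measurableT_comp (measurable_tnth i) measurable_snd).
  exact: (measurableT_comp (measurable_tnth i) measurable_fst).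
by apply/funext => w /=; rewrite tnth_mktuple.
Qed.

Lemma integral_obs_law n (th : n.-tuple R) (F : n.-tuple R -> \bar R) :
  measurable_fun setT F -> (forall y, 0 <= F y) ->
  \int[obs_law s th]_y F y = \int[tuple_prod (fun _ : 'I_n => nu)]_z F (add_tuple th z).
Proof.
move=> mF F0.
have mh (i : 'I_n) : measurable_fun [set: R] (fun x : R => x + tnth th i)%R.
  exact: measurable_funD.
have hE (i : 'I_n) (g : R -> \bar R) : measurable_fun setT g -> (forall x, 0 <= g x) ->
    \int[normal_law (tnth th i) s]_x g x = \int[nu]_x g (x + tnth th i)%R.
  by move=> mg g0; exact: (integral_normal_law_shift s_gt0).
exact: (integral_tuple_prod_map mh hE mF F0).
Qed.

(** In the representation as parameters plus noise, [th] occurs only in the integrand and no longer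
    in the measure, so that Tonelli gives measurability. *)
Lemma measurable_integral_obs_law n (F : n.-tuple R * n.-tuple R -> \bar R) :
  measurable_fun setT F -> (forall w, 0 <= F w) ->
  measurable_fun setT (fun th => \int[obs_law s th]_y F (th, y)).
Proof.
move=> mF F0.
rewrite (_ : (fun _ => _) = fun th : n.-tuple R =>
    \int[tuple_prod (fun _ : 'I_n => nu)]_z F (th, add_tuple th z)); last first.
  apply/funext => th.
  exact: (@integral_obs_law _ th (fun y => F (th, y)) (measurable_fun_pair2 th mF) (fun y => F0 _)).
apply: (@measurable_fun_fubini_tonelli_F _ _ _ _ R (tuple_prod (fun _ : 'I_n => nu))
  (fun w : n.-tuple R * n.-tuple R => F (w.1, add_tuple w.1 w.2))) => //.
apply: (measurableT_comp mF); apply: measurable_fun_pair; first exact: measurable_fst.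
exact: measurable_add_tuple.
Qed.

Variables (c : R) (c_gt0 : (0 < c)%R) (G : probability R R).
Hypothesis Gc : supported c G.

(** Independence makes the other coordinates useless. If [i] is not the first coordinate, the first
    parameter and noise are frozen and the induction hypothesis applies; if it is, all the others
    are frozen, and the rule becomes a function of one observation, covered by [bayes_risk_le]. *)
Lemma bayes_risk_coordinate_le n (i : 'I_n) (g : n.-tuple R -> R) : measurable_fun setT g ->
  \int[G]_t point_risk s (pmean s c G) t <=
  \int[tuple_prod (fun _ : 'I_n => G)]_th \int[tuple_prod (fun _ : 'I_n => nu)]_z
    ((g (add_tuple th z) - tnth th i) ^+ 2)%:E.
Proof.
have r0 : 0 <= \int[G]_t point_risk s (pmean s c G) t.
  by apply: integral_ge0 => t _; exact: point_risk_ge0.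
elim: n i g => [|n IH] i g mg; first by case: i.
pose F (w : n.+1.-tuple R * n.+1.-tuple R) : \bar R :=
  ((g (add_tuple w.1 w.2) - tnth w.1 i) ^+ 2)%:E.
have mF : measurable_fun setT F.
  apply/measurable_EFinP; apply: measurable_funX; apply: measurable_funB.
    exact: (measurableT_comp mg (@measurable_add_tuple n.+1)).
  exact: (measurableT_comp (measurable_tnth i) measurable_fst).
have F0 w : 0 <= F w by rewrite lee_fin sqr_ge0.
rewrite (integral_double_tupleS G nu mF F0).
case: (unliftP ord0 i) => [j ij|i0].
  rewrite -[leLHS](integral_probability_cst G); apply: ge0_le_integralT => [//|a].
  rewrite -[leLHS](integral_probability_cst nu); apply: ge0_le_integralT => [//|b].
  have mgb : measurable_fun setT (fun y : n.-tuple R => g [tuple of (b + a)%R :: y]).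
    apply: (measurableT_comp mg).
    exact: (measurableT_comp (@measurable_cons_pair _ R n) (pair1_measurable (b + a)%R)).
  apply: le_trans (IH j _ mgb) _.
  rewrite le_eqVlt; apply/orP; left; apply/eqP.
  apply: eq_integral => x _; apply: eq_integral => y _.
  by rewrite /F /= add_tuple_cons ij tnthS.
apply: (double_tuple_swap mF F0 r0) => x y.
pose gxy (u : R) := g [tuple of u :: add_tuple x y].
have mgxy : measurable_fun setT gxy.
  apply: (measurableT_comp mg).
  exact: (measurableT_comp (@measurable_cons_pair _ R n) (pair2_measurable _)).
apply: le_trans (bayes_risk_le s_gt0 c_gt0 Gc mgxy) _.
rewrite le_eqVlt; apply/orP; left; apply/eqP.
apply: eq_integral => a _.
have ml : measurable_fun setT (fun u : R => ((gxy u - a) ^+ 2)%:E).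
  by apply/measurable_EFinP; apply: measurable_funX; exact: measurable_funB.
have l0 (u : R) : 0 <= ((gxy u - a) ^+ 2)%:E :> \bar R by rewrite lee_fin sqr_ge0.
rewrite /point_risk (integral_normal_law_shift s_gt0 a ml l0).
by apply: eq_integral => b _; rewrite /F /= add_tuple_cons i0.
Qed.

End location_model.

Section mean.
Context (R : realType) (n : nat).
Local Open Scope ereal_scope.

Let ni0 : 0 <= (n.+1%:R^-1)%:E :> \bar R.
Proof. by rewrite lee_fin invr_ge0. Qed.

Lemma ge0_integral_mean d (T : measurableType d) (mu : {measure set T -> \bar R})
    (F : 'I_n.+1 -> T -> \bar R) :
  (forall i, measurable_fun setT (F i)) -> (forall i x, 0 <= F i x) ->
  \int[mu]_x ((n.+1%:R^-1)%:E * \sum_(i < n.+1) F i x) =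
  (n.+1%:R^-1)%:E * \sum_(i < n.+1) \int[mu]_x F i x.
Proof.
move=> mF F0; rewrite ge0_integralZl//.
- by rewrite ge0_integral_sum.
- exact: emeasurable_sum.
- by move=> x _; exact: sume_ge0.
Qed.

(** [r] may be infinite, so it is factored out of the sum before the real coefficients are
    simplified. *)
Lemma mean_cst (r : \bar R) : 0 <= r ->
  (n.+1%:R^-1)%:E * \sum_(i < n.+1) r = r.
Proof.
move=> r0.
transitivity ((n.+1%:R^-1)%:E * ((\sum_(i < n.+1) 1%:E) * r)).
  by congr (_ * _); rewrite ge0_sume_distrl//; apply: eq_bigr => i _; rewrite mul1e.
by rewrite sumEFin muleA -EFinM sumr_const card_ord mulVf ?mul1e.
Qed.

Lemma le_mean (a b : 'I_n.+1 -> \bar R) : (forall i, a i <= b i) ->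
  (n.+1%:R^-1)%:E * \sum_(i < n.+1) a i <= (n.+1%:R^-1)%:E * \sum_(i < n.+1) b i.
Proof. by move=> ab; apply: (lee_wpmul2l ni0); exact: lee_sum. Qed.

Lemma EFin_mean (a : 'I_n.+1 -> R) :
  (n.+1%:R^-1 * \sum_(i < n.+1) a i)%:E = (n.+1%:R^-1)%:E * \sum_(i < n.+1) (a i)%:E.
Proof. by rewrite EFinM sumEFin. Qed.

End mean.

Section minimax_lower_bound.
Context (R : realType) (s c : R) (s_gt0 : 0 < s) (c_gt0 : 0 < c).
Variables (G : probability R R) (G_supp : G `]-c, c[%classic = 1%E).
Notation nu := (normal_law 0 s).
Local Open Scope ereal_scope.

Lemma supported_itv_oo : supported c G.
Proof.
apply/eqP; rewrite eq_le probability_le1//= -G_supp le_measure ?inE//.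
by move=> x /=; rewrite !in_itv/= => /andP[/ltW -> /ltW ->].
Qed.

Let Gc := supported_itv_oo.

Definition bayes_risk : \bar R := \int[G]_t point_risk s (pmean s c G) t.

Lemma bayes_risk_ge0 : 0 <= bayes_risk.
Proof. by apply: integral_ge0 => t _; exact: point_risk_ge0. Qed.

Lemma measurable_squared_loss n (D : decision_rule R n) : measurable_fun setT D ->
  measurable_fun setT (fun w : n.-tuple R * n.-tuple R => (squared_loss w.1 (D w.2))%:E).
Proof.
move=> mD; apply/measurable_EFinP; apply: measurable_funM => //.
apply: measurable_sum => i; apply: measurable_funX; apply: measurable_funB.
  exact: (measurableT_comp (measurable_tnth i) (measurableT_comp mD measurable_snd)).
exact: (measurableT_comp (measurable_tnth i) measurable_fst).
Qed.

Lemma squared_loss_ge0 n (x y : n.-tuple R) : (0 <= squared_loss x y)%R.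
Proof. by rewrite mulr_ge0 ?invr_ge0// sumr_ge0// => i _; exact: sqr_ge0. Qed.

Lemma bayes_risk_le_risk n (D : decision_rule R n.+1) : measurable_fun setT D ->
  bayes_risk <= risk s (tuple_prod (fun _ : 'I_n.+1 => G)) D.
Proof.
move=> mD; pose L i (w : n.+1.-tuple R * n.+1.-tuple R) : \bar R :=
  ((tnth (D (add_tuple w.1 w.2)) i - tnth w.1 i) ^+ 2)%:E.
have mDi i : measurable_fun setT (fun y => tnth (D y) i).
  exact: (measurableT_comp (measurable_tnth i) mD).
have mL i : measurable_fun setT (L i).
  apply/measurable_EFinP; apply: measurable_funX; apply: measurable_funB.
    exact: (measurableT_comp (mDi i) (@measurable_add_tuple R n.+1)).
  exact: (measurableT_comp (measurable_tnth i) measurable_fst).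
have L0 i w : 0 <= L i w by rewrite lee_fin sqr_ge0.
pose nun := tuple_prod (fun _ : 'I_n.+1 => nu).
have mI i : measurable_fun setT (fun th => \int[nun]_z L i (th, z)).
  exact: (@measurable_fun_fubini_tonelli_F _ _ _ _ R nun (L i) (mL i) (L0 i)).
have I0 i th : 0 <= \int[nun]_z L i (th, z) by exact: integral_ge0.
rewrite /risk (_ : \int[_]_th _ = \int[tuple_prod (fun _ : 'I_n.+1 => G)]_th
    ((n.+1%:R^-1)%:E * \sum_(i < n.+1) \int[nun]_z L i (th, z))); last first.
  apply: eq_integral => th _.
  have ml : measurable_fun setT (fun y => (squared_loss th (D y))%:E : \bar R).
    exact: (measurable_fun_pair2 th (measurable_squared_loss mD)).
  have l0 y : 0 <= (squared_loss th (D y))%:E :> \bar R by rewrite lee_fin squared_loss_ge0.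
  transitivity (\int[nun]_z (squared_loss th (D (add_tuple th z)))%:E).
    exact: (integral_obs_law s_gt0 th ml l0).
  transitivity (\int[nun]_z ((n.+1%:R^-1)%:E * \sum_(i < n.+1) L i (th, z))).
    by apply: eq_integral => z _; rewrite /squared_loss EFin_mean.
  apply: (ge0_integral_mean nun (F := fun i z => L i (th, z))) => [i|i z].
    exact: (measurable_fun_pair2 th (mL i)).
  exact: L0.
rewrite (ge0_integral_mean _ mI I0) -[leLHS](mean_cst n bayes_risk_ge0).
apply: le_mean => i.
exact: (bayes_risk_coordinate_le s_gt0 c_gt0 Gc i (mDi i)).
Qed.

Lemma integral_empirical_cdf n (mu : probability (n.+1.-tuple R) R) (t : R) :
  \int[mu]_th (empirical_cdf th t)%:E =
  (n.+1%:R^-1)%:E * \sum_(i < n.+1) mu [set th | (tnth th i <= t)%R].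
Proof.
have mS i : measurable [set th : n.+1.-tuple R | (tnth th i <= t)%R].
  rewrite (_ : [set _ | _] = (fun th : n.+1.-tuple R => tnth th i) @^-1` `]-oo, t]).
    by rewrite -[X in measurable X]setTI; exact: (measurable_tnth i).
  by apply/seteqP; split => th /=; rewrite in_itv.
transitivity (\int[mu]_th ((n.+1%:R^-1)%:E *
    \sum_(i < n.+1) (\1_[set th : n.+1.-tuple R | (tnth th i <= t)%R] th)%:E)).
  apply: eq_integral => th _; rewrite /empirical_cdf EFin_mean; congr (_ * _).
  by apply: eq_bigr => i _; rewrite indicE mem_setE.
rewrite ge0_integral_mean.
- by congr (_ * _); apply: eq_bigr => i _; rewrite integral_indic// setIT.
- by move=> i; apply/measurable_EFinP; exact: measurable_indic.
- by move=> i th; rewrite lee_fin.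
Qed.

Lemma tuple_prod_empirical_class n :
  empirical_class c G n.+1 (tuple_prod (fun _ : 'I_n.+1 => G)).
Proof.
split => [|t].
  rewrite (_ : [set _ | _] = [set th : n.+1.-tuple R | forall i, `](- c)%R, c[%classic (tnth th i)]).
    rewrite (tuple_prodE (fun=> G) (B := fun=> `](- c)%R, c[%classic))//.
    by rewrite big1// => i _; exact: G_supp.
  by apply/seteqP; split => th /= h i; have := h i; rewrite in_itv.
rewrite integral_empirical_cdf -[RHS](mean_cst n)//; congr (_ * _).
apply: eq_bigr => i _.
(* A condition on one coordinate is a box whose other sides are the whole line. *)
rewrite (_ : [set _ | _] = [set th : n.+1.-tuple R | forall j,
    (if j == i then `]-oo, t]%classic else setT) (tnth th j)]).
  rewrite (tuple_prodE (fun=> G) (B := fun j => if j == i then `]-oo, t]%classic else setT)).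
    rewrite (bigD1 i)//= eqxx big1 ?mule1// => j /negPf ->.
    exact: probability_setT.
  by move=> j; case: ifP.
apply/seteqP; split => th /= h; last by have := h i; rewrite eqxx /= in_itv.
by move=> j; case: eqP => // ->; rewrite /= in_itv.
Qed.

Lemma bayes_risk_le_minimax n : bayes_risk <= minimax_risk s c G n.+1.
Proof.
apply: le_ereal_inf_tmp => _ [D mD <-].
apply: le_trans (bayes_risk_le_risk mD) _.
apply: ereal_sup_ubound; exists (tuple_prod (fun _ : 'I_n.+1 => G)) => //.
exact: tuple_prod_empirical_class.
Qed.

End minimax_lower_bound.

(** * Risk of the plug-in rule *)

Section coordinate_laws.
Context (R : realType) (n : nat).
Local Open Scope ereal_scope.

(** Named so that a measurable-function structure can be attached, as [distribution] requires. *)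
Definition coordinate (i : 'I_n.+1) (th : n.+1.-tuple R) : R := tnth th i.

HB.instance Definition _ i := @isMeasurableFun.Build _ _ _ _
  (coordinate i) (@measurable_tnth _ R n.+1 i).

(** The average of the coordinate laws has the distribution function of [G], hence is [G], whatever
    the dependence between the coordinates. *)
Lemma integral_mean_coordinate (c : R) (G : probability R R) (mu : probability (n.+1.-tuple R) R)
    (f : R -> \bar R) :
  empirical_class c G n.+1 mu -> measurable_fun setT f -> (forall t, 0 <= f t) ->
  \int[mu]_th ((n.+1%:R^-1)%:E * \sum_(i < n.+1) f (tnth th i)) = \int[G]_t f t.
Proof.
move=> [_ muG] mf f0.
pose A := average_prob (fun i => distribution mu (coordinate i) : probability R R).
have AG : \int[A]_t f t = \int[G]_t f t.
  apply: eq_measure_integral => B mB _.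
  apply: (@eq_probability_itvNyc R A G) => // t.
  rewrite -muG integral_empirical_cdf [LHS]average_probE; congr (_ * _).
rewrite -AG ge0_integral_average_prob// ge0_integral_mean.
- congr (_ * _); apply: eq_bigr => i _.
  by rewrite (ge0_integral_distribution (coordinate i) mf f0).
- by move=> i; exact: (measurableT_comp mf (measurable_tnth i)).
- by move=> i th; exact: f0.
Qed.

End coordinate_laws.

Section risk_upper_bound.
Context (R : realType) (s c : R) (s_gt0 : 0 < s) (c_gt0 : 0 < c).
Variables (G : probability R R) (Gc : supported c G) (n : nat).
Local Open Scope ereal_scope.

Lemma risk_le_bayes_risk (mu : probability (n.+1.-tuple R) R) (D : decision_rule R n.+1) (B : R) :
  empirical_class c G n.+1 mu -> measurable_fun setT D -> (0 <= B)%R ->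
  (forall th : n.+1.-tuple R, (forall i, `|tnth th i| <= c)%R ->
    \int[obs_law s th]_y (squared_loss th (D y))%:E <=
    (n.+1%:R^-1)%:E * \sum_(i < n.+1)
      point_risk s (pmean s c (empirical_prob th)) (tnth th i) + B%:E) ->
  risk s mu D <= bayes_risk s c G + B%:E.
Proof.
move=> muG mD B0 DB.
have mpG : measurable_fun setT (pmean s c G) by exact: measurable_pmean.
pose rho := point_risk s (pmean s c G).
have mrho : measurable_fun setT rho by exact: measurable_point_risk.
have rho0 t : 0 <= rho t by exact: point_risk_ge0.
pose m (th : n.+1.-tuple R) := (n.+1%:R^-1)%:E * \sum_(i < n.+1) rho (tnth th i).
have mm : measurable_fun setT m.
  apply: measurable_funeM; apply: emeasurable_sum => i.
  exact: (measurableT_comp mrho (measurable_tnth i)).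
have m0 th : 0 <= m th by rewrite mule_ge0 ?lee_fin ?invr_ge0// sume_ge0.
have EG : \int[mu]_th m th = bayes_risk s c G by exact: (integral_mean_coordinate muG).
have le_m (th : n.+1.-tuple R) : (forall i, `|tnth th i| <= c)%R ->
    \int[obs_law s th]_y (squared_loss th (D y))%:E <= m th + B%:E.
  move=> thc; apply: (le_trans (DB th thc)); apply: leeD => //.
  have Hth : supported c (empirical_prob th) by exact: supported_empirical.
  have mth : measurable_fun setT (point_risk s (pmean s c (empirical_prob th))).
    by apply: measurable_point_risk => //; exact: measurable_pmean.
  have := bayes_risk_le s_gt0 c_gt0 Hth mpG.
  by rewrite (integral_empirical th mth (point_risk_ge0 _ _)) (integral_empirical th mrho rho0).
have mB : measurable_fun setT (fun th => m th + B%:E) by exact: emeasurable_funD.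
have BE : 0 <= B%:E :> \bar R by rewrite lee_fin.
rewrite -EG -[X in _ + X](integral_probability_cst mu) -ge0_integralD//.
have ml : measurable_fun setT
    (fun th : n.+1.-tuple R => \int[obs_law s th]_y (squared_loss th (D y))%:E).
  apply: (measurable_integral_obs_law s_gt0 (F := fun w => (squared_loss w.1 (D w.2))%:E)).
    exact: measurable_squared_loss.
  by move=> w; rewrite lee_fin squared_loss_ge0.
(* The pointwise bound concerns parameters in [[-c, c]]; under [mu] almost every tuple has all its
   entries there. *)
apply: ae_ge0_le_integral => //.
- by move=> th _; apply: integral_ge0 => y _; rewrite lee_fin squared_loss_ge0.
- by move=> th _; exact: adde_ge0.
pose S := [set th : n.+1.-tuple R | forall i, (-c < tnth th i < c)%R].
have mS : measurable S.
  rewrite (_ : S = [set th : n.+1.-tuple R | forall i, `](- c)%R, c[%classic (tnth th i)]).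
    by apply: (measurable_tuple_box (B := fun=> `](- c)%R, c[%classic)).
  by apply/seteqP; split => th /= h i; have := h i; rewrite in_itv.
exists (~` S); split; first exact: measurableC.
  apply: (eq_trans (probability_setC mu mS)).
  by rewrite [X in _ - X]muG.1 subee.
move=> th /= h Sth; apply: h => _; apply: le_m => i.
by rewrite ler_norml; have /andP[/ltW -> /ltW ->] := Sth i.
Qed.

End risk_upper_bound.

(** * Choice of the parameters and the rate *)

Section regret_rate.
Context (R : realType) (s c : R) (s_gt0 : 0 < s) (c_gt0 : 0 < c).
Notation M := (exp_moment_bound s c).

(** In order: the entropy of the net divided by [lam], the net precision, the central-difference
    error, and the tails, with 32 = 24 + 8. *)
Definition regret_constant (E : R) : R :=
  144 * s ^+ 4 * (E + 2) + 8 * c ^+ 2 +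
  3 * (3 * (s ^+ 2 / 2) ^+ 2 * (4 * (2 * c / s ^+ 2) ^+ 3) ^+ 2) + 32 * c ^+ 2 * M.

Lemma regret_boundE n (J : finType) (T l : R) : 0 < l ->
  regret_bound s c n J T l =
  n.+1%:R^-1 * (144 * s ^+ 4 * l^-1 ^+ 2) * (ln #|J|%:R + 3 / 2) + n.+1%:R^-1 * (8 * c ^+ 2) +
  3 * difference_error s c l + 24 * c ^+ 2 * M * expR (- T) + 8 * c ^+ 2 * M * (n.+1%:R * expR (- T)).
Proof.
move=> l0; rewrite /regret_bound /tilted_error.
have : n.+1%:R != 0 :> R by [].
have : l != 0 by rewrite gt_eqF.
have : s != 0 by rewrite gt_eqF.
move: (n.+1%:R) (difference_error _ _ _) (ln _) (expR (- T)) M => N D L e M'.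
clear - s_gt0 c_gt0.
by move=> s0 l0 N0; field; rewrite s0 l0 N0.
Qed.

Lemma difference_error_sqr (u : R) : 0 < u ->
  difference_error s c (u ^+ 2) =
  3 * (s ^+ 2 / 2) ^+ 2 * (4 * (2 * c / s ^+ 2) ^+ 3) ^+ 2 * u ^+ 8.
Proof.
move=> u0; rewrite /difference_error.
have : u != 0 by rewrite gt_eqF.
have : s != 0 by rewrite gt_eqF.
by clear - s_gt0 c_gt0; move=> s0 u0; field; rewrite s0 u0.
Qed.

(** In terms of u = 1 / x: the entropy term is u^16 x^4 x^2 = u^10, the net precision u^16, the
    tails at most u^16, and the central-difference error l^4 = u^8. The last one sets the rate. *)
Lemma regret_bound_le n (J : finType) (E x : R) : 0 <= E -> 1 <= x ->
  n.+1%:R = x ^+ 16 -> ln #|J|%:R <= E * x ^+ 2 ->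
  regret_bound s c n J (32 * x) (x^-1 ^+ 2) <= regret_constant E * x^-1 ^+ 8.
Proof.
move=> E0 x1 nx lnJ.
have x0 : 0 < x by exact: lt_le_trans x1.
pose u := x^-1; have u0 : 0 < u by rewrite invr_gt0.
have u1 : u <= 1 by rewrite invf_le1.
have ux : u * x = 1 by rewrite mulVf ?gt_eqF.
have uX (i j : nat) : (j <= i)%N -> u ^+ i <= u ^+ j.
  by move=> ij; apply: ler_wiXn2l => //; exact: ltW.
(* From exp x >= x. The power 32 leaves u^16 after multiplication by n + 1 = x^16. *)
have eT : expR (- (32 * x)) <= u ^+ 32.
  rewrite expRN -/u exprVn lef_pV2 ?posrE ?expR_gt0 ?exprn_gt0//.
  rewrite expRM_natl lerXn2r ?nnegrE ?expR_ge0 ?(ltW x0)//.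
  by apply: le_trans (expR_ge1Dx _); rewrite lerDr.
rewrite regret_boundE ?exprn_gt0// difference_error_sqr// -/u nx /regret_constant.
have M0 : 0 <= M by exact: expR_ge0.
have e0 : 0 <= expR (- (32 * x)) by exact: expR_ge0.
have Nu : (x ^+ 16)^-1 = u ^+ 16 by rewrite exprVn.
have lu : (u ^+ 2)^-1 ^+ 2 = x ^+ 4 by rewrite /u -!exprVn invrK -exprM.
rewrite Nu lu.
clearbody u.
have A1 : u ^+ 16 * (144 * s ^+ 4 * x ^+ 4) * (ln #|J|%:R + 3 / 2) <=
    144 * s ^+ 4 * (E + 2) * u ^+ 8.
  have x2 : 1 <= x ^+ 2 by exact: exprn_ege1.
  have L2 : ln #|J|%:R + 3 / 2 <= (E + 2) * x ^+ 2 by rewrite mulrDl; lra.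
  have k0 : 0 <= u ^+ 16 * (144 * s ^+ 4 * x ^+ 4).
    by rewrite !mulr_ge0 ?exprn_ge0// ltW.
  apply: (le_trans (ler_wpM2l k0 L2)).
  have -> : u ^+ 16 * (144 * s ^+ 4 * x ^+ 4) * ((E + 2) * x ^+ 2) =
      144 * s ^+ 4 * (E + 2) * (u ^+ 10 * (u * x) ^+ 6) by ring.
  rewrite ux expr1n mulr1; apply: ler_wpM2l; last exact: uX.
  by rewrite !mulr_ge0 ?exprn_ge0 ?addr_ge0// ltW.
have A4 : u ^+ 16 * (8 * c ^+ 2) <= 8 * c ^+ 2 * u ^+ 8.
  by rewrite mulrC ler_wpM2l ?uX// mulr_ge0// sqr_ge0.
have A3 : 24 * c ^+ 2 * M * expR (- (32 * x)) <= 24 * c ^+ 2 * M * u ^+ 8.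
  apply: ler_wpM2l; first by apply: mulr_ge0 => //; rewrite mulr_ge0// sqr_ge0.
  by apply: (le_trans eT); exact: uX.
have A5 : 8 * c ^+ 2 * M * (x ^+ 16 * expR (- (32 * x))) <= 8 * c ^+ 2 * M * u ^+ 8.
  apply: ler_wpM2l; first by apply: mulr_ge0 => //; rewrite mulr_ge0// sqr_ge0.
  apply: (@le_trans _ _ (x ^+ 16 * u ^+ 32)); first by apply: ler_wpM2l => //; exact/exprn_ge0/ltW.
  have -> : x ^+ 16 * u ^+ 32 = (u * x) ^+ 16 * u ^+ 16 by ring.
  by rewrite ux expr1n mul1r uX.
set D := 3 * (s ^+ 2 / 2) ^+ 2 * _.
have -> : (144 * s ^+ 4 * (E + 2) + 8 * c ^+ 2 + 3 * D + 32 * c ^+ 2 * M) * u ^+ 8 =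
    144 * s ^+ 4 * (E + 2) * u ^+ 8 + 8 * c ^+ 2 * u ^+ 8 + 3 * (D * u ^+ 8) +
    24 * c ^+ 2 * M * u ^+ 8 + 8 * c ^+ 2 * M * u ^+ 8 by ring.
by rewrite !lerD.
Qed.

End regret_rate.

Section minimax_regret.
Context (R : realType) (s c : R) (s_gt0 : 0 < s) (c_gt0 : 0 < c).

(** A sum of nonnegative lower bounds for x, one for each side condition on [l] and [lam]. The 33 is
    32 from T = 32 x plus 1 for the summand [l]. *)
Definition threshold : R := 1 + (c + 33) / s ^+ 2 + 2 * c / s ^+ 2 + 16 * c ^+ 2 / (144 * s ^+ 4).

Lemma threshold_conditions (x : R) : threshold <= x ->
  let l := x^-1 ^+ 2 in
  [/\ 1 <= x, l * (c + 32 * x + l) / s ^+ 2 <= 1, 2 * l * c / s ^+ 2 <= 1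
    & l ^+ 2 / (144 * s ^+ 4) * (16 * c ^+ 2) <= 1].
Proof.
move=> xt l.
have s2 : 0 < s ^+ 2 by exact: exprn_gt0.
have s4 : 0 < 144 * s ^+ 4 by rewrite mulr_gt0// exprn_gt0.
have a1 : 0 <= (c + 33) / s ^+ 2 by rewrite divr_ge0 ?(ltW s2)// addr_ge0// ltW.
have a2 : 0 <= 2 * c / s ^+ 2 by rewrite divr_ge0 ?(ltW s2)// mulr_ge0// ltW.
have a3 : 0 <= 16 * c ^+ 2 / (144 * s ^+ 4) by rewrite divr_ge0 ?(ltW s4)// mulr_ge0// sqr_ge0.
have [x1 b1 b2 b3] : [/\ 1 <= x, (c + 33) / s ^+ 2 <= x, 2 * c / s ^+ 2 <= x
    & 16 * c ^+ 2 / (144 * s ^+ 4) <= x].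
  by move: xt; rewrite /threshold; split; lra.
have x0 : 0 < x by exact: lt_le_trans x1.
rewrite {}/l; move: (mulVf (lt0r_neq0 x0)).
have : 0 < x^-1 by rewrite invr_gt0.
have : x^-1 <= 1 by rewrite invf_le1.
move: (x^-1) => u u1 u0 ux.
have uB (b : R) : b <= x -> u * b <= 1.
  by move=> bx; rewrite -ux; apply: ler_wpM2l => //; exact: ltW.
have u21 : u ^+ 2 <= 1 by rewrite exprn_ile1// ltW.
have u2u : u ^+ 2 <= u by rewrite expr2 ler_piMr// ltW.
split => //.
- apply: le_trans (uB _ b1); rewrite mulrA ler_pM2r ?invr_gt0//.
  rewrite [leRHS]mulrDr mulrDr mulrDr.
  have -> : u ^+ 2 * (32 * x) = 32 * u * (u * x) by ring.
  rewrite ux mulr1.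
  have h1 : u ^+ 2 * c <= u * c by rewrite ler_pM2r.
  have h2 : u ^+ 2 * u ^+ 2 <= u by apply: le_trans u2u; rewrite ler_piMr// sqr_ge0.
  by lra.
- apply: le_trans (uB _ b2).
  have -> : 2 * u ^+ 2 * c / s ^+ 2 = u ^+ 2 * (2 * c / s ^+ 2) by ring.
  by rewrite ler_wpM2r.
- apply: le_trans (uB _ b3); rewrite mulrAC -mulrA.
  have u4u : (u ^+ 2) ^+ 2 <= u by apply: le_trans u2u; rewrite expr2 ler_piMr// sqr_ge0.
  by rewrite ler_wpM2r.
Qed.

(** The left side is N^(-1/2), and ln N >= 1 because N >= 4 >= exp 1. *)
Lemma inv_sqrt_le_rate (x N : R) : 0 < x -> N = x ^+ 16 -> 4 <= N ->
  x^-1 ^+ 8 <= Num.sqrt (ln N / N).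
Proof.
move=> x0 Nx N4; have N0 : 0 < N by exact: lt_le_trans N4.
have lnN : 1 <= ln N.
  by rewrite -[leLHS]expRK ler_ln ?posrE ?expR_gt0// (le_trans (expR1_le4 R)).
have -> : x^-1 ^+ 8 = Num.sqrt N^-1.
  have x8 : 0 <= x^-1 ^+ 8 by rewrite exprn_ge0// invr_ge0 ltW.
  rewrite -[LHS]ger0_norm// -sqrtr_sqr -exprM Nx exprVn.
  by [].
by apply: ler_wsqrtr; rewrite ler_peMl// invr_ge0 ltW.
Qed.

Lemma minimax_regret_le (G : probability R R) : G `]-c, c[%classic = 1%E ->
  exists K : R, \forall n \near \oo, forall (mu : probability (n.-tuple R) R)
      (Ghat : n.-tuple R -> probability R R),
    empirical_class c G n mu -> (forall y, is_npmle s c y (Ghat y)) ->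
    measurable_fun setT (plugin_rule s Ghat) ->
    (risk s mu (plugin_rule s Ghat) <=
      minimax_risk s c G n + (K * Num.sqrt (ln n%:R / n%:R))%:E)%E.
Proof.
move=> G1; have Gc : supported c G by exact: supported_itv_oo.
have [C C0 coverC] := marginal_net s_gt0 c_gt0.
(* 48 = 32 + 16, as T = 32 x and - ln w = ln N <= 16 x. *)
pose E := C * 48 ^+ 2.
have E0 : 0 <= E by rewrite mulr_ge0// ltW.
have K0 : 0 <= regret_constant s c E.
  have s4 : 0 <= s ^+ 4 by exact/exprn_ge0/ltW.
  rewrite /regret_constant !addr_ge0//.
  - by apply: mulr_ge0; [rewrite mulr_ge0|rewrite addr_ge0].
  - by rewrite mulr_ge0// sqr_ge0.
  - by rewrite mulr_ge0// mulr_ge0 ?sqr_ge0// mulr_ge0 ?sqr_ge0.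
  - by apply: mulr_ge0; [rewrite mulr_ge0// sqr_ge0|exact: expR_ge0].
exists (regret_constant s c E).
(* The 4 makes ln n at least 1 and excludes n = 0; the other summand makes the sixteenth root of n
   exceed [threshold]. *)
suff bound n : 4 + threshold ^+ 16 <= n%:R -> forall (mu : probability (n.-tuple R) R)
    (Ghat : n.-tuple R -> probability R R),
    empirical_class c G n mu -> (forall y, is_npmle s c y (Ghat y)) ->
    measurable_fun setT (plugin_rule s Ghat) ->
    (risk s mu (plugin_rule s Ghat) <= minimax_risk s c G n +
      (regret_constant s c E * Num.sqrt (ln n%:R / n%:R))%:E)%E.
  by near=> n; apply: bound; near: n; exact: nbhs_infty_ger.
case: n => [|n] nB.
  by exfalso; move: nB; apply/negP; rewrite -ltNge ltr_wpDr// exprn_even_ge0.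
move=> mu Ghat muG np mplug.
pose N : R := n.+1%:R; rewrite -/N in nB *.
pose x := N `^ 16^-1.
have N0 : 0 < N by [].
have x0 : 0 < x by exact: powR_gt0.
have Nx : N = x ^+ 16.
  by rewrite -powR_mulrn ?(ltW x0)// /x -powRrM mulVf// powRr1// ltW.
have thx : threshold <= x.
  rewrite leNgt; apply/negP => xt.
  have : x ^+ 16 < threshold ^+ 16 by rewrite ltrXn2r ?(ltW x0).
  by rewrite -Nx; lra.
have [x1 h1 h2 h3] := threshold_conditions thx.
have lnN : ln N <= 16 * x.
  rewrite Nx lnXn// -[leLHS]mulr_natl ler_wpM2l//.
  have xE : x = 1 + (x - 1) by ring.
  have xm1 : -1 < x - 1 by lra.
  by rewrite {1}xE (le_trans (le_ln1Dx xm1)) ?gerBl.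
have N1 : 1 <= N by rewrite ler1n.
have [||| J [Hs [Hsc J0 lnJ coverP]]] := coverC (32 * x) N^-1.
- by lra.
- by rewrite invr_gt0.
- by rewrite invf_le1.
have lnJ' : ln #|J|%:R <= E * x ^+ 2.
  apply: (le_trans lnJ); rewrite /E -mulrA -exprMn.
  apply: ler_wpM2l; first exact: ltW.
  rewrite lnV ?posrE// opprK lerXn2r ?nnegrE ?addr_ge0 ?ln_ge0 ?mulr_ge0 ?(ltW x0)//.
  by lra.
have l0 : 0 < x^-1 ^+ 2 by rewrite exprn_gt0// invr_gt0.
have T0 : 0 <= 32 * x by rewrite mulr_ge0// ltW.
have RB := regret_bound_le c s_gt0 E0 x1 Nx lnJ'.
have KB : regret_bound s c n J (32 * x) (x^-1 ^+ 2) <=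
    regret_constant s c E * Num.sqrt (ln N / N).
  apply: (le_trans RB); apply: ler_wpM2l => //.
  apply: inv_sqrt_le_rate => //.
  by apply: le_trans nB; rewrite lerDl exprn_even_ge0.
have B0 : 0 <= regret_constant s c E * Num.sqrt (ln N / N) by rewrite mulr_ge0 ?sqrtr_ge0.
apply: (@le_trans _ _ (bayes_risk s c G +
    (regret_constant s c E * Num.sqrt (ln N / N))%:E)%E); last first.
  by apply: leeD => //; exact: bayes_risk_le_minimax.
apply: risk_le_bayes_risk => // th thc.
apply: le_trans (conditional_risk_le s_gt0 c_gt0 thc J0 Hsc coverP l0 T0 h1 h2 h3 np) _.
by apply: leeD => //; rewrite lee_fin.
Unshelve. all: by end_near.
Qed.

End minimax_regret.

Theorem theorem4p2 (R : realType) (sigma c : R) (G : probability R R)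
    (sigma_gt0 : 0 < sigma) (c_gt0 : 0 < c)
    (G_supp : G `]-c, c[%classic = 1%E)
    (G_moment2_gt0 : (0 < \int[G]_t (t ^+ 2)%:E)%E) :
  exists K : R, \forall n \near \oo,
    forall (mu : probability (n.-tuple R) R)
           (Ghat : n.-tuple R -> probability R R),
      empirical_class c G n mu ->
      (forall y : n.-tuple R, is_npmle sigma c y (Ghat y)) ->
      measurable_fun setT (plugin_rule sigma Ghat) ->
      (risk sigma mu (plugin_rule sigma Ghat) <=
         minimax_risk sigma c G n + (K * Num.sqrt (ln n%:R / n%:R))%:E)%E.
Proof. exact: minimax_regret_le. Qed.
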